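(* Let $\nu\ge2$ and $C_1,C_2>0$. Assume that $m\in\mathcal{F}(\nu,C_1)$, $f\in\mathcal{F}(\nu-1,C_2)$ and $\inf_{x\in\mathcal{I}}f(x)>0$, where $\mathcal{I}=[0,1]$. Let $r\ge\lfloor\nu/2\rfloor$ be an integer, and let $\hat{m}_r$ be the $L_2$ boosting estimate updated at the $r$th iteration with the Nadaraya--Watson smoother as learner. Then $$E[\hat{m}_r(x)|X_1,\ldots,X_n]-m(x)=O_p\left(h^\nu+\sqrt{\frac{h\log n}{n}}\right)$$ uniformly for $x\in\mathcal{I}_\varepsilon$ for arbitrarily small $\varepsilon>0$.
   Context: $(X_1,Y_1),\ldots,(X_n,Y_n)$ are independent and identically distributed copies of a pair $(X,Y)$ of real random variables; $X$ has marginal density $f$ supported on $\mathcal{I}=[0,1]$, and $m(x)=E(Y|X=x)$ is the regression function. The kernel $K$ is a symmetric probability density function which is Lipschitz continuous and supported on $[-1,1]$. The bandwidth $h=h_n>0$ is a deterministic sequence with $h\to0$ and $nh/\log n\to\infty$ as $n\to\infty$, and $K_h(u)=K(u/h)/h$. Convention: $\lfloor a\rfloor$ denotes the largest integer that is (strictly) less than $a$ (so, e.g., $\lfloor 1\rfloor=0$, $\lfloor 2\rfloor=1$). Function class: for $\nu>0$ and $C>0$, $$\mathcal{F}(\nu,C)=\left\{g:\ |g^{(\lfloor\nu\rfloor)}(x)-g^{(\lfloor\nu\rfloor)}(x')|\le C|x-x'|^{\nu-\lfloor\nu\rfloor}\ \text{for all } x,x'\in\mathcal{I}\right\},$$ where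 the functions $g$ on $\mathcal{I}$ are $\lfloor\nu\rfloor$ times differentiable. $L_2$ boosting with the Nadaraya--Watson learner: with weights $w_i(x)=K_h(X_i-x)/\sum_{k=1}^nK_h(X_k-x)$, the initial estimate is $\hat{m}_0(x)=\sum_{i=1}^nw_i(x)Y_i$, and for $r\ge1$, $$\hat{m}_r(x)=\hat{m}_{r-1}(x)+\sum_{i=1}^nw_i(x)\left[Y_i-\hat{m}_{r-1}(X_i)\right].$$ For $\varepsilon>0$, $\mathcal{I}_\varepsilon=[\varepsilon,1-\varepsilon]$. ''Uniformly for $x\in\mathcal{I}_\varepsilon$ for arbitrarily small $\varepsilon>0$'' means that for every sufficiently small fixed $\varepsilon>0$ the supremum over $x\in\mathcal{I}_\varepsilon$ of the absolute value of the left-hand side is of the stated $O_p$ order as $n\to\infty$. *)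

(* Defs.v *)
From HB Require Import structures.
From mathcomp Require Import all_boot all_order all_algebra finmap.
From mathcomp Require Import all_classical all_reals all_analysis.

Set Implicit Arguments.
Unset Strict Implicit.
Unset Printing Implicit Defensive.

Import Order.TTheory GRing.Theory Num.Theory.
Import numFieldNormedType.Exports.

Local Open Scope classical_set_scope.
Local Open Scope ring_scope.

Section function_classes.
Context {R : realType}.

(* The largest integer strictly less than a, so that sfloor 2 = 1. *)
Definition sfloor (a : R) : int := Num.ceil a - 1.

Definition unit_interval : set R := `[0, 1].

(* Differentiation of functions on [0, 1], one-sided at 0 and 1: the values of
   g outside [0, 1] are irrelevant.  This matters for a density, which may jump
   to 0 at the endpoints. *)
Definition diff_quotient (g : R -> R) (x y : R) : R := (g y - g x) / (y - x).

Definition derivable_unit (g : R -> R) (x : R) : Prop :=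
  cvg (diff_quotient g x y @[y --> within unit_interval x^']).

Definition deriv_unit (g : R -> R) (x : R) : R :=
  lim (diff_quotient g x y @[y --> within unit_interval x^']).

Definition holder_class (nu C : R) (g : R -> R) : Prop :=
  (forall j : nat, (j < `|sfloor nu|)%N ->
    forall x, unit_interval x -> derivable_unit (iter j deriv_unit g) x) /\
  (forall x x', unit_interval x -> unit_interval x' ->
    `| iter `|sfloor nu|%N deriv_unit g x - iter `|sfloor nu|%N deriv_unit g x' |
      <= C * `|x - x'| `^ (nu - (sfloor nu)%:~R)).

Definition smoothing_kernel (K : R -> R) : Prop :=
  [/\ forall u, 0 <= K u,
      forall u, K (- u) = K u,
      (\int[lebesgue_measure]_u (K u)%:E = 1)%E,
      exists L : R, L.-lipschitz K &
      forall u, 1 < `|u| -> K u = 0].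

End function_classes.

Section L2_boosting.
Context {R : realType}.

(* The sample of size n is (xs 0, ys 0), ..., (xs n.-1, ys n.-1). *)
Definition scaled_kernel (K : R -> R) (h u : R) : R := K (u / h) / h.

Definition kernel_sum (K : R -> R) (h : R) (n : nat) (xs : nat -> R) (x : R) : R :=
  \sum_(k < n) scaled_kernel K h (xs k - x).

(* All weights are 0 when kernel_sum vanishes, because 0^-1 = 0. *)
Definition nw_weight (K : R -> R) (h : R) (n : nat) (xs : nat -> R)
    (i : nat) (x : R) : R :=
  scaled_kernel K h (xs i - x) / kernel_sum K h n xs x.

Fixpoint boosting (K : R -> R) (h : R) (n : nat) (xs ys : nat -> R)
    (r : nat) (x : R) : R :=
  match r with
  | 0%N => \sum_(i < n) nw_weight K h n xs i x * ys i
  | r'.+1 => boosting K h n xs ys r' x +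
      \sum_(i < n) nw_weight K h n xs i x *
        (ys i - boosting K h n xs ys r' (xs i))
  end.

End L2_boosting.

Section probability.
Context {R : realType} {d : measure_display} {T : measurableType d}.
Variable P : probability T R.

Definition iid_copies (Xs Ys : nat -> {RV P >-> R}) (X Y : {RV P >-> R}) : Prop :=
  (forall (i : nat) (B : set (R * R)), measurable B ->
    P [set w | B (Xs i w, Ys i w)] = P [set w | B (X w, Y w)]) /\
  (forall (J : {fset nat}) (B : nat -> set (R * R)),
    (forall i, measurable (B i)) ->
    P (\bigcap_(i in [set` J]) [set w | B i (Xs i w, Ys i w)]) =
    (\prod_(i <- J) P [set w | B i (Xs i w, Ys i w)])%E).

Definition has_density (X : {RV P >-> R}) (f : R -> R) : Prop :=
  [/\ measurable_fun setT f,
      forall x, 0 <= f x &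
      forall B : set R, measurable B ->
        distribution P X B = (\int[lebesgue_measure]_(x in B) (f x)%:E)%E].

Definition sigma_rv (X : T -> R) : set (set T) :=
  preimage_set_system setT X measurable.

Definition sigma_sample (Xs : nat -> T -> R) (n : nat) : set (set T) :=
  <<s \bigcup_(i in `I_n) sigma_rv (Xs i) >>.

(* Z is a version of E[W | G], for G a sub-sigma-algebra. *)
Definition is_cond_exp (G : set (set T)) (W Z : T -> R) : Prop :=
  [/\ P.-integrable setT (EFin \o W),
      P.-integrable setT (EFin \o Z),
      forall B : set R, measurable B -> G (Z @^-1` B) &
      forall A, G A ->
        (\int[P]_(w in A) (Z w)%:E = \int[P]_(w in A) (W w)%:E)%E].

Definition regression_function (X Y : {RV P >-> R}) (m : R -> R) : Prop :=
  measurable_fun setT m /\ is_cond_exp (sigma_rv X) Y (m \o X).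

(* Z n x is a version of the conditional expectation given X_1, ..., X_n of the
   boosting estimate at x from the sample of size n.  Each Z n x being
   determined only up to a null set that depends on x, a supremum over x makes
   sense only for a version with regular paths.  The weights are continuous at
   every x where kernel_sum is positive, and the version is required to
   have this continuity; any two such versions agree almost surely at all these
   x simultaneously.  Such a version is given by the boosting estimate computed
   from the responses m (X_i). *)
Definition boosting_cond_exp (K : R -> R) (h : nat -> R)
    (Xs Ys : nat -> {RV P >-> R}) (r : nat) (Z : nat -> R -> T -> R) : Prop :=
  (forall n x, is_cond_exp (sigma_sample Xs n)
    (fun w => boosting K (h n) n (Xs ^~ w) (Ys ^~ w) r x) (Z n x)) /\
  {ae P, forall w, forall n x,
    0 < kernel_sum K (h n) n (Xs ^~ w) x -> {for x, continuous (Z n ^~ w)}}.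

(* S n = O_p(a n).  The S n are not required to be measurable: the bound is on
   the outer probability of exceeding M * a n. *)
Definition stochastic_bigO (S : nat -> T -> \bar R) (a : nat -> R) : Prop :=
  forall delta : R, 0 < delta ->
    exists2 M : R, 0 < M &
      \forall n \near \oo, exists A : set T,
        [/\ measurable A, (P A <= delta%:E)%E &
            [set w | ((M * a n)%:E < S n w)%E] `<=` A].

End probability.

(* Main.v *)
Require Import Defs.
From HB Require Import structures.
From mathcomp Require Import all_boot all_order all_algebra finmap.
From mathcomp Require Import all_classical all_reals all_analysis.
From mathcomp Require Import measurable_realfun.
From mathcomp Require Import ring lra zify.
Import Order.TTheory GRing.Theory Num.Theory.
Import numFieldNormedType.Exports.
Local Open Scope classical_set_scope.
Local Open Scope ring_scope.

(** Let [S] be the Nadaraya-Watson smoother of the sample, [S g y] being the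
    weighted mean of the [g (X_i)] with the weights at [y]. The boosting estimate
    is linear in the responses, with coefficients that depend on the design only;
    so its conditional expectation is the estimate computed from the responses
    [m (X_i)] ([boosting_cond_expE]), and its bias at [x] is the value at [x] of
    [- (1 - S) ^ (r + 1) m] ([boosting_residual]). Let [S0] be the population
    smoother, the ratio of the expectations of numerator and denominator. With
    [rho = sqrt (ln n / (n h))], the two terms of the rate [h ^ nu + h rho] come from
    [S0] and from [S - S0].

    Bias: [(1 - S0) ^ (r + 1) m] is [O(h ^ nu)] ([pop_bias]). A symmetric kernel gains
    two powers of [h] per application of [1 - S0] to a smooth function, but [m] and
    [f] are only Hoelder and the smoothed functions inherit no derivative bounds
    that could be iterated. Instead, in a window of a fixed number of bandwidths
    around [x], both are compared with their Taylor polynomials, written in the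
    position [s] measured in bandwidths ([holder_expansion], [expansion_graded]). On
    polynomials [1 - S0] is explicit, the reciprocal of the denominator being
    expanded in a geometric series ([graded_inverse_mass]), and every application
    gains exactly two powers of [h] ([graded_residual]). The density is approximated
    one order less well than [m], with error [O(h ^ (nu - 1))], but this error is
    only ever multiplied by increments over one bandwidth, which are [O(h)]
    ([bias_step]). Since [2 (r + 1) >= nu], all that is left is [O(h ^ nu)].

    Fluctuation: since averaging does not increase the supremum norm, the difference
    of [(1 - S) ^ k] and [(1 - S0) ^ k] telescopes into terms [(S - S0) u] for the
    deterministic functions [u = (1 - S0) ^ j m] ([residual_gap]). Such a [u] varies
    by [O(h)] over a bandwidth, and [S - S0] vanishes on constants; the exponential
    inequality with the variance of the kernel weights ([deviation]) and a union
    bound over a fine grid give [(S - S0) u = O(h rho)] uniformly, outside an event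
    of probability [O(1 / n)] ([smoother_error], [boosting_rate]).

    Finally, a conditional expectation is determined only up to a null set that
    depends on [x]; continuity in [x] of the version and of the estimate, wherever
    the kernel sum is positive, gives one null set for all [x]
    ([boosting_version]). *)

Set Implicit Arguments.
Unset Strict Implicit.
Unset Printing Implicit Defensive.

(** * Kernel-weighted integrals *)

Section kernel.
Context {R : realType}.
Variable K : R -> R.
Hypothesis kerK : smoothing_kernel K.

Lemma kernel_lipschitz :
  exists2 L : R, 0 < L & forall u v, `|K u - K v| <= L * `|u - v|.
Proof.
have [_ _ _ [L lipL] _] := kerK.
exists (`|L| + 1) => [|u v]; first by rewrite ltr_wpDl.
have /= := lipL (u, v) (conj I I) => /le_trans; apply.
by rewrite ler_wpM2r// (le_trans (ler_norm _))// lerDl.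
Qed.

Lemma kernel_continuous : continuous K.
Proof.
have [L L0 hL] := kernel_lipschitz.
move=> u; apply/cvgrPdist_le => e e0; near=> v.
rewrite (le_trans (hL _ _))// mulrC -ler_pdivlMr//.
by near: v; apply: cvgr_dist_le; [exact: cvg_id|rewrite divr_gt0].
Unshelve. all: by end_near. Qed.

Lemma kernel_measurable : measurable_fun setT K.
Proof. by apply: continuous_measurable_fun; exact: kernel_continuous. Qed.

Lemma kernel_bounded : exists2 k : R, 0 < k & forall u, K u <= k.
Proof.
have [L L0 hL] := kernel_lipschitz; have [K0 _ _ _ Ks] := kerK.
exists (L * 3) => [|u]; first by rewrite mulr_gt0.
have K2 : K 2 = 0 by apply: Ks; rewrite ger0_norm// ltr1n.
have [u1|u1] := leP `|u| 1; last by rewrite Ks// mulr_ge0// ltW.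
rewrite -[K u]subr0 -K2 (le_trans (ler_norm _))// (le_trans (hL _ _))//.
rewrite ler_wpM2l ?(ltW L0)// (le_trans (ler_normB _ _))//.
by rewrite (ger0_norm (ler0n _ 2)); lra.
Qed.

Lemma scaled_kernel_measurable (h y : R) :
  measurable_fun setT (fun t : R => K ((t - y) / h)).
Proof.
apply: measurableT_comp; first exact: kernel_measurable.
by apply: measurable_funM => //; apply: measurable_funB.
Qed.

Lemma kernel_out (h t y : R) : 0 < h -> h < `|t - y| -> K ((t - y) / h) = 0.
Proof.
have [_ _ _ _ Ks] := kerK => h0 ht; apply: Ks.
by rewrite normrM normfV (gtr0_norm h0) ltr_pdivlMr// mul1r.
Qed.

(** Both the law of the design points, through [xi = X] on the sample space, and
    the Lebesgue measure, through [xi = id], are integrated against the kernel. *)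
Definition local_int d (T : measurableType d) (mu : {measure set T -> \bar R})
    (xi : T -> R) (h y : R) (g : R -> R) : R :=
  \int[mu]_w (K ((xi w - y) / h) * g (xi w)).

Definition locally_bounded (h y : R) (g : R -> R) :=
  measurable_fun setT g /\ exists B : R, forall t : R, `|t - y| <= h -> `|g t| <= B.

Section local_int.
Context d (T : measurableType d) (mu : {measure set T -> \bar R}).
Variables (xi : T -> R) (h y : R).
Hypothesis mxi : measurable_fun setT xi.
Hypothesis h0 : 0 < h.
Hypothesis mu_fin : (mu (xi @^-1` `[(y - h)%R, (y + h)%R]) < +oo)%E.

Lemma local_int_integrable g : locally_bounded h y g ->
  mu.-integrable setT (fun w => (K ((xi w - y) / h) * g (xi w))%:E).
Proof.
move=> [mg [B gB]]; have [K0 _ _ _ Ks] := kerK.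
have [k k0 hk] := kernel_bounded.
have mD : measurable (xi @^-1` `[(y - h)%R, (y + h)%R]).
  by rewrite -[X in measurable X]setTI; apply: mxi => //; exact: measurable_itv.
have mKg : measurable_fun setT (fun w => K ((xi w - y) / h) * g (xi w)).
  apply: (@measurableT_comp _ _ _ _ _ _ (fun t : R => K ((t - y) / h) * g t)) => //.
  by apply: measurable_funM => //; exact: scaled_kernel_measurable.
apply: (@le_integrable _ _ _ mu setT measurableT _
  (fun w => (k * `|B|)%:E * (\1_(xi @^-1` `[(y - h)%R, (y + h)%R]) w)%:E)%E).
- exact/measurable_EFinP.
- move=> t _; rewrite /= lee_fin; have [ty|ty] := leP `|xi t - y| h.
    rewrite indicE mem_set ?mulr1; last first.
      by move: ty; rewrite /= in_itv/= ler_distl => /andP[-> ->].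
    rewrite [leRHS]ger0_norm ?mulr_ge0 ?(ltW k0)//.
    rewrite normrM (ger0_norm (K0 _)) ler_pM//.
    by rewrite (le_trans (gB _ ty))// ler_norm.
  by rewrite kernel_out// mul0r normr0.
- apply: integrableZl => //.
  apply/integrableP; split; first exact/measurable_EFinP/measurable_indic.
  under eq_integral do rewrite gee0_abs ?lee_fin//.
  by rewrite integral_indic// setIT.
Qed.

Lemma local_intD g1 g2 : locally_bounded h y g1 -> locally_bounded h y g2 ->
  local_int mu xi h y (fun t : R => g1 t + g2 t) = local_int mu xi h y g1 + local_int mu xi h y g2.
Proof.
move=> b1 b2; rewrite /local_int -RintegralD//; [|exact: local_int_integrable..].
by apply: eq_Rintegral => t _; rewrite mulrDr.
Qed.

Lemma local_intZ c g : locally_bounded h y g ->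
  local_int mu xi h y (fun t : R => c * g t) = c * local_int mu xi h y g.
Proof.
move=> b1; rewrite /local_int -RintegralZl//; [|exact: local_int_integrable..].
by apply: eq_Rintegral => t _; rewrite mulrCA.
Qed.

Lemma local_intB g1 g2 : locally_bounded h y g1 -> locally_bounded h y g2 ->
  local_int mu xi h y (fun t : R => g1 t - g2 t) = local_int mu xi h y g1 - local_int mu xi h y g2.
Proof.
move=> b1 b2; rewrite /local_int -RintegralB//; [|exact: local_int_integrable..].
by apply: eq_Rintegral => t _; rewrite mulrBr.
Qed.

Lemma locally_bounded_cst c : locally_bounded h y (cst c).
Proof. by split; [exact: measurable_cst|exists `|c|]. Qed.

Lemma locally_boundedD g1 g2 : locally_bounded h y g1 -> locally_bounded h y g2 ->
  locally_bounded h y (fun t : R => g1 t + g2 t).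
Proof.
move=> [m1 [B1 b1]] [m2 [B2 b2]]; split; first exact: measurable_funD.
exists (B1 + B2) => t ty; rewrite (le_trans (ler_normD _ _))// lerD//.
  exact: b1.
exact: b2.
Qed.

Lemma locally_boundedM g1 g2 : locally_bounded h y g1 -> locally_bounded h y g2 ->
  locally_bounded h y (fun t : R => g1 t * g2 t).
Proof.
move=> [m1 [B1 b1]] [m2 [B2 b2]]; split; first exact: measurable_funM.
by exists (B1 * B2) => t ty; rewrite normrM ler_pM//; [exact: b1|exact: b2].
Qed.

Lemma locally_boundedB g1 g2 : locally_bounded h y g1 -> locally_bounded h y g2 ->
  locally_bounded h y (fun t : R => g1 t - g2 t).
Proof.
move=> b1 [m2 [B2 b2]]; apply: locally_boundedD => //; split.
  exact: measurable_funN.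
by exists B2 => t ty; rewrite normrN b2.
Qed.

Lemma local_int_ge0 g : (forall t, `|t - y| <= h -> 0 <= g t) ->
  0 <= local_int mu xi h y g.
Proof.
have [K0 _ _ _ _] := kerK.
move=> g0; apply: Rintegral_ge0 => t _.
have [/g0|ty] := leP `|xi t - y| h; first exact: mulr_ge0.
by rewrite kernel_out// mul0r.
Qed.

Lemma le_local_int g1 g2 : locally_bounded h y g1 -> locally_bounded h y g2 ->
  (forall t, `|t - y| <= h -> g1 t <= g2 t) ->
  local_int mu xi h y g1 <= local_int mu xi h y g2.
Proof.
move=> b1 b2 g12; rewrite -subr_ge0 -local_intB//; apply: local_int_ge0 => t ty.
by rewrite subr_ge0 g12.
Qed.

(** The kernel is nonnegative, so a kernel-weighted integral obeys the triangle
    inequality with a possibly non-constant majorant. *)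
Lemma local_int_norm g (G : R -> R) : locally_bounded h y g ->
  locally_bounded h y G ->
  (forall t, `|t - y| <= h -> `|g t| <= G t) ->
  `|local_int mu xi h y g| <= local_int mu xi h y G.
Proof.
move=> bg bG gG; have bN : locally_bounded h y (fun t : R => -1 * G t).
  by apply: locally_boundedM bG; exact: locally_bounded_cst.
have leN : - local_int mu xi h y G <= local_int mu xi h y g.
  rewrite -mulN1r -local_intZ//; apply: le_local_int => // t /gG.
  by rewrite mulN1r ler_norml => /andP[].
rewrite ler_norml leN/=; apply: le_local_int => // t /gG.
by rewrite ler_norml => /andP[].
Qed.

End local_int.

Lemma locally_bounded_continuous h y (g : R -> R) : continuous g -> locally_bounded h y g.
Proof.
move=> cg; split; first exact: continuous_measurable_fun.
have : compact (g @` `[y - h, y + h]%classic).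
  apply: continuous_compact; last exact: segment_compact.
  by apply: continuous_subspaceT => t; exact: cg.
move=> /compact_bounded [M [_ hM]].
exists (`|M| + 1) => t ty; apply: (hM (`|M| + 1)).
  by rewrite (le_lt_trans (ler_norm _))// ltrDl.
by exists t => //; move: ty; rewrite /= in_itv/= ler_distl => /andP[-> ->].
Qed.

Local Notation leb := (@lebesgue_measure R).

Lemma lebesgue_itv_finite (a b : R) : (leb `[a, b]%classic < +oo)%E.
Proof. by rewrite lebesgue_measure_itv/=; case: ifP => _; rewrite -?EFinB ltry. Qed.

Lemma local_int_itv h y (g : R -> R) : 0 < h ->
  local_int leb id h y g = \int[leb]_(t in `[y - h, y + h]) (K ((t - y) / h) * g t).
Proof.
move=> h0; rewrite /local_int [RHS]Rintegral_mkcond.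
apply: eq_Rintegral => t _; rewrite patchE; case: ifPn => //.
rewrite notin_setE /= in_itv/= => /negP; rewrite -ler_distl -ltNge => ht.
by rewrite kernel_out// mul0r.
Qed.

Lemma local_int_scale h y (g : R -> R) : 0 < h -> continuous g ->
  local_int leb id h y (fun t : R => g ((t - y) / h)) = h * local_int leb id 1 0 g.
Proof.
move=> h0 cg.
have n0 : h != 0 by rewrite gt_eqF.
pose F (v : R) : R := h * v + y.
have dF (v : R) : is_derive v 1 F h.
  by rewrite /F; apply: is_derive_eq; rewrite addr0 [LHS]mulr1.
have F'E : derive1 F = cst h by apply/funext => v; rewrite derive1E derive_val.
rewrite !local_int_itv//.
have Fm1 : F (-1) = y - h by rewrite /F mulrN1 addrC.
have F1 : F 1 = y + h by rewrite /F mulr1 addrC.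
rewrite /Rintegral -Fm1 -F1 (@integration_by_substitution_increasing _ F
  (fun t : R => K ((t - y) / h) * g ((t - y) / h)) (-1) 1)//.
- rewrite sub0r add0r -/(Rintegral _ _ _) -RintegralZl//.
  + apply: eq_Rintegral => v _; rewrite F'E mulrC; congr (_ * _).
    by rewrite /= /F addrK mulrAC mulfV// mul1r subr0 divr1.
  + apply: (integrableS measurableT) => //.
    apply: local_int_integrable => //.
    by rewrite sub0r add0r; exact: lebesgue_itv_finite.
    exact: locally_bounded_continuous.
- by move=> a b _ _ ab; rewrite /F ltrD2r ltr_pM2l.
- by rewrite F'E => v _; exact: cvg_cst.
- by rewrite F'E; exact: is_cvg_cst.
- by rewrite F'E; exact: is_cvg_cst.
- have cF : continuous F.
    by move=> v; apply/differentiable_continuous/derivable1_diffP; exact: ex_derive.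
  split.
  + by move=> v _; exact: ex_derive.
  + by apply: cvg_at_right_filter; exact: cF.
  + by apply: cvg_at_left_filter; exact: cF.
- apply: continuous_subspaceT => t.
  have ct : {for t, continuous (fun t : R => (t - y) / h)}.
    by apply: cvgM; [apply: cvgB; [exact: cvg_id|exact: cvg_cst]|exact: cvg_cst].
  apply: cvgM; apply: (continuous_comp ct).
    exact: kernel_continuous.
  exact: cg.
Qed.

Lemma local_int1 h y : 0 < h -> local_int leb id h y (cst 1) = h.
Proof.
have [_ _ K1 _ _] := kerK.
move=> h0; rewrite (@local_int_scale h y (cst 1))//; last by move=> v; exact: cvg_cst.
rewrite /local_int (_ : Rintegral _ _ _ = 1) ?mulr1//.
rewrite -[RHS]/(fine 1%E) -K1; congr fine; apply: eq_integral => u _.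
by rewrite subr0 divr1 mulr1.
Qed.

Lemma kernel_first_moment : local_int leb id 1 0 id = 0.
Proof.
have [_ Ksym _ _ _] := kerK.
have self_opp (a : R) : a = - a -> a = 0 by lra.
have N : local_int leb id 1 0 id = - local_int leb id 1 0 id.
  rewrite local_int_itv// sub0r add0r {1}/Rintegral.
  rewrite -[X in `[_, X]]opprK integration_by_substitution_oppr//; last first.
    apply: continuous_subspaceT => v; apply: cvgM; last exact: cvg_id.
    apply: continuous_comp; last exact: kernel_continuous.
    by apply: cvgM; [apply: cvgB; [exact: cvg_id|exact: cvg_cst]|exact: cvg_cst].
  rewrite -[RHS]mulN1r -RintegralZl//.
    rewrite /Rintegral opprK; congr fine; apply: eq_integral => v _ /=.
    by rewrite !subr0 !divr1 Ksym mulN1r mulrN.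
  rewrite opprK; apply: (integrableS measurableT) => //.
  have fin : (leb (id @^-1` `[(0 - 1)%R, (0 + 1)%R]) < +oo)%E.
    exact: lebesgue_itv_finite.
  have cid : continuous (id : R -> R) by move=> v; exact: cvg_id.
  have mid : measurable_fun setT (id : measurableTypeR R -> R).
    exact: measurable_id.
  exact: (local_int_integrable mid ltr01 fin (locally_bounded_continuous 1 0 cid)).
exact: self_opp.
Qed.

End kernel.

(** * Smooth functions on the open unit interval *)

Section taylor.
Context {R : realType}.
Implicit Types (g : R -> R) (G : nat -> R -> R) (x y : R).

(** At an interior point, points near [x] lie in the unit interval, so restricting
    the difference quotient to it does not change the limit. *)
Lemma is_derive_deriv_unit g x : 0 < x < 1 -> derivable_unit g x ->
  is_derive x 1 g (deriv_unit g x).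
Proof.
move=> x01 dg; apply/is_derive1_caratheodory.
pose q z := if z == x then deriv_unit g x else (g z - g x) / (z - x).
exists q; split; last by rewrite /q eqxx.
  move=> z; rewrite /q; case: eqVneq => [->|zx]; first by rewrite !subrr mulr0.
  by rewrite divfK// subr_eq0.
apply/continuous_withinNx; rewrite [q x]/q eqxx.
have xI : \forall y \near x, unit_interval y.
  have : x \in `]0, 1[%R by rewrite in_itv/= x01.
  move=> /near_in_itvoo; apply: filterS => y.
  by rewrite /unit_interval /= !in_itv/= => /andP[/ltW -> /ltW ->].
have: diff_quotient g x y @[y --> x^'] --> deriv_unit g x.
  apply: cvg_trans dg.
  move=> A; rewrite /nbhs /=.
  rewrite /fmap /within /= => hA.
  near=> y.
  have : unit_interval y by near: y; apply: cvg_within; exact: xI.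
  near: y; exact: hA.
apply: cvg_trans; apply: near_eq_cvg.
near=> y; rewrite /q /diff_quotient ifF//.
by apply/negbTE; near: y; exact: nbhs_dnbhs_neq.
Unshelve. all: by end_near. Qed.

Definition derivative_chain (p : nat) G :=
  forall j, (j < p)%N -> forall x, 0 < x < 1 -> is_derive x 1 (G j) (G j.+1 x).

Definition taylor_poly (p : nat) G x y :=
  \sum_(k < p.+1) G k x / k`!%:R * (y - x) ^+ k.

Lemma mean_value g (dg : R -> R) x y : 0 < x < 1 -> 0 < y < 1 ->
  (forall z, 0 < z < 1 -> is_derive (z : R) 1 g (dg z)) ->
  exists z, [/\ 0 < z < 1, `|z - x| <= `|y - x| & g y - g x = dg z * (y - x)].
Proof.
move=> x01 y01 gd.
suff [z [z01 zxy e]] : exists z, [/\ 0 < z < 1,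
    Num.min x y <= z <= Num.max x y & g y - g x = dg z * (y - x)].
  exists z; split=> //; move: zxy; have [xy|/ltW yx] := leP x y => /andP[xz zy].
    by rewrite !ger0_norm ?subr_ge0// lerD2r.
  by rewrite !ler0_norm ?subr_le0// lerN2 lerD2r.
wlog xy : x y x01 y01 / x <= y.
  move=> W; have /orP[xy|yx] := le_total x y; first exact: W.
  have [z [z01 zx e]] := W _ _ y01 x01 yx.
  exists z; split; rewrite 1?minC 1?maxC//.
  by rewrite -opprB e -mulrN opprB.
move: x01 y01 => /andP[x0 _] /andP[_ y1].
have xy01 c : x <= c <= y -> 0 < c < 1.
  by move=> /andP[xc cy]; rewrite (lt_le_trans x0 xc) (le_lt_trans cy y1).
have [c cxy ce] : exists2 c, c \in `[x, y] & g y - g x = dg c * (y - x).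
  apply: MVT_segment => // [c /[!in_itv]/= /andP[/ltW xc /ltW cy]|].
    by apply: gd; apply: xy01; rewrite xc.
  apply: continuous_in_subspaceT => c; rewrite inE/= in_itv/= => /xy01/gd dc.
  by apply/differentiable_continuous/derivable1_diffP; exact: ex_derive.
move: cxy; rewrite in_itv/= => cxy; exists c; split; first exact: xy01.
  by rewrite min_l// max_r.
by [].
Qed.

Lemma is_derive_taylor_poly p G x z :
  is_derive (z : R) 1 (taylor_poly p.+1 G x) (taylor_poly p (fun k => G k.+1) x z).
Proof.
pose F (k : nat) y := G k x / k`!%:R * (y - x) ^+ k.
pose dF (k : nat) y := G k x / k`!%:R * (k%:R * (y - x) ^+ k.-1).
have dFk (k : nat) : is_derive (z : R) 1 (F k) (dF k z).
  have -> : F k = G k x / k`!%:R *: (((fun y => y - x) ^+ k) : R -> R).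
    by apply/funext => y; rewrite fctE /=.
  apply: is_derive_eq.
  by rewrite /dF /= subr0 scaler1.
have -> : taylor_poly p.+1 G x = \sum_(k < p.+2) F k.
  by apply/funext => y; rewrite fct_sumE.
have := @is_derive_sum _ _ _ p.+2 (fun k => F k) z 1 (fun k => dF k z) (fun k => dFk k).
move=> /is_derive_eq; apply.
rewrite big_ord_recl /dF /= mul0r mulr0 add0r; apply: eq_bigr => k _.
rewrite /bump /= add1n factS natrM.
have k0 : k.+1%:R != 0 :> R by rewrite pnatr_eq0.
have f0 : k`!%:R != 0 :> R by rewrite pnatr_eq0 -lt0n fact_gt0.
by field; rewrite f0 -natr1 addrC in k0 *.
Qed.

(** By induction on the order: the derivative in [y] of the Taylor polynomial of
    [G 0] is the Taylor polynomial of [G 1], and the mean value theorem turns the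
    remainder of the latter into that of the former. *)
Lemma taylor_remainder p G (C beta : R) : 0 <= C -> 0 <= beta ->
  derivative_chain p G ->
  (forall x y, 0 < x < 1 -> 0 < y < 1 ->
    `|G p y - G p x| <= C * `|y - x| `^ beta) ->
  forall x y, 0 < x < 1 -> 0 < y < 1 ->
    `|G 0%N y - taylor_poly p G x y| <= C * `|y - x| `^ (p%:R + beta).
Proof.
move=> C0 b0; elim: p G => [|p IH] G dG hG x y x01 y01.
  rewrite /taylor_poly big_ord1 expr0 mulr1 fact0 divr1 add0r.
  exact: hG.
have dG' : derivative_chain p (fun k => G k.+1).
  by move=> j jp z; apply: dG.
have dT (z : R) : 0 < z < 1 -> is_derive z 1 (G 0%N - taylor_poly p.+1 G x)
    (G 1%N z - taylor_poly p (fun k => G k.+1) x z).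
  move=> z01; have ? := dG 0%N isT z z01; have ? := is_derive_taylor_poly p G x z.
  by apply: is_derive_eq.
have [z [z01 zx]] := mean_value x01 y01 dT.
have -> : (G 0%N - taylor_poly p.+1 G x) x = 0.
  apply/eqP; rewrite subr_eq0 /taylor_poly; apply/eqP.
  rewrite big_ord_recl big1 => [|i _]; last by rewrite subrr expr0n/= mulr0.
  by rewrite expr0 mulr1 fact0 divr1 addr0.
rewrite subr0 !fctE => ->; rewrite normrM.
apply: le_trans (ler_wpM2r (normr_ge0 _) (IH _ dG' hG x z x01 z01)) _.
have [->|yx] := eqVneq y x.
  by rewrite subrr normr0 mulr0; exact: mulr_ge0 (powR_ge0 _ _).
have -> : p.+1%:R + beta = p%:R + beta + 1 by rewrite -natr1 addrAC.
rewrite -mulrA ler_wpM2l// [leRHS]powRD; last first.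
  by apply/implyP => _; rewrite normr_eq0 subr_eq0.
rewrite powRr1// ler_wpM2r// ge0_ler_powR// ?nnegrE//.
by rewrite addr_ge0.
Qed.

(** The last derivative is within [C] of its value at the midpoint; the mean value
    theorem then bounds the others, going down in the order. *)
Lemma derivative_chain_bounded p G (C beta : R) : 0 <= C -> 0 <= beta ->
  derivative_chain p G ->
  (forall x y, 0 < x < 1 -> 0 < y < 1 ->
    `|G p y - G p x| <= C * `|y - x| `^ beta) ->
  exists B : R, forall k, (k <= p)%N -> forall x, 0 < x < 1 -> `|G k x| <= B.
Proof.
move=> C0 b0 dG hG.
have h01 : 0 < (2^-1 : R) < 1 by rewrite invr_gt0 ltr0n/= invf_lt1// ltr1n.
have y1 (x y : R) : 0 < x < 1 -> 0 < y < 1 -> `|y - x| <= 1.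
  by move=> ? ?; rewrite ler_norml; apply/andP; split; lra.
have one k B : (k < p)%N -> (forall x, 0 < x < 1 -> `|G k.+1 x| <= B) ->
    forall x, 0 < x < 1 -> `|G k x| <= `|G k 2^-1| + B.
  move=> kp hB x x01; have [z [z01 _]] := mean_value h01 x01 (dG k kp).
  move=> e; rewrite -lerBlDl (le_trans (lerB_dist _ _))// e normrM (le_trans (ler_pM _ _ (hB z z01) (y1 _ _ h01 x01)))//.
  by rewrite mulr1.
have [B hB] : exists B : nat -> R, forall k, (k <= p)%N ->
    forall x, 0 < x < 1 -> `|G (p - k)%N x| <= B k.
  exists (fix B k := if k is k'.+1 then `|G (p - k)%N 2^-1| + B k'
                     else `|G p 2^-1| + C).
  elim=> [_ x x01|k IH kp x x01].
    rewrite subn0 -lerBlDl (le_trans (lerB_dist _ _))//.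
    rewrite (le_trans (hG _ _ h01 x01))// ler_piMr//.
    apply: (@le_trans _ _ (1 `^ beta)); last by rewrite powR1.
    by rewrite ge0_ler_powR ?nnegrE// y1.
  apply: one => //; first by rewrite ltn_subrL (leq_trans _ kp).
  by move=> z z01; rewrite subnSK//; apply: IH => //; exact: ltnW.
exists (\sum_(i < p.+1) `|B i|) => k kp x x01.
have /(_ (p - k)%N (leq_subr _ _) x x01) := hB.
rewrite subKn// => /le_trans; apply.
rewrite (bigD1 (inord (p - k)))//= inordK ?ltnS ?leq_subr//.
by rewrite (le_trans (ler_norm _))// lerDl sumr_ge0.
Qed.

End taylor.

Section holder_expansion.
Context {R : realType}.
Implicit Types (g : R -> R) (x y nu C : R).

Lemma sfloor_ge0 nu : 0 < nu -> (`|sfloor nu|%N)%:Z = sfloor nu.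
Proof.
move=> nu0; have : 0 <= sfloor nu by rewrite /sfloor subr_ge0 -gtz0_ge1 ceil_gt0.
by move=> /gez0_abs.
Qed.

Lemma sfloor_lt nu : (sfloor nu)%:~R < nu.
Proof. by rewrite /sfloor gt_pred_ceil. Qed.

(** The Taylor coefficients stay bounded up to the endpoints, and the remainder is
    uniform in the centre: every later use of smoothness goes through this. *)
Lemma holder_expansion nu C g : 1 <= nu -> 0 <= C -> holder_class nu C g ->
  exists p (c : nat -> R -> R) (B : R),
  [/\ forall x, c 0%N x = g x,
      forall k x, (k <= p)%N -> 0 < x < 1 -> `|c k x| <= B,
      forall x y, 0 < x < 1 -> 0 < y < 1 ->
        `|g y - \sum_(k < p.+1) c k x * (y - x) ^+ k| <= C * `|y - x| `^ nu &
      forall x y, 0 < x < 1 -> 0 < y < 1 -> `|g y - g x| <= B * `|y - x|].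
Proof.
move=> nu1 C0 [dg hg]; have nu0 : 0 < nu by apply: lt_le_trans nu1.
pose p := `|sfloor nu|%N; pose G j := iter j deriv_unit g.
have pE : (sfloor nu)%:~R = p%:R :> R by rewrite -(sfloor_ge0 nu0).
pose beta := nu - p%:R.
have b0 : 0 <= beta by rewrite subr_ge0 -pE ltW// sfloor_lt.
have uI x : 0 < x < 1 -> unit_interval x.
  by rewrite /unit_interval/= in_itv/= => /andP[/ltW -> /ltW ->].
have dG : derivative_chain p G.
  by move=> j jp x x01; apply: is_derive_deriv_unit => //; apply: dg (uI _ x01).
have hG x y : 0 < x < 1 -> 0 < y < 1 ->
    `|G p y - G p x| <= C * `|y - x| `^ beta.
  by move=> /uI x01 /uI y01; have := hg _ _ y01 x01; rewrite pE.
have [B0 hB0] := derivative_chain_bounded C0 b0 dG hG.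
have B00 : 0 <= B0.
  apply: le_trans (hB0 0%N _ 2^-1 _) => //.
  by rewrite invr_gt0 ltr0n/= invf_lt1// ltr1n.
pose c k x := G k x / k`!%:R.
have hc k x : (k <= p)%N -> 0 < x < 1 -> `|c k x| <= B0.
  move=> kp x01; rewrite /c normrM normfV (ger0_norm (ler0n _ _)).
  rewrite ler_pdivrMr ?ltr0n ?fact_gt0// (le_trans (hB0 _ kp _ x01))//.
  by rewrite ler_peMr// ler1n fact_gt0.
have T x y : 0 < x < 1 -> 0 < y < 1 ->
    `|g y - \sum_(k < p.+1) c k x * (y - x) ^+ k| <= C * `|y - x| `^ nu.
  move=> x01 y01; have := taylor_remainder C0 b0 dG hG x01 y01.
  by rewrite /beta (addrC p%:R) subrK.
have c0 x : c 0%N x = g x by rewrite /c fact0 divr1.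
exists p, c, (p%:R * B0 + B0 + C); split => // [k x kp x01|x y x01 y01].
  rewrite (le_trans (hc _ _ kp x01))// -addrA (addrA _ B0 C) (addrC _ B0) -addrA.
  by rewrite lerDl addr_ge0// mulr_ge0.
have y1 : `|y - x| <= 1 by rewrite ler_norml; apply/andP; split; lra.
have pw : `|y - x| `^ nu <= `|y - x|.
  have [->|yx] := eqVneq y x; last by rewrite ge1r_powR// normr_gt0 subr_eq0 yx.
  by rewrite subrr normr0 powR0// gt_eqF.
pose S := \sum_(k < p.+1) c k x * (y - x) ^+ k.
have -> : g y - g x = (g y - S) + (S - g x) by rewrite subrKA.
rewrite (le_trans (ler_normD _ _))// addrC mulrDl lerD//; last first.
  by rewrite (le_trans (T _ _ x01 y01))// ler_wpM2l.
rewrite /S big_ord_recl c0 expr0 mulr1 addrC addKr.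
apply: (@le_trans _ _ (p%:R * B0 * `|y - x|)); last first.
  by rewrite ler_wpM2r// lerDl.
rewrite (le_trans (ler_norm_sum _ _ _))//.
rewrite -mulrA mulr_natl -[X in _ *+ X]card_ord -sumr_const.
apply: ler_sum => k _; rewrite normrM ler_pM//; first exact: (hc _ _ (ltn_ord k) x01).
by rewrite normrX exprS ler_piMr// exprn_ile1.
Qed.

End holder_expansion.

(** * Polynomials graded by the bandwidth *)

Section graded.
Context {R : realType} {Th : Type}.
Variables (V : Th -> Prop) (hh : Th -> R).
Hypothesis hh01 : forall th, V th -> 0 <= hh th <= 1.

Definition bounded_coef (c : Th -> R) := exists C : R, forall th, V th -> `|c th| <= C.

(** Around a centre [x], with [hh] the bandwidth and [s] the position relative to
    [x] in units of the bandwidth, the Taylor term [c * (y - x) ^+ k] reads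
    [c * hh ^+ k * s ^+ k]: as many powers of [hh] as of [s]. The grade [j] counts
    the excess of powers of [hh], by pairs, so that a polynomial of grade [j] is
    [O(hh ^+ (2 * j))] on bounded windows. *)
Inductive graded (j : nat) : (Th -> R -> R) -> Prop :=
| graded_monomial c k b : bounded_coef c -> (b + 2 * j <= k)%N ->
    graded j (fun th s => c th * hh th ^+ k * s ^+ b)
| graded_add G H : graded j G -> graded j H ->
    graded j (fun th s => G th s + H th s).

Lemma bounded_coef_cst (a : R) : bounded_coef (fun=> a).
Proof. by exists `|a|. Qed.

Lemma bounded_coefM c1 c2 : bounded_coef c1 -> bounded_coef c2 ->
  bounded_coef (fun th => c1 th * c2 th).
Proof.
move=> [C1 h1] [C2 h2]; exists (C1 * C2) => th Vth.
by rewrite normrM ler_pM// ?h1 ?h2.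
Qed.

Lemma graded0 j : graded j (fun _ _ => 0).
Proof.
have -> : (fun (_ : Th) (_ : R) => 0 : R) =
    (fun th s => 0 * hh th ^+ (0 + 2 * j) * s ^+ 0).
  by apply/funext => th; apply/funext => s; rewrite !mul0r.
by apply: (graded_monomial (c := fun=> 0)) => //; exact: bounded_coef_cst.
Qed.

Lemma graded_le i j G : (i <= j)%N -> graded j G -> graded i G.
Proof.
move=> ij; elim=> [c k b bc kb|G1 G2 _ g1 _ g2]; last exact: graded_add.
by apply: graded_monomial => //; apply: leq_trans kb; rewrite leq_add2l leq_mul2l ij orbT.
Qed.

Lemma graded_sum j n (G : nat -> Th -> R -> R) :
  (forall i, (i < n)%N -> graded j (G i)) ->
  graded j (fun th s => \sum_(i < n) G i th s).
Proof.
elim: n => [|n IH] hG.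
  under eq_fun do under eq_fun do rewrite big_ord0.
  exact: graded0.
under eq_fun do under eq_fun do rewrite big_ord_recr/=.
by apply: graded_add; [apply: IH => i /ltnW; exact: hG|exact: hG].
Qed.

Lemma graded_mul i j G H : graded i G -> graded j H ->
  graded (i + j) (fun th s => G th s * H th s).
Proof.
elim=> [c k b bc kb|G1 G2 _ IH1 _ IH2 gH]; last first.
  under eq_fun do under eq_fun do rewrite mulrDl.
  by apply: graded_add; [exact: IH1|exact: IH2].
elim=> [c' k' b' bc' kb'|H1 H2 _ IH1 _ IH2]; last first.
  by under eq_fun do under eq_fun do rewrite mulrDr; exact: graded_add.
under eq_fun => th do under eq_fun => s do
  rewrite mulrACA -exprD mulrACA -exprD.
apply: (graded_monomial (c := fun th => c th * c' th)).
  exact: bounded_coefM.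
by rewrite mulnDr addnACA leq_add.
Qed.

Lemma gradedZ j (c : Th -> R) G : bounded_coef c -> graded j G ->
  graded j (fun th s => c th * G th s).
Proof.
move=> bc gG; rewrite -[j]add0n; apply: graded_mul gG.
have -> : (fun th (_ : R) => c th) = (fun th s => c th * hh th ^+ 0 * s ^+ 0).
  by apply/funext => th; apply/funext => s; rewrite !mulr1.
exact: graded_monomial.
Qed.

Lemma graded_exp G n : graded 0 G -> graded 0 (fun th s => G th s ^+ n).
Proof.
move=> gG; elim: n => [|n IH].
  have -> : (fun th s => G th s ^+ 0) = (fun th s => 1 * hh th ^+ 0 * s ^+ 0).
    by apply/funext => th; apply/funext => s; rewrite !mulr1.
  by apply: (graded_monomial (c := fun=> 1)) => //; exact: bounded_coef_cst.
under eq_fun do under eq_fun do rewrite exprS.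
exact: (graded_mul gG IH).
Qed.

Lemma graded_bound j G : graded j G -> forall S : R, exists C : R,
  forall th s, V th -> `|s| <= S -> `|G th s| <= C * hh th ^+ (2 * j).
Proof.
move=> gG S; elim: gG => [c k b [C hC] kb|G1 G2 _ [C1 h1] _ [C2 h2]]; last first.
  exists (C1 + C2) => th s Vth hs; rewrite (le_trans (ler_normD _ _))// mulrDl.
  by rewrite lerD// ?h1 ?h2.
exists (C * S ^+ b) => th s Vth hs; have /andP[h0 h1] := hh01 Vth.
rewrite !normrM !normrX (ger0_norm h0) mulrAC ler_pM ?mulr_ge0 ?exprn_ge0//.
  by rewrite ler_pM ?hC ?exprn_ge0// lerXn2r ?nnegrE// (le_trans _ hs).
by rewrite ler_wiXn2l// (leq_trans _ kb)// leq_addl.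
Qed.

Lemma graded_continuous j G th : graded j G -> continuous (G th).
Proof.
elim=> [c k b _ _|G1 G2 _ c1 _ c2] s.
  by apply: cvgM; [exact: cvg_cst|exact: exprn_continuous].
by apply: cvgD; [exact: c1|exact: c2].
Qed.

Variable K : R -> R.
Hypothesis kerK : smoothing_kernel K.
Local Notation kint := (local_int K (@lebesgue_measure R) id 1 0).

Let kintD (g1 g2 : R -> R) : continuous g1 -> continuous g2 ->
  kint (fun v => g1 v + g2 v) = kint g1 + kint g2.
Proof.
move=> c1 c2; apply: (local_intD kerK) => //.
- exact: lebesgue_itv_finite.
- exact: locally_bounded_continuous.
- exact: locally_bounded_continuous.
Qed.

Let kintZ c (g : R -> R) : continuous g ->
  kint (fun v => c * g v) = c * kint g.
Proof.
move=> c1; apply: (local_intZ kerK) => //.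
- exact: lebesgue_itv_finite.
- exact: locally_bounded_continuous.
Qed.

Lemma shift_exp_continuous (s : R) n : continuous (fun v : R => (s + v) ^+ n).
Proof.
move=> v; apply: (@continuous_comp _ _ _ (fun v : R => s + v) (fun v => v ^+ n)).
  by apply: cvgD; [exact: cvg_cst|exact: cvg_id].
exact: exprn_continuous.
Qed.

Definition moment_correction n (s : R) : R :=
  \sum_(l < n.+1) (if (l < 2)%N then 0 else 'C(n, l)%:R * kint (fun v => v ^+ l)) * s ^+ (n - l).

(** The kernel has total mass 1 and, being symmetric, first moment 0: smoothing
    a monomial changes it by terms of degree lower by at least 2. *)
Lemma kint_shift_exp n s :
  kint (fun v => (s + v) ^+ n) = s ^+ n + moment_correction n s.
Proof.
have int_sum k (a : nat -> R) : kint (fun v => \sum_(l < k) a l * v ^+ l) =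
    \sum_(l < k) a l * kint (fun v => v ^+ l).
  have cX l : continuous (fun v : R => a l * v ^+ l).
    by move=> v; apply: cvgM; [exact: cvg_cst|exact: exprn_continuous].
  have cS m : continuous (fun v : R => \sum_(l < m) a l * v ^+ l).
    elim: m => [|m IH]; first by under eq_fun do rewrite big_ord0; move=> v; exact: cvg_cst.
    by under eq_fun do rewrite big_ord_recr/=; move=> v; apply: cvgD; [exact: IH|exact: cX].
  elim: k => [|k IH].
    rewrite big_ord0; under [X in kint X]eq_fun do rewrite big_ord0 -(mul0r (0 : R)).
    by rewrite kintZ ?mul0r// => v; exact: cvg_cst.
  under [X in kint X]eq_fun do rewrite big_ord_recr/=.
  by rewrite big_ord_recr/= (kintD (cS k) (cX k)) IH kintZ//; exact: exprn_continuous.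
under [X in kint X]eq_fun => v.
  rewrite exprDn; under eq_bigr => l _ do rewrite -mulrnAl.
  over.
rewrite (int_sum n.+1 (fun l => s ^+ (n - l) *+ 'C(n, l))).
rewrite /moment_correction big_ord_recl [in RHS]big_ord_recl /= mul0r add0r.
have -> : kint (fun v => v ^+ 0) = 1 by exact: (local_int1 kerK 0 ltr01).
rewrite subn0 bin0 mulr1 mulr1n; congr (_ + _).
apply: eq_bigr => l _; rewrite /bump/= add1n.
case: l => -[|l] ln /=; last by rewrite mulrnAl -mulrnAr [RHS]mulrC mulr_natl.
by rewrite (kernel_first_moment kerK) mulr0 mul0r.
Qed.

(** The step on which the bias reduction rests. On monomials the integral is
    [s ^+ b] times the smoothed [s ^+ b'] minus the smoothed [s ^+ (b + b')]. The
    leading terms cancel, and what remains has degree lower by at least 2 while the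
    power of [hh] is unchanged: the grade goes up by one. *)
Lemma graded_residual j G Rho : graded j G -> graded 0 Rho ->
  graded j.+1 (fun th s => kint (fun v => (G th s - G th (s + v)) * Rho th (s + v))).
Proof.
have cshift (F : R -> R) s : continuous F -> continuous (fun v => F (s + v)).
  move=> cF v; apply: (@continuous_comp _ _ _ (fun v : R => s + v) F).
    by apply: cvgD; [exact: cvg_cst|exact: cvg_id].
  exact: cF.
have cres (F P : R -> R) s : continuous F -> continuous P ->
    continuous (fun v => (F s - F (s + v)) * P (s + v)).
  move=> cF cP v; apply: cvgM; last exact: cshift.
  by apply: cvgB; [exact: cvg_cst|exact: cshift].
move=> gG gRho; elim: gG => [c k b bc kb|G1 G2 g1 IH1 g2 IH2]; last first.
  rewrite (_ : (fun _ _ => _) = (fun th s =>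
    kint (fun v => (G1 th s - G1 th (s + v)) * Rho th (s + v)) +
    kint (fun v => (G2 th s - G2 th (s + v)) * Rho th (s + v)))).
    exact: graded_add.
  apply/funext => th; apply/funext => s; rewrite -kintD.
  - by congr kint; apply/funext => v; rewrite -mulrDl opprD addrACA.
  - by apply: cres; apply: graded_continuous; eassumption.
  - by apply: cres; apply: graded_continuous; eassumption.
have cM (th : Th) : continuous (fun s : R => c th * hh th ^+ k * s ^+ b).
  by move=> s; apply: cvgM; [exact: cvg_cst|exact: exprn_continuous].
elim: gRho => [c' k' b' bc' kb'|H1 H2 g1 IH1 g2 IH2]; last first.
  rewrite (_ : (fun _ _ => _) = (fun th s =>
    kint (fun v => (c th * hh th ^+ k * s ^+ b - c th * hh th ^+ k * (s + v) ^+ b) * H1 th (s + v)) +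
    kint (fun v => (c th * hh th ^+ k * s ^+ b - c th * hh th ^+ k * (s + v) ^+ b) * H2 th (s + v)))).
    exact: graded_add.
  apply/funext => th; apply/funext => s; rewrite -kintD.
  - by congr kint; apply/funext => v; rewrite -mulrDr.
  - by apply: (cres (fun s : R => c th * hh th ^+ k * s ^+ b)) => //; apply: graded_continuous; eassumption.
  - by apply: (cres (fun s : R => c th * hh th ^+ k * s ^+ b)) => //; apply: graded_continuous; eassumption.
pose a th := c th * c' th.
have E th s : kint (fun v => (c th * hh th ^+ k * s ^+ b -
      c th * hh th ^+ k * (s + v) ^+ b) * (c' th * hh th ^+ k' * (s + v) ^+ b')) =
    a th * hh th ^+ (k + k') * (s ^+ b * moment_correction b' s) +
    -1 * a th * hh th ^+ (k + k') * moment_correction (b + b') s.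
  pose A := a th * hh th ^+ (k + k').
  rewrite (_ : (fun _ => (_ - _) * _) = (fun v => A * s ^+ b * (s + v) ^+ b' +
      - A * (s + v) ^+ (b + b'))); last first.
    by apply/funext => v; rewrite /A /a /= !exprD; ring.
  have cE n : continuous (fun v : R => (s + v) ^+ n) := @shift_exp_continuous s n.
  have cZ (e : R) n : continuous (fun v : R => e * (s + v) ^+ n).
    by move=> v; apply: cvgM; [exact: cvg_cst|exact: cE].
  rewrite (kintD (cZ (A * s ^+ b) b') (cZ (- A) (b + b')%N)) !kintZ//.
  by rewrite !kint_shift_exp /A !exprD; ring.
under eq_fun do under eq_fun do rewrite E.
have gmc n (e : Th -> R) k0 i : bounded_coef e -> (i + n + 2 * j <= k0)%N ->
    graded j.+1 (fun th s => e th * hh th ^+ k0 * (s ^+ i * moment_correction n s)).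
  move=> be nk.
  under eq_fun => th do under eq_fun => s do rewrite /moment_correction !mulr_sumr.
  apply: (graded_sum (G := fun l th s => e th * hh th ^+ k0 * (s ^+ i *
      ((if (l < 2)%N then 0 else 'C(n, l)%:R * kint (fun v => v ^+ l)) * s ^+ (n - l))))).
  move=> l ln.
  case: ltnP => l2.
    under eq_fun do under eq_fun do rewrite mul0r !mulr0.
    exact: graded0.
  set M := _ * kint _.
  rewrite (_ : (fun _ _ => _) = (fun th s => (e th * M) * hh th ^+ k0 * s ^+ (i + (n - l)))).
    apply: (graded_monomial (c := fun th => e th * M)).
      by apply: bounded_coefM => //; exact: bounded_coef_cst.
    by apply: leq_trans nk; move: ln l2; clear; lia.
  by apply/funext => th; apply/funext => s; rewrite exprD; ring.
apply: graded_add.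
  apply: gmc; first exact: bounded_coefM.
  by move: kb kb'; clear; lia.
rewrite (_ : (fun _ _ => _) = (fun th s => -1 * a th * hh th ^+ (k + k') *
    (s ^+ 0 * moment_correction (b + b') s))); last first.
  by apply/funext => th; apply/funext => s; rewrite expr0 mul1r.
apply: (gmc _ (fun th => -1 * a th)); last by move: kb kb'; clear; lia.
by apply: bounded_coefM; [exact: bounded_coef_cst|exact: bounded_coefM].
Qed.

End graded.

(** * Transport of weighted measures *)

Section transport.
Local Open Scope ereal_scope.
Context d d' (T : measurableType d) (S : measurableType d') {R : realType}.
Variables (mu : {measure set T -> \bar R}) (kap : {measure set S -> \bar R}).
Variables (xi : T -> S) (F : T -> R).
Hypothesis mxi : measurable_fun setT xi.
Hypothesis mF : measurable_fun setT F.
Hypothesis F0 : forall w, (0 <= F w)%R.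
Hypothesis Fkap : forall B, measurable B ->
  \int[mu]_(w in xi @^-1` B) (F w)%:E = kap B.

Import HBNNSimple.

(** Change of variables for the image under [xi] of the measure with density
    [F] with respect to [mu]. With [F = 1] this is the law of [xi]; with
    [xi = id] it is integration against a density; with [F] a statistic
    independent of [xi] it says that expectations factor. *)
Lemma ge0_integral_transport (g : S -> \bar R) :
  measurable_fun setT g -> (forall s, 0 <= g s) ->
  \int[mu]_w ((F w)%:E * g (xi w)) = \int[kap]_s g s.
Proof.
move=> mg g0; pose a := nnsfun_approx measurableT mg.
have acvg s : (a n s)%:E @[n --> \oo] --> g s.
  by apply: cvg_nnsfun_approx => //; move=> ? _; exact: g0.
have and_ s : {homo (fun n => a n s) : i j / (i <= j)%N >-> (i <= j)%R}.
  by move=> i j ij; exact/lefP/nd_nnsfun_approx.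
have mEF : measurable_fun setT (EFin \o F) by exact/measurable_EFinP.
have ma n : measurable_fun setT (fun s => (a n s)%:E) by exact/measurable_EFinP.
have man n : measurable_fun setT (fun w => (F w)%:E * (a n (xi w))%:E).
  by apply: emeasurable_funM => //; exact: measurableT_comp (ma n) mxi.
have -> : \int[kap]_s g s = limn (fun n => \int[kap]_s (a n s)%:E).
  rewrite -monotone_convergence//.
  - by apply: eq_integral => s _; apply/esym/cvg_lim => //; exact: acvg.
  - by move=> n s _; rewrite lee_fin.
  - by move=> s _ i j ij; rewrite lee_fin and_.
have -> : \int[mu]_w ((F w)%:E * g (xi w)) =
    limn (fun n => \int[mu]_w ((F w)%:E * (a n (xi w))%:E)).
  rewrite -monotone_convergence//.
  - apply: eq_integral => w _; apply/esym/cvg_lim => //.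
    by apply: cvgeZl => //; exact: acvg.
  - by move=> n w _; rewrite mule_ge0 ?lee_fin.
  - by move=> w _ i j ij; apply: lee_wpmul2l; rewrite lee_fin// and_.
congr (limn _); apply/funext => n.
transitivity (\int[kap]_s (\sum_(y \in range (a n)) (y * \1_(a n @^-1` [set y]) s)%:E)).
  rewrite ge0_integral_fsum//; last 2 first.
  - move=> y; apply/measurable_EFinP.
    by apply: measurable_funM => //; exact: measurable_indic.
  - by move=> y s _; exact: nnfun_muleindic_ge0.
  under eq_integral => w _.
    rewrite [in X in _ * X]fimfunE -fsumEFin// ge0_mule_fsumr; last first.
      by move=> y; exact: nnfun_muleindic_ge0.
    over.
  rewrite ge0_integral_fsum//; last 2 first.
  - move=> y; apply: emeasurable_funM => //; apply/measurable_EFinP.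
    apply: measurable_funM => //; apply: measurableT_comp => //.
  - by move=> y w _; apply: mule_ge0; [rewrite lee_fin|exact: nnfun_muleindic_ge0].
  apply: eq_fsbigr => y; rewrite inE => -[s0 _ <-].
  have mB : measurable (a n @^-1` [set a n s0]) by [].
  under [RHS]eq_integral do rewrite EFinM.
  rewrite ge0_integralZl//; last 2 first.
  - exact/measurable_EFinP/measurable_indic.
  - by rewrite lee_fin.
  rewrite integral_indic// setIT -Fkap//.
  under eq_integral do rewrite EFinM muleCA.
  rewrite ge0_integralZl//; last 3 first.
  - apply: emeasurable_funM => //; apply/measurable_EFinP.
    exact: measurableT_comp.
  - by move=> w _; rewrite mule_ge0 ?lee_fin.
  - by rewrite lee_fin.
  congr (_ * _); rewrite [RHS]integral_mkcond; apply: eq_integral => w _.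
  by rewrite epatch_indic.
by apply: eq_integral => s _; rewrite [in RHS]fimfunE -fsumEFin.
Qed.

End transport.

Section transport_real.
Context d d' (T : measurableType d) (S : measurableType d') {R : realType}.
Variables (mu : {measure set T -> \bar R}) (kap : {measure set S -> \bar R}).
Variables (xi : T -> S) (F : T -> R).
Hypothesis mxi : measurable_fun setT xi.
Hypothesis mF : measurable_fun setT F.
Hypothesis F0 : forall w, 0 <= F w.
Hypothesis Fkap : forall B, measurable B ->
  (\int[mu]_(w in xi @^-1` B) (F w)%:E = kap B)%E.

Lemma integral_transport (g : S -> R) : measurable_fun setT g ->
  (\int[mu]_w (F w * g (xi w))%:E = \int[kap]_s (g s)%:E)%E.
Proof.
move=> mg; rewrite integralE [RHS]integralE; congr (_ - _)%E.
  rewrite -(ge0_integral_transport mxi mF F0 Fkap)//; last first.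
    exact/measurable_funepos/measurable_EFinP.
  apply: eq_integral => w _; rewrite !funeposE -!EFin_max -EFinM; congr EFin.
  by rewrite maxr_pMr// mulr0.
rewrite -(ge0_integral_transport mxi mF F0 Fkap)//; last first.
  exact/measurable_funeneg/measurable_EFinP.
apply: eq_integral => w _; rewrite !funenegE -!EFinN -!EFin_max -EFinM; congr EFin.
by rewrite maxr_pMr// mulr0 mulrN.
Qed.

End transport_real.

(** * The population smoother *)

Section population.
Context {R : realType} d (T : measurableType d) (P : probability T R).
Variables (X : {RV P >-> R}) (f K : R -> R).
Hypothesis kerK : smoothing_kernel K.
Hypothesis densX : has_density X f.
Local Notation leb := (@lebesgue_measure R).
Local Notation E := (local_int K P X).
Implicit Types (h y : R) (g : R -> R).

Lemma local_int_density h y g : measurable_fun setT g ->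
  E h y g = local_int K leb id h y (fun t => f t * g t).
Proof.
move=> mg; have [mf f0 df] := densX.
have mKg : measurable_fun setT (fun t : R => K ((t - y) / h) * g t).
  by apply: measurable_funM => //; exact: scaled_kernel_measurable.
transitivity (fine (\int[distribution P X]_t (K ((t - y) / h) * g t)%:E)%E).
  congr fine.
  rewrite -(integral_transport (mu := P) (xi := X) (F := cst 1))//.
    by apply: eq_integral => w _; rewrite mul1r.
  move=> B mB; transitivity (\int[P]_(w in X @^-1` B) (cst 1%E w))%E => //.
  rewrite integral_cst ?mul1e//.
  by rewrite -[Z in measurable Z]setTI; exact: measurable_funP.
congr fine.
rewrite -(integral_transport (mu := leb) (kap := distribution P X) (xi := id) (F := f))//.
- by apply: eq_integral => t _; congr EFin; rewrite mulrCA.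
- by move=> B mB; rewrite [RHS](df _ mB).
Qed.

End population.

Section population_smoother.
Context {R : realType} d (T : measurableType d) (P : probability T R).
Variables (X : {RV P >-> R}) (K : R -> R).
Hypothesis kerK : smoothing_kernel K.
Local Notation E := (local_int K P X).
Implicit Types (h y c e B : R) (g : R -> R).

Definition nw_pop h g y := E h y g / E h y (cst 1).

Lemma measurable_rv : measurable_fun setT X.
Proof. by []. Qed.

Lemma probability_fin (A : set T) : measurable A -> (P A < +oo)%E.
Proof. by move=> mA; rewrite (le_lt_trans (probability_le1 _ mA)) ?ltry. Qed.

Lemma rv_preimage_fin (a b : R) : (P (X @^-1` `[a, b]) < +oo)%E.
Proof.
by apply: probability_fin; rewrite -[Z in measurable Z]setTI; exact: measurable_rv.
Qed.

Lemma mass_ge0 h y : 0 < h -> 0 <= E h y (cst 1).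
Proof. by move=> h0; apply: (local_int_ge0 kerK). Qed.

(** The smoother is an average over one bandwidth. *)
Lemma nw_pop_center h y g c e : 0 < h -> locally_bounded h y g ->
  0 < E h y (cst 1) -> (forall t, `|t - y| <= h -> `|g t - c| <= e) ->
  `|nw_pop h g y - c| <= e.
Proof.
move=> h0 bg D0 gc; have fin := rv_preimage_fin (y - h) (y + h).
have bc a := locally_bounded_cst h y a.
rewrite /nw_pop -[c in _ - c](mulfK (lt0r_neq0 D0)) -mulrBl normrM normfV (gtr0_norm D0).
rewrite ler_pdivrMr// -(local_intZ kerK measurable_rv h0 fin) //.
rewrite -(local_intZ kerK measurable_rv h0 fin) // -(local_intB kerK measurable_rv h0 fin) //.
  apply: (local_int_norm kerK measurable_rv h0 fin).
  - by apply: locally_boundedB => //; apply: locally_boundedM; exact: bc.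
  - by apply: locally_boundedM; exact: bc.
  - by move=> t ty; rewrite !mulr1; exact: gc.
by apply: locally_boundedM; exact: bc.
Qed.

Lemma bounded_locally h y g B : measurable_fun setT g -> (forall t, `|g t| <= B) ->
  locally_bounded h y g.
Proof. by move=> mg gB; split=> //; exists B. Qed.

Lemma nw_pop_bounded h g B y : 0 < h -> measurable_fun setT g ->
  (forall t, `|g t| <= B) -> `|nw_pop h g y| <= B.
Proof.
move=> h0 mg gB; have B0 : 0 <= B by rewrite (le_trans _ (gB 0)).
have := mass_ge0 y h0; rewrite le_eqVlt => /predU1P[D0|D0].
  by rewrite /nw_pop -D0 invr0 mulr0 normr0.
rewrite -[nw_pop _ _ _]subr0; apply: nw_pop_center => //.
  exact: bounded_locally gB.
by move=> t _; rewrite subr0.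
Qed.

Lemma measurable_inv_ge0 d' (T' : measurableType d') (F : T' -> R) :
  measurable_fun setT F -> (forall w, 0 <= F w) -> measurable_fun setT (fun w => (F w)^-1).
Proof.
move=> mF F0; under eq_fun do rewrite -powR_inv1//.
apply: (@measurableT_comp _ _ _ _ _ _ (fun x : R => x `^ (-1)) _ F) => //.
Qed.

Lemma local_int_measurable h g B : 0 < h -> measurable_fun setT g ->
  (forall t, `|g t| <= B) -> measurable_fun setT (fun y => E h y g).
Proof.
move=> h0 mg gB; have B0 : 0 <= B by rewrite (le_trans _ (gB 0)).
have [L L0 hL] := kernel_lipschitz kerK.
apply: continuous_measurable_fun.
have lip y z : `|E h y g - E h z g| <= L / h * B * `|y - z|.
  have int y' := local_int_integrable kerK measurable_rv h0
    (rv_preimage_fin (y' - h) (y' + h)) (bounded_locally h y' mg gB).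
  rewrite /local_int -RintegralB//; [|exact: int..].
  apply: le_trans (le_normr_Rintegral _ _) _ => //.
    by apply: eq_integrable (integrableB measurableT (int y) (int z)) => // w _.
  have cst_int : P.-integrable setT (EFin \o cst (L / h * B * `|y - z|)).
    exact: finite_measure_integrable_cst.
  apply: (@le_trans _ _ (\int[P]_w (cst (L / h * B * `|y - z|) w))).
    apply: le_Rintegral => //.
      have := integrable_abse (integrableB measurableT (int y) (int z)).
      by apply: eq_integrable => // w _.
    move=> w _ /=; rewrite -mulrBl normrM.
    have -> : L / h * B * `|y - z| = L / h * `|y - z| * B by rewrite mulrAC.
    apply: ler_pM => //; rewrite (le_trans (hL _ _))// -mulrA ler_pM2l//.
    rewrite -mulrBl normrM normfV (gtr0_norm h0) mulrC opprB addrC subrKA.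
    by rewrite distrC.
  rewrite Rintegral_cst//.
  rewrite [Z in _ * Z](_ : _ = 1) ?mulr1// -[RHS]/(fine 1%E).
  by congr fine; exact: probability_setT.
move=> y; apply/cvgrPdist_le => e e0.
have C0 : 0 <= L / h * B by rewrite mulr_ge0// divr_ge0// ltW.
near=> z; rewrite (le_trans (lip _ _))//.
rewrite (@le_trans _ _ ((L / h * B + 1) * `|y - z|))//.
  by rewrite ler_wpM2r// lerDl.
rewrite mulrC -ler_pdivlMr ?ltr_wpDl//.
by near: z; apply: cvgr_dist_le; [exact: cvg_id|rewrite divr_gt0// ltr_wpDl].
Unshelve. all: by end_near. Qed.

Lemma nw_pop_measurable h g B : 0 < h -> measurable_fun setT g ->
  (forall t, `|g t| <= B) -> measurable_fun setT (nw_pop h g).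
Proof.
move=> h0 mg gB; apply: measurable_funM; first exact: local_int_measurable gB.
apply: measurable_inv_ge0; last by move=> y; exact: mass_ge0.
by apply: (local_int_measurable (B := 1)) => // t; rewrite normr1.
Qed.

(** Up to sign, this is the bias of the population version of the boosting
    estimate after [k - 1] updates. *)
Fixpoint pop_residual h g (k : nat) : R -> R :=
  if k is k'.+1 then fun y => pop_residual h g k' y - nw_pop h (pop_residual h g k') y
  else g.

Lemma pop_residual_regular h g B k : 0 < h -> measurable_fun setT g ->
  (forall t, `|g t| <= B) ->
  measurable_fun setT (pop_residual h g k) /\
  (forall t, `|pop_residual h g k t| <= 2 ^+ k * B).
Proof.
move=> h0 mg gB; elim: k => [|k [mk bk]] /=.
  by split=> // t; rewrite expr0 mul1r.
split; first by apply: measurable_funB => //; exact: nw_pop_measurable bk.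
move=> t; rewrite (le_trans (ler_normB _ _))// exprS -mulrA mulr_natl mulr2n lerD//.
exact: nw_pop_bounded.
Qed.

(** Smoothing moves a function by at most its oscillation at the scale of the
    bandwidth, so each residual is of the order of the oscillation of the previous
    one. *)
Lemma pop_residual_step h g B e delta k y : 0 < h -> measurable_fun setT g ->
  (forall t, `|g t| <= B) ->
  (forall z, delta <= z <= 1 - delta -> 0 < E h z (cst 1)) ->
  (forall z t, delta + k%:R * h <= z <= 1 - (delta + k%:R * h) ->
    delta + k%:R * h <= t <= 1 - (delta + k%:R * h) -> `|t - z| <= h ->
    `|pop_residual h g k t - pop_residual h g k z| <= e) ->
  delta + k.+1%:R * h <= y <= 1 - (delta + k.+1%:R * h) ->
  `|pop_residual h g k.+1 y| <= e.
Proof.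
move=> h0 mg gB mass oscg yI; have [mk bk] := pop_residual_regular k h0 mg gB.
have kh0 : 0 <= k%:R * h by rewrite mulr_ge0// ltW.
have kE : k.+1%:R * h = k%:R * h + h by rewrite -natr1 mulrDl mul1r.
rewrite kE in yI; rewrite /= distrC; apply: nw_pop_center => //.
- exact: bounded_locally bk.
- by apply: mass; lra.
- by move=> t; rewrite ler_distl => ty; apply: oscg; rewrite ?ler_distl//; lra.
Qed.

Lemma pop_residual_osc h g B e delta k : 0 < h -> measurable_fun setT g ->
  (forall t, `|g t| <= B) ->
  (forall z, delta <= z <= 1 - delta -> 0 < E h z (cst 1)) ->
  (forall z t, delta <= z <= 1 - delta -> delta <= t <= 1 - delta ->
    `|t - z| <= 2 * h -> `|g t - g z| <= e) ->
  forall z t, delta + k%:R * h <= z <= 1 - (delta + k%:R * h) ->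
    delta + k%:R * h <= t <= 1 - (delta + k%:R * h) -> `|t - z| <= 2 * h ->
    `|pop_residual h g k t - pop_residual h g k z| <= 2 ^+ k * e.
Proof.
move=> h0 mg gB mass osc0; elim: k => [|k IH] z t zI tI tz.
  by rewrite expr0 mul1r; apply: osc0 => //; move: zI tI; rewrite mul0r addr0.
have step y : delta + k.+1%:R * h <= y <= 1 - (delta + k.+1%:R * h) ->
    `|pop_residual h g k.+1 y| <= 2 ^+ k * e.
  apply: (pop_residual_step h0 mg gB mass) => s u sI uI su; apply: IH => //.
  by rewrite (le_trans su)// mulr_natl mulr2n lerDl ltW.
rewrite (le_trans (ler_normB _ _))// exprS -mulrA mulr_natl mulr2n.
by apply: lerD; apply: step.
Qed.

Lemma kernel_mass_bounds f h y (c0 F0 : R) : has_density X f -> 0 < h -> 0 <= c0 ->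
  (forall t, `|t - y| <= h -> c0 <= f t <= F0) ->
  c0 * h <= E h y (cst 1) <= F0 * h.
Proof.
move=> densX h0 c00 fb; have [mf _ _] := densX.
have mid : measurable_fun setT (id : measurableTypeR R -> R) by exact: measurable_id.
have fin : ((@lebesgue_measure R) (id @^-1` `[(y - h)%R, (y + h)%R]) < +oo)%E.
  exact: lebesgue_itv_finite.
have b1 := locally_bounded_cst h y (1 : R).
have bf : locally_bounded h y f.
  split=> //; exists F0 => t /fb/andP[c0f fF].
  by rewrite ger0_norm// (le_trans c00).
have bc (a : R) : locally_bounded h y (fun t => a * cst 1 t).
  exact: (locally_boundedM (locally_bounded_cst h y a) b1).
have Lc (a : R) : a * h = local_int K (@lebesgue_measure R) id h y (fun t => a * cst 1 t).
  rewrite (local_intZ kerK mid h0 fin a b1); congr (_ * _).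
  by apply/esym; exact: (local_int1 kerK y h0).
rewrite (local_int_density kerK densX)// !Lc; apply/andP; split.
  apply: (le_local_int kerK mid h0 fin (bc _) (locally_boundedM bf b1)) => t /fb.
  by rewrite /= !mulr1 => /andP[].
apply: (le_local_int kerK mid h0 fin (locally_boundedM bf b1) (bc _)) => t /fb.
by rewrite /= !mulr1 => /andP[].
Qed.

End population_smoother.

(** * The bias of the population smoother *)

Section bias.
Context {R : realType} d (T : measurableType d) (P : probability T R).
Variables (X : {RV P >-> R}) (f K : R -> R).
Hypothesis kerK : smoothing_kernel K.
Hypothesis densX : has_density X f.
Local Notation leb := (@lebesgue_measure R).
Local Notation E := (local_int K P X).
Local Notation L := (local_int K leb id).
Local Notation kint := (local_int K leb id 1 0).

(** A parameter is a pair of a bandwidth and a centre; [s] below is the position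
    relative to the centre, in units of the bandwidth. *)
Variables (V : R * R -> Prop) (Sm nu c0 F0 Bf : R).
Hypothesis V01 : forall th, V th -> 0 < th.1 <= 1.
Hypothesis Vin : forall th (s : R), V th -> `|s| <= Sm -> 0 < th.2 + th.1 * s < 1.
Hypothesis Sm1 : 1 <= Sm.
Hypothesis c00 : 0 < c0.
Hypothesis f_bounds : forall t : R, 0 < t < 1 -> c0 <= f t <= F0.
Hypothesis f_lip : forall t t' : R, 0 < t < 1 -> 0 < t' < 1 -> `|f t' - f t| <= Bf * `|t' - t|.
Hypothesis nu2 : 2 <= nu.
Variable Rho : R * R -> R -> R.
Hypothesis gRho : graded V fst 0 Rho.
Variable Cf : R.
Hypothesis f_Rho : forall th (s : R), V th -> `|s| <= Sm ->
  `|f (th.2 + th.1 * s) - Rho th s| <= Cf * th.1 `^ (nu - 1).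

Implicit Types (th : R * R) (s t y h : R).

Let mid_leb : measurable_fun setT (id : measurableTypeR R -> R).
Proof. exact: measurable_id. Qed.

Let fin_leb h y : (leb (id @^-1` `[(y - h)%R, (y + h)%R]) < +oo)%E.
Proof. exact: lebesgue_itv_finite. Qed.

Let leb_cst h y a : 0 < h -> L h y (fun t => a * cst 1 t) = a * h.
Proof.
move=> h0; rewrite (local_intZ kerK mid_leb h0 (fin_leb h y)); last first.
  exact: locally_bounded_cst.
by congr (_ * _); exact: (local_int1 kerK y h0).
Qed.

Let bdd_cst h y a : locally_bounded h y (fun t => a * cst 1 t).
Proof.
exact: (locally_boundedM (locally_bounded_cst h y a) (locally_bounded_cst h y 1)).
Qed.

Lemma window_rel S th s t : V th -> `|s| <= S - 1 ->
  `|t - (th.2 + th.1 * s)| <= th.1 ->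
  exists s', [/\ `|s'| <= S, `|s' - s| <= 1 & t = th.2 + th.1 * s'].
Proof.
move=> /V01/andP[h0 _] sS ty; exists ((t - th.2) / th.1).
have sE : (t - th.2) / th.1 = s + (t - (th.2 + th.1 * s)) / th.1.
  by field; rewrite gt_eqF.
have d1 : `|(t - (th.2 + th.1 * s)) / th.1| <= 1.
  by rewrite normrM normfV (gtr0_norm h0) ler_pdivrMr// mul1r.
split; last by rewrite mulrC divfK ?gt_eqF// addrC subrK.
  by rewrite sE (le_trans (ler_normD _ _))// -[S](subrK 1) lerD.
by rewrite sE addrAC subrr add0r.
Qed.

Lemma window_in th s t : V th -> `|s| <= Sm - 1 ->
  `|t - (th.2 + th.1 * s)| <= th.1 -> 0 < t < 1.
Proof. by move=> Vth sS /(window_rel Vth sS) [s' [s'S _ ->]]; exact: Vin. Qed.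

Lemma density_locally_bounded th s : V th -> `|s| <= Sm - 1 ->
  locally_bounded th.1 (th.2 + th.1 * s) f.
Proof.
move=> Vth sS; have [mf _ _] := densX; split=> //; exists F0 => t.
move=> /(window_in Vth sS)/f_bounds/andP[c0f fF].
by rewrite ger0_norm// (le_trans (ltW c00)).
Qed.

Lemma mass_bounds th s : V th -> `|s| <= Sm - 1 ->
  c0 * th.1 <= E th.1 (th.2 + th.1 * s) (cst 1) <= F0 * th.1.
Proof.
move=> Vth sS; have /andP[h0 _] := V01 Vth.
apply: (kernel_mass_bounds kerK densX h0 (ltW c00)) => t ty.
exact/f_bounds/(window_in Vth sS).
Qed.

Lemma mass_gt0 th s : V th -> `|s| <= Sm - 1 -> 0 < E th.1 (th.2 + th.1 * s) (cst 1).
Proof.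
move=> Vth sS; have /andP[h0 _] := V01 Vth.
have /andP[+ _] := mass_bounds Vth sS; apply: lt_le_trans.
by rewrite mulr_gt0.
Qed.

Lemma local_int_window th s (G : R -> R) : V th -> continuous G ->
  L th.1 (th.2 + th.1 * s) (fun t => G ((t - th.2) / th.1)) =
  th.1 * kint (fun v => G (s + v)).
Proof.
move=> /V01/andP[h0 _] cG.
have cGs : continuous (fun v => G (s + v)).
  move=> v; apply: (@continuous_comp _ _ _ (fun v : R => s + v) G).
    by apply: cvgD; [exact: cvg_cst|exact: cvg_id].
  exact: cG.
rewrite -(local_int_scale kerK (th.2 + th.1 * s) h0 cGs).
congr local_int; apply/funext => t; congr G.
by field; rewrite gt_eqF.
Qed.

Lemma rel_continuous th (G : R -> R) : continuous G ->
  continuous (fun t => G ((t - th.2) / th.1)).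
Proof.
move=> cG t; apply: (@continuous_comp _ _ _ (fun t : R => (t - th.2) / th.1) G).
  by apply: cvgM; [apply: cvgB; [exact: cvg_id|exact: cvg_cst]|exact: cvg_cst].
exact: cG.
Qed.

Let bandwidth_in01 th : V th -> 0 <= th.1 <= 1.
Proof. by move=> /V01/andP[/ltW -> ->]. Qed.

Definition smoothed_density th s := kint (fun v => Rho th (s + v)).

Lemma graded_smoothed_density : graded V fst 0 smoothed_density.
Proof.
have g1 : graded V fst 0 (fun _ _ => 1 : R).
  have -> : (fun (_ : R * R) (_ : R) => 1 : R) = (fun th s => 1 * th.1 ^+ 0 * s ^+ 0).
    by apply/funext => th; apply/funext => s; rewrite !mulr1.
  by apply: (graded_monomial fst (c := fun=> 1)) => //; exact: bounded_coef_cst.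
have -> : smoothed_density = (fun th s => Rho th s +
    -1 * kint (fun v => (Rho th s - Rho th (s + v)) * 1)).
  apply/funext => th; apply/funext => s; rewrite /smoothed_density.
  have cR : continuous (Rho th) := graded_continuous (th := th) gRho.
  have cRs : continuous (fun v => Rho th (s + v)).
    move=> v; apply: (@continuous_comp _ _ _ (fun v : R => s + v) (Rho th)).
      by apply: cvgD; [exact: cvg_cst|exact: cvg_id].
    exact: cR.
  under [X in _ + -1 * kint X]eq_fun do rewrite mulr1 -[Rho th s]mulr1.
  have b1 := locally_bounded_cst 1 0 (1 : R).
  have bc := locally_bounded_cst 1 0 (Rho th s).
  have fin1 := fin_leb 1 0.
  rewrite (local_intB kerK mid_leb ltr01 fin1 (g1 := fun t => Rho th s * cst 1 t)).
  - by rewrite leb_cst// mulN1r opprB mulr1 addrC subrK.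
  - exact: locally_boundedM.
  - exact: locally_bounded_continuous.
apply: graded_add => //; apply: (gradedZ (c := fun=> -1)); first exact: bounded_coef_cst.
by apply: graded_le (graded_residual kerK gRho g1).
Qed.

Lemma smoothed_density_mass : exists2 C, 0 <= C & forall th s, V th -> `|s| <= Sm - 1 ->
  `|E th.1 (th.2 + th.1 * s) (cst 1) - th.1 * smoothed_density th s| <=
  C * th.1 `^ (nu - 1) * th.1.
Proof.
exists `|Cf| => // th s Vth sS; have /andP[h0 _] := V01 Vth.
have cR : continuous (Rho th) := graded_continuous (th := th) gRho.
have bf := density_locally_bounded Vth sS.
have bR := locally_bounded_continuous th.1 (th.2 + th.1 * s) (rel_continuous (th := th) cR).
rewrite (local_int_density kerK densX)// -(local_int_window s Vth cR).
set y := _ + _ in bf bR *.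
have b1 := locally_bounded_cst th.1 y (1 : R).
rewrite -(local_intB kerK mid_leb h0 (fin_leb _ _))//; last exact: locally_boundedM.
rewrite -[_ * _ * _](_ : L th.1 y (fun t => `|Cf| * th.1 `^ (nu - 1) * cst 1 t) = _); last first.
  by rewrite leb_cst.
apply: (local_int_norm kerK mid_leb h0 (fin_leb _ _)) => //.
- by apply: locally_boundedB => //; exact: locally_boundedM.
move=> t /(window_rel Vth sS) [s' [s'S _ ->]]; rewrite !mulr1.
have -> : (th.2 + th.1 * s' - th.2) / th.1 = s' by field; rewrite gt_eqF.
rewrite (le_trans (f_Rho Vth s'S))// ler_wpM2r ?powR_ge0//; exact: ler_norm.
Qed.

Lemma powR_bandwidth th a b : V th -> a <= b -> th.1 `^ b <= th.1 `^ a.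
Proof. by move=> Vth ab; apply: ger_powR => //; exact: V01. Qed.

(** The smoothed density is compared with [f] at the centre by way of the true
    kernel mass, since [f] is Lipschitz whereas its expansion is only known
    through its distance to [f]. *)
Lemma smoothed_density_centre : exists2 C, 0 <= C & forall th s, V th -> `|s| <= Sm - 1 ->
  `|f th.2 - smoothed_density th s| <= C * th.1.
Proof.
have [C C0 hC] := smoothed_density_mass.
exists (`|Bf| * Sm + C); first by rewrite addr_ge0// mulr_ge0// (le_trans _ Sm1).
move=> th s Vth sS; have /andP[h0 h1] := V01 Vth.
have x01 : 0 < th.2 < 1.
  have := @Vin th 0 Vth; rewrite mulr0 addr0; apply.
  by rewrite normr0 (le_trans _ Sm1).
have bf := density_locally_bounded Vth sS.
have := hC th s Vth sS; set y := _ + _ in bf *; set e := E _ _ _ => he.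
rewrite -(ler_pM2r h0) -[X in _ * X]gtr0_norm// -normrM mulrBl [f _ * _]mulrC.
have -> : th.1 * f th.2 - smoothed_density th s * th.1 =
  (th.1 * f th.2 - e) + (e - th.1 * smoothed_density th s) by ring.
rewrite (le_trans (ler_normD _ _))// !mulrDl lerD//; last first.
  rewrite (le_trans he)// ler_pM2r// ler_wpM2l//.
  have n1 : 1 <= nu - 1 by rewrite lerBrDr; exact: nu2.
  by have := powR_bandwidth Vth n1; rewrite powRr1// ltW.
rewrite /e (local_int_density kerK densX)//.
have b1 := locally_bounded_cst th.1 y (1 : R).
have bc a := locally_bounded_cst th.1 y (a : R).
have Lc a : a * th.1 = L th.1 y (fun t => a * cst 1 t).
  by rewrite leb_cst.
have bf1 := locally_boundedM bf b1.
rewrite [th.1 * _]mulrC (Lc (f th.2)) (Lc (`|Bf| * Sm * th.1)) -(local_intB kerK mid_leb h0 (fin_leb _ _) (bdd_cst _ _ _) bf1).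
apply: (local_int_norm kerK mid_leb h0 (fin_leb _ _)).
- exact: (locally_boundedB (bdd_cst _ _ _) bf1).
- exact: bdd_cst.
move=> t ty; have t01 := window_in Vth sS ty; rewrite !mulr1.
have [s' [s'S _ tE]] := window_rel Vth sS ty.
rewrite distrC (le_trans (f_lip x01 t01))// -mulrA.
apply: (@le_trans _ _ (`|Bf| * `|t - th.2|)); first by rewrite ler_wpM2r// ler_norm.
rewrite ler_wpM2l// tE addrAC subrr add0r normrM (gtr0_norm h0) mulrC.
by rewrite ler_pM2r.
Qed.

(** The smoothed density is within [O(h)] of the constant [f x], so a geometric
    series truncated at an order at least [nu - 1] inverts it, with the same order
    of error as the expansion of the density has. *)
Lemma graded_inverse_mass : exists2 W, graded V fst 0 W &
  exists2 C, 0 <= C & forall th s, V th -> `|s| <= Sm - 1 ->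
  `|th.1 / E th.1 (th.2 + th.1 * s) (cst 1) - W th s| <= C * th.1 `^ (nu - 1).
Proof.
have [C1 C10 h1] := smoothed_density_mass.
have [C2 C20 h2] := smoothed_density_centre.
pose N := Num.bound (nu - 1).
have hN : nu - 1 <= N%:R by apply/ltW/archi_boundP; rewrite subr_ge0 (le_trans _ nu2)// ler1n.
pose z th s := 1 * th.1 ^+ 0 * s ^+ 0 + - (f th.2)^-1 * smoothed_density th s.
have x01 th : V th -> 0 < th.2 < 1.
  move=> Vth; have := @Vin th 0 Vth; rewrite mulr0 addr0; apply.
  by rewrite normr0 (le_trans _ Sm1).
have fx0 th : V th -> c0 <= f th.2 by move=> /x01/f_bounds/andP[].
have fxp th : V th -> 0 < f th.2 by move=> /fx0; apply: lt_le_trans.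
have bfV : bounded_coef V (fun th => (f th.2)^-1).
  exists c0^-1 => th Vth; rewrite normfV gtr0_norm ?fxp// lef_pV2 ?posrE ?fxp//.
  exact: fx0.
have bfN : bounded_coef V (fun th => - (f th.2)^-1).
  by have [C hC] := bfV; exists C => th /hC; rewrite normrN.
have gz : graded V fst 0 z.
  apply: graded_add.
    by apply: (graded_monomial fst (c := fun=> 1)) => //; exact: bounded_coef_cst.
  by apply: gradedZ => //; exact: graded_smoothed_density.
pose W th s := (f th.2)^-1 * \sum_(j < N) z th s ^+ j.
have gW : graded V fst 0 W.
  apply: gradedZ => //; apply: (graded_sum (G := fun j th s => z th s ^+ j)).
  by move=> j _; exact: graded_exp.
exists W => //.
have [CW hCW] := graded_bound bandwidth_in01 gW (Sm - 1).
exists ((`|C2 / c0| ^+ N + `|CW| * C1) / c0).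
  by rewrite divr_ge0 ?(ltW c00)// addr_ge0// mulr_ge0.
move=> th s Vth sS; have /andP[h0 h1'] := V01 Vth.
have := h1 th s Vth sS; have /andP[+ _] := mass_bounds Vth sS.
set e := E _ _ _ => ce he.
have e0 : 0 < e by apply: lt_le_trans ce; rewrite mulr_gt0.
have fn0 : f th.2 != 0 by rewrite gt_eqF// fxp.
have zE : z th s = 1 - (f th.2)^-1 * smoothed_density th s.
  by rewrite /z !mulr1 mulNr.
have WE : 1 - W th s * smoothed_density th s = z th s ^+ N.
  have sE : (f th.2)^-1 * smoothed_density th s = 1 - z th s.
    by rewrite zE subKr.
  by rewrite /W mulrAC sE (canRL (subrK _) (subrX1 (z th s) N)); ring.
have hz : `|z th s| <= `|C2 / c0| * th.1.
  have -> : z th s = (f th.2)^-1 * (f th.2 - smoothed_density th s).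
    by rewrite zE mulrBr mulVf.
  rewrite normrM normfV (gtr0_norm (fxp _ Vth)) mulrC normrM.
  rewrite (ger0_norm C20) normfV (gtr0_norm c00) [leRHS]mulrAC ler_pM ?invr_ge0 ?(ltW (fxp _ Vth))//.
    exact: h2.
  by rewrite lef_pV2 ?posrE ?fxp// fx0.
have -> : th.1 / e - W th s = (th.1 - W th s * e) / e.
  by field; rewrite gt_eqF.
rewrite normrM normfV (gtr0_norm e0) ler_pdivrMr//.
have -> : th.1 - W th s * e = th.1 * (1 - W th s * smoothed_density th s) +
   - W th s * (e - th.1 * smoothed_density th s) by ring.
rewrite (le_trans (ler_normD _ _))// WE.
apply: (@le_trans _ _ ((`|C2 / c0| ^+ N + `|CW| * C1) * th.1 `^ (nu - 1) * th.1)).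
  rewrite !mulrDl lerD//.
    rewrite normrM (gtr0_norm h0) mulrC ler_pM2r// normrX.
    rewrite (le_trans (lerXn2r _ _ _ hz)) ?nnegrE ?mulr_ge0 ?(ltW h0)//.
    rewrite exprMn ler_wpM2l ?exprn_ge0//.
    by rewrite -powR_mulrn ?(ltW h0)// powR_bandwidth.
  rewrite normrM normrN -mulrA -mulrA ler_pM// ?mulrA//.
  by rewrite (le_trans (hCW _ _ Vth sS))// mulr1 ler_norm.
rewrite [X in _ <= X](_ : _ = (`|C2 / c0| ^+ N + `|CW| * C1) * th.1 `^ (nu - 1) * (e / c0)).
  rewrite ler_wpM2l ?mulr_ge0 ?powR_ge0 ?addr_ge0 ?mulr_ge0//.
  by rewrite ler_pdivlMr// mulrC.
by rewrite -!mulrA; congr (_ * _); rewrite mulrC -!mulrA; congr (_ * _); rewrite mulrC.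
Qed.

(** The error [O(h ^ (nu - 1))] made on the density only ever multiplies increments
    of [u] over one bandwidth, which are [O(h)]: the approximation by graded
    polynomials survives with an error of the same order as before, and
    [graded_residual] raises the grade. *)
Lemma bias_step j S Q (u : R * R -> R -> R) (M Cu Co : R) : S <= Sm ->
  graded V fst j Q ->
  (forall th, V th -> measurable_fun setT (u th)) ->
  (forall th t, V th -> `|u th t| <= M) ->
  (forall th s, V th -> `|s| <= S ->
    `|u th (th.2 + th.1 * s) - Q th s| <= Cu * th.1 `^ nu) ->
  (forall th s s', V th -> `|s| <= S -> `|s'| <= S -> `|s' - s| <= 1 ->
    `|u th (th.2 + th.1 * s') - u th (th.2 + th.1 * s)| <= Co * th.1) ->
  exists2 Q', graded V fst j.+1 Q' & exists Cu' : R, forall th s, V th -> `|s| <= S - 1 ->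
    `|u th (th.2 + th.1 * s) - nw_pop X K th.1 (u th) (th.2 + th.1 * s) - Q' th s|
      <= Cu' * th.1 `^ nu.
Proof.
move=> SSm gQ mu uM uQ uo.
have [W gW [CW CW0 hW]] := graded_inverse_mass.
pose N th s := kint (fun v => (Q th s - Q th (s + v)) * Rho th (s + v)).
have gN : graded V fst j.+1 N := graded_residual kerK gQ gRho.
exists (fun th s => W th s * N th s); first exact: (graded_mul gW gN).
have [CN hCN] := graded_bound bandwidth_in01 gN (S - 1).
exists (2 * `|Cu| + `|Cf| * (2 * `|Cu| + `|Co|) / c0 + `|CN| * CW) => th s Vth sS.
have /andP[h0 h1] := V01 Vth; have sSm : `|s| <= Sm - 1 by rewrite (le_trans sS)// lerD2r.
have sS0 : `|s| <= S by rewrite (le_trans sS)// lerBlDr lerDl.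
set y := th.2 + th.1 * s; have e0 : 0 < E th.1 y (cst 1) := mass_gt0 Vth sSm.
have /andP[ce _] : c0 * th.1 <= E th.1 y (cst 1) <= F0 * th.1 := mass_bounds Vth sSm.
have hWe : `|th.1 / E th.1 y (cst 1) - W th s| <= CW * th.1 `^ (nu - 1) := hW th s Vth sSm.
have bf : locally_bounded th.1 y f := density_locally_bounded Vth sSm.
have win t : `|t - y| <= th.1 -> exists s', [/\ `|s'| <= S, `|s' - s| <= 1 & t = th.2 + th.1 * s'].
  exact: window_rel.
have relE s' : (th.2 + th.1 * s' - th.2) / th.1 = s' by field; rewrite gt_eqF.
have pnu : th.1 `^ (nu - 1) * th.1 = th.1 `^ nu.
  by rewrite -[X in _ * X]powRr1 ?(ltW h0)// -powRD ?subrK//; apply/implyP => _; rewrite gt_eqF.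
set e := E _ _ _ in e0 ce hWe *.
have cQ : continuous (Q th) := graded_continuous (th := th) gQ.
have cR : continuous (Rho th) := graded_continuous (th := th) gRho.
have bu : locally_bounded th.1 y (u th) by split; [exact: mu|exists M => t _; exact: uM].
have bq : locally_bounded th.1 y (fun t => Q th ((t - th.2) / th.1)).
  exact/locally_bounded_continuous/rel_continuous.
have bR : locally_bounded th.1 y (fun t => Rho th ((t - th.2) / th.1)).
  exact/locally_bounded_continuous/rel_continuous.
have bc a : locally_bounded th.1 y (cst a) := locally_bounded_cst _ _ a.
have finP := rv_preimage_fin X (y - th.1) (y + th.1).
have mX : measurable_fun setT X by [].
pose du t := u th y - u th t; pose dq t := Q th s - Q th ((t - th.2) / th.1).
have bdu : locally_bounded th.1 y du := locally_boundedB (bc _) bu.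
have bdq : locally_bounded th.1 y dq := locally_boundedB (bc _) bq.
have duE : u th y - nw_pop X K th.1 (u th) y = E th.1 y du / e.
  rewrite /nw_pop -/e; have -> : E th.1 y du = u th y * e - E th.1 y (u th).
    have bc1 : locally_bounded th.1 y (fun t => u th y * cst 1 t) := bdd_cst _ _ _.
    rewrite -(local_intZ kerK mX h0 finP _ (bc 1)) -(local_intB kerK mX h0 finP bc1 bu).
    by congr local_int; apply/funext => t; rewrite mulr1.
  by rewrite mulrBl mulfK ?gt_eqF.
have A12 : `|E th.1 y du - E th.1 y dq| <= 2 * `|Cu| * th.1 `^ nu * e.
  rewrite -(local_intB kerK mX h0 finP bdu bdq) -(local_intZ kerK mX h0 finP _ (bc 1)).
  apply: (local_int_norm kerK mX h0 finP); [exact: locally_boundedB|exact: bdd_cst|].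
  move=> t /win [s' [s'S _ ->]]; rewrite /du /dq relE mulr1.
  have -> : u th y - u th (th.2 + th.1 * s') - (Q th s - Q th s') =
    (u th y - Q th s) - (u th (th.2 + th.1 * s') - Q th s') by ring.
  rewrite (le_trans (ler_normB _ _))// -mulrA mulr_natl mulr2n lerD//.
    by rewrite (le_trans (uQ th s Vth sS0))// ler_wpM2r ?powR_ge0// ler_norm.
  by rewrite (le_trans (uQ th s' Vth s'S))// ler_wpM2r ?powR_ge0// ler_norm.
have hn : th.1 `^ nu <= th.1.
  rewrite -[leRHS]powRr1 ?(ltW h0)//; apply: powR_bandwidth => //.
  by rewrite (le_trans _ nu2)// ler1n.
have dq_le s' : `|s'| <= S -> `|s' - s| <= 1 -> `|dq (th.2 + th.1 * s')| <= (2 * `|Cu| + `|Co|) * th.1.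
  move=> s'S s's; rewrite /dq relE.
  have -> : Q th s - Q th s' = (u th (th.2 + th.1 * s') - Q th s') -
    (u th y - Q th s) - (u th (th.2 + th.1 * s') - u th y) by ring.
  rewrite (le_trans (ler_normB _ _))// mulrDl lerD//; last first.
    by rewrite (le_trans (uo th s s' Vth sS0 s'S s's))// ler_wpM2r ?(ltW h0)// ler_norm.
  rewrite (le_trans (ler_normB _ _))// -mulrA mulr_natl mulr2n.
  have CuN : Cu * th.1 `^ nu <= `|Cu| * th.1.
    by rewrite (le_trans (ler_wpM2r (powR_ge0 _ _) (ler_norm Cu)))// ler_wpM2l.
  by rewrite lerD// (le_trans _ CuN)//; exact: uQ.
have A2N : `|E th.1 y dq - th.1 * N th s| <= `|Cf| * (2 * `|Cu| + `|Co|) * th.1 `^ nu * th.1.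
  have cG : continuous (fun v => (Q th s - Q th v) * Rho th v).
    move=> v; apply: cvgM; last exact: cR.
    by apply: cvgB; [exact: cvg_cst|exact: cQ].
  have -> : th.1 * N th s = L th.1 y (fun t => dq t * Rho th ((t - th.2) / th.1)).
    by rewrite /N -(local_int_window s Vth cG).
  have [mdq _] := bdq.
  rewrite (local_int_density kerK densX)//.
  rewrite -(local_intB kerK mid_leb h0 (fin_leb _ _) (locally_boundedM bf bdq) (locally_boundedM bdq bR)).
  rewrite -(@leb_cst th.1 y _ h0).
  apply: (local_int_norm kerK mid_leb h0 (fin_leb _ _)).
  - exact: (locally_boundedB (locally_boundedM bf bdq) (locally_boundedM bdq bR)).
  - exact: bdd_cst.
  move=> t /win [s' [s'S s's ->]]; rewrite mulr1 relE.
  rewrite [f _ * _]mulrC -mulrBr normrM mulrC.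
  have -> : `|Cf| * (2 * `|Cu| + `|Co|) * th.1 `^ nu =
     (`|Cf| * th.1 `^ (nu - 1)) * ((2 * `|Cu| + `|Co|) * th.1) by rewrite -pnu; ring.
  apply: ler_pM => //; last exact: dq_le.
  rewrite (le_trans (f_Rho Vth (le_trans s'S SSm)))// ler_wpM2r ?powR_ge0//.
  exact: ler_norm.
have NB : `|N th s| <= `|CN| * th.1.
  rewrite (le_trans (hCN _ _ Vth sS))// (le_trans (ler_wpM2r _ (ler_norm CN))) ?exprn_ge0 ?(ltW h0)//.
  by rewrite ler_wpM2l// mulnS exprS ler_piMr ?(ltW h0)// exprn_ile1 ?(ltW h0).
rewrite duE.
have -> : E th.1 y du / e - W th s * N th s = (E th.1 y du - E th.1 y dq) / e +
   (E th.1 y dq - th.1 * N th s) / e + N th s * (th.1 / e - W th s).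
  by field; rewrite gt_eqF.
rewrite (le_trans (ler_normD _ _))// [leRHS]mulrDl lerD//.
  rewrite (le_trans (ler_normD _ _))// [leRHS]mulrDl lerD//.
    by rewrite normrM normfV (gtr0_norm e0) ler_pdivrMr.
  rewrite normrM normfV (gtr0_norm e0) ler_pdivrMr// (le_trans A2N)//.
  have -> : `|Cf| * (2 * `|Cu| + `|Co|) / c0 * th.1 `^ nu * e =
    `|Cf| * (2 * `|Cu| + `|Co|) * th.1 `^ nu * (e / c0) by ring.
  apply: ler_wpM2l; first by rewrite mulr_ge0 ?powR_ge0// mulr_ge0// addr_ge0// mulr_ge0.
  by rewrite ler_pdivlMr// mulrC.
rewrite normrM; apply: (@le_trans _ _ ((`|CN| * th.1) * (CW * th.1 `^ (nu - 1)))).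
  exact: ler_pM.
by rewrite le_eqVlt; apply/orP; left; apply/eqP; rewrite -pnu; ring.
Qed.

(** After [k] steps the residual is a polynomial of grade [k], up to [O(h ^ nu)], and
    its value at the centre of the window is [O(h ^ (2 * k))]. Each step narrows
    the window by one bandwidth and preserves the [O(h)] bound on increments over
    one bandwidth that the next step needs. *)
Lemma pop_bias (g : R -> R) (M Cu Co : R) Q (k : nat) : k%:R <= Sm ->
  graded V fst 0 Q -> measurable_fun setT g -> (forall t, `|g t| <= M) ->
  (forall th s, V th -> `|s| <= Sm ->
    `|g (th.2 + th.1 * s) - Q th s| <= Cu * th.1 `^ nu) ->
  (forall th s s', V th -> `|s| <= Sm -> `|s'| <= Sm -> `|s' - s| <= 1 ->
    `|g (th.2 + th.1 * s') - g (th.2 + th.1 * s)| <= Co * th.1) ->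
  nu <= (2 * k)%:R ->
  exists2 C, 0 <= C & forall th, V th -> `|pop_residual X K th.1 g k th.2| <= C * th.1 `^ nu.
Proof.
move=> kS gQ mg gM gQu go nuk.
pose res th k := pop_residual X K th.1 g k.
have reg k' th : V th -> measurable_fun setT (res th k') /\
    (forall t, `|res th k' t| <= 2 ^+ k' * M).
  by move=> /V01/andP[h0 _]; exact: pop_residual_regular.
have [Qk gQk [C hC]] : exists2 Qk, graded V fst k Qk & exists C : R,
    forall th s, V th -> `|s| <= Sm - k%:R ->
    `|res th k (th.2 + th.1 * s) - Qk th s| <= C * th.1 `^ nu.
  have : forall k', (k' <= k)%N -> (exists2 Qk, graded V fst k' Qk & exists C : R,
      forall th s, V th -> `|s| <= Sm - k'%:R ->
      `|res th k' (th.2 + th.1 * s) - Qk th s| <= C * th.1 `^ nu) /\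
    (forall th s s', V th -> `|s| <= Sm - k'%:R -> `|s'| <= Sm - k'%:R ->
      `|s' - s| <= 1 ->
      `|res th k' (th.2 + th.1 * s') - res th k' (th.2 + th.1 * s)| <=
      2 ^+ k' * Co * th.1).
    elim=> [_|k' IH /ltnW k'k].
      split; first by exists Q => //; exists Cu => th s Vth; rewrite subr0; exact: gQu.
      by move=> th s s'; rewrite subr0 expr0 mul1r; exact: go.
    have [[Qk gQk [C hC]] osc] := IH k'k.
    have kE : Sm - k'.+1%:R = Sm - k'%:R - 1 by rewrite -natr1 opprD addrA.
    have SSm : Sm - k'%:R <= Sm by rewrite lerBlDr lerDl.
    split.
      have [Q' gQ' [Cu' hCu']] := bias_step SSm gQk (fun th Vth => (reg k' th Vth).1)
        (fun th t Vth => (reg k' th Vth).2 t) hC osc.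
      by exists Q' => //; exists Cu' => th s Vth; rewrite kE; exact: hCu'.
    move=> th s s' Vth sS s'S _; have /andP[h0 _] := V01 Vth.
    have small s0 : `|s0| <= Sm - k'.+1%:R ->
        `|res th k'.+1 (th.2 + th.1 * s0)| <= 2 ^+ k' * Co * th.1.
      rewrite kE => s0S; rewrite /res /= distrC; apply: nw_pop_center => //.
      - by split; [exact: (reg _ _ Vth).1|exists (2 ^+ k' * M) => t _; exact: (reg _ _ Vth).2].
      - by apply: mass_gt0 => //; rewrite (le_trans s0S)// lerD2r.
      - move=> t /(window_rel Vth s0S) [s1 [s1S s1s ->]]; apply: osc => //.
        by rewrite (le_trans s0S)// lerBlDr lerDl.
    rewrite (le_trans (ler_normB _ _))// exprS -!mulrA mulr_natl mulr2n !mulrA.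
    by rewrite lerD// small.
  by move=> /(_ k (leqnn _)) [].
have [CQ hCQ] := graded_bound bandwidth_in01 gQk 0.
exists (`|C| + `|CQ|) => [|th Vth]; first by rewrite addr_ge0.
have := hC th 0 Vth; rewrite normr0 mulr0 addr0 subr_ge0 => /(_ kS) hk.
have := hCQ th 0 Vth; rewrite normr0 => /(_ (lexx _)) hq.
have /andP[h0 h1] := V01 Vth.
rewrite -[pop_residual _ _ _ _ _ _](subrK (Qk th 0)) (le_trans (ler_normD _ _))//.
rewrite mulrDl lerD//.
  by rewrite (le_trans hk)// ler_wpM2r ?powR_ge0// ler_norm.
rewrite (le_trans hq)// (le_trans (ler_wpM2r _ (ler_norm CQ))) ?exprn_ge0 ?(ltW h0)//.
by rewrite ler_wpM2l// -powR_mulrn ?(ltW h0)// powR_bandwidth.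
Qed.

End bias.

(** * Sums of independent variables *)

Section independence.
Context {R : realType} d (T : measurableType d) (P : probability T R).
Variables (X : {RV P >-> R}) (Xs : nat -> {RV P >-> R}).

Definition independent_copies :=
  (forall i (B : set R), measurable B -> P (Xs i @^-1` B) = P (X @^-1` B)) /\
  (forall n (B : nat -> set R), (forall i, measurable (B i)) ->
     P (\bigcap_(i in `I_n) Xs i @^-1` B i) = (\prod_(i < n) P (X @^-1` B i))%E).

Hypothesis copies : independent_copies.

Lemma bounded_integrable (F : T -> R) (C : R) : measurable_fun setT F ->
  (forall w, `|F w| <= C) -> P.-integrable setT (EFin \o F).
Proof.
move=> mF FC; apply: (@le_integrable _ _ _ P setT measurableT _ (EFin \o cst C)).
- exact/measurable_EFinP.
- move=> w _ /=; rewrite lee_fin (le_trans (FC w))//; exact: ler_norm.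
- exact: finite_measure_integrable_cst.
Qed.

Lemma preimage_rv_measurable (Y : {RV P >-> R}) (B : set R) :
  measurable B -> measurable (Y @^-1` B).
Proof. by move=> mB; rewrite -[Z in measurable Z]setTI; exact: measurable_funP. Qed.

Lemma law_fineK (Y : {RV P >-> R}) (B : set R) : measurable B ->
  (fine (P (Y @^-1` B)))%:E = P (Y @^-1` B).
Proof. by move=> mB; rewrite fineK// fin_num_measure//; exact: preimage_rv_measurable. Qed.

Lemma expectation_indic_rv (B : set R) : measurable B ->
  \int[P]_w \1_B (X w) = fine (P (X @^-1` B)).
Proof.
move=> mB; congr fine; rewrite -[X in _ = P X]setIT -integral_indic//.
exact: preimage_rv_measurable.
Qed.

Let prod_indic n (B : nat -> set R) : (forall i, measurable (B i)) ->
  (\int[P]_w (\prod_(i < n) \1_(B i) (Xs i w))%:E)%E =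
   (\prod_(i < n) \int[P]_w \1_(B i) (X w))%:E.
Proof.
move=> mB; have [_ indep] := copies.
have mI : measurable (\bigcap_(i in `I_n) Xs i @^-1` B i).
  by apply: bigcap_measurableType => // i _; exact: preimage_rv_measurable.
transitivity (P (\bigcap_(i in `I_n) Xs i @^-1` B i)).
  rewrite -[X in _ = P X]setIT -integral_indic//; apply: eq_integral => w _.
  congr EFin; rewrite indicE; case: (boolP (w \in _)).
    rewrite inE => wB; rewrite big1// => i _; rewrite indicE mem_set//.
    exact: (wB _ (ltn_ord i)).
  rewrite notin_setE => /existsNP [i] /not_implyP [/= ni wB].
  by rewrite (bigD1 (Ordinal ni))//= indicE memNset ?mul0r.
rewrite indep// (eq_bigr (fun i : 'I_n => (\int[P]_w \1_(B i) (X w))%:E)).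
  by rewrite -(big_morph EFin EFinM (erefl _)).
by move=> i _; rewrite expectation_indic_rv// law_fineK.
Qed.

Lemma prod_bounded n (phi : nat -> R -> R) (C : nat -> R) (w : T) (Q : pred 'I_n) :
  (forall i t, 0 <= phi i t <= C i) ->
  0 <= \prod_(i < n | Q i) phi i (Xs i w) <= \prod_(i < n | Q i) C i.
Proof.
move=> phiC; apply/andP; split; first by apply: prodr_ge0 => i _; case/andP: (phiC i (Xs i w)).
by apply: ler_prod => i _.
Qed.

Lemma prod_measurable n (phi : nat -> R -> R) (Q : pred 'I_n) :
  (forall i, measurable_fun setT (phi i)) ->
  measurable_fun setT (fun w => \prod_(i < n | Q i) phi i (Xs i w)).
Proof.
move=> mphi; under eq_fun do rewrite big_mkcond.
apply: measurable_prod => i _; case: (Q i) => //.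
exact: (measurableT_comp (mphi i)).
Qed.

(** Independence is a product rule for events. The factors are turned from
    indicators into general functions one at a time: for a fixed index, the
    product of the other factors is a weight to which the change of variables
    for weighted measures applies. *)
Lemma expectation_prod n (phi : nat -> R -> R) (C : nat -> R) :
  (forall i, measurable_fun setT (phi i)) -> (forall i t, 0 <= phi i t <= C i) ->
  (\int[P]_w (\prod_(i < n) phi i (Xs i w))%:E)%E =
  (\prod_(i < n) \int[P]_w phi i (X w))%:E.
Proof.
move=> mphi phiC.
suff : forall k, (k <= n)%N -> forall (phi : nat -> R -> R) (C : nat -> R),
    (forall i, measurable_fun setT (phi i)) -> (forall i t, 0 <= phi i t <= C i) ->
    (forall i, (k <= i)%N -> exists2 B : set R, measurable B & phi i = \1_B) ->
    (\int[P]_w (\prod_(i < n) phi i (Xs i w))%:E)%E =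
    (\prod_(i < n) \int[P]_w phi i (X w))%:E.
  move=> /(_ n (leqnn n)) H.
  pose phi' i := if (i < n)%N then phi i else \1_(setT : set R).
  have phi'E (i : 'I_n) : phi' i = phi i by rewrite /phi' ltn_ord.
  have -> : (\int[P]_w (\prod_(i < n) phi i (Xs i w))%:E)%E =
      (\int[P]_w (\prod_(i < n) phi' i (Xs i w))%:E)%E.
    by apply: eq_integral => w _; congr EFin; apply: eq_bigr => i _; rewrite phi'E.
  rewrite (H phi' (fun i => C i + 1)).
  - by congr EFin; apply: eq_bigr => i _; rewrite phi'E.
  - move=> i; rewrite /phi'; case: ifP => // _; exact: measurable_indic.
  - have C0 i : 0 <= C i by have /andP[+ +] := phiC i 0; exact: le_trans.
    move=> i t; rewrite /phi'; case: ifP => _.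
      by have /andP[-> /le_trans ->] := phiC i t; rewrite ?lerDl.
    by rewrite indicE in_setT ler01/= lerDr.
  - by move=> i ni; exists setT => //; rewrite /phi' ltnNge ni.
move=> {mphi phiC phi C}; elim=> [_ phi C mphi phiC ind|k IH kn phi C mphi phiC ind].
  have /choice[B hB] : forall i, exists B : set R, measurable B /\ phi i = \1_B.
    by move=> i; have [B mB e] := ind i (leq0n _); exists B.
  under eq_integral do under eq_bigr do rewrite (hB _).2.
  rewrite prod_indic; last by move=> i; exact: (hB i).1.
  by congr EFin; apply: eq_bigr => i _; rewrite (hB i).2.
pose ok : 'I_n := Ordinal kn.
pose e i := \int[P]_w phi i (X w).
have e0 i : 0 <= e i by apply: Rintegral_ge0 => w _; case/andP: (phiC i (X w)).
pose F w := \prod_(i < n | i != ok) phi i (Xs i w).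
have mF : measurable_fun setT F by exact: prod_measurable.
have F0 w : 0 <= F w by case/andP: (prod_bounded w (fun i => i != ok) phiC).
have c0 : 0 <= \prod_(i < n | i != ok) e i by apply: prodr_ge0.
pose c := NngNum c0.
have C0 i : 0 <= C i by have /andP[+ +] := phiC i 0; exact: le_trans.
have int i : P.-integrable setT (EFin \o (phi i \o X)).
  apply: (bounded_integrable (C := C i)); first exact: measurableT_comp.
  by move=> w /=; have /andP[p0 pC] := phiC i (X w); rewrite ger0_norm.
have Fkap (B : set R) : measurable B ->
    (\int[P]_(w in Xs k @^-1` B) (F w)%:E = mscale c (distribution P X) B)%E.
  move=> mB; pose phi' i := if i == k then \1_B else phi i.
  have phi'k : phi' k = \1_B by rewrite /phi' eqxx.
  have phi'E (i : 'I_n) : i != ok -> phi' i = phi i.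
    by move=> ik; rewrite /phi' ifN.
  transitivity (\int[P]_w (\prod_(i < n) phi' i (Xs i w))%:E)%E.
    rewrite integral_mkcond; apply: eq_integral => w _.
    rewrite (bigD1 ok)//= phi'k.
    have -> : \prod_(i < n | i != ok) phi' i (Xs i w) = F w.
      by apply: eq_bigr => i ik; rewrite phi'E.
    rewrite patchE indicE; have [hB|hB] := pselect (B (Xs k w)).
      by rewrite !mem_set// mul1r.
    by rewrite !memNset// mul0r.
  rewrite (IH (ltnW kn) phi' (fun i => C i + 1)).
  - rewrite (bigD1 ok)//= phi'k expectation_indic_rv//.
    rewrite /mscale /= muleC EFinM law_fineK// /distribution /pushforward.
    by congr (_ * _%:E)%E; apply: eq_bigr => i ik; rewrite phi'E.
  - by move=> i; rewrite /phi'; case: ifP => // _; exact: measurable_indic.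
  - move=> i t; rewrite /phi'; case: ifP => _.
      rewrite indicE ler0n/=; apply: (@le_trans _ _ 1); last by rewrite lerDr.
      by rewrite lern1 leq_b1.
    by have /andP[-> /le_trans ->] := phiC i t; rewrite ?lerDl.
  - move=> i ki; rewrite /phi'; case: ifPn => [_|ik]; first by exists B.
    by apply: ind; rewrite ltn_neqAle eq_sym ik.
transitivity (\int[P]_w (F w * phi k (Xs k w))%:E)%E.
  by apply: eq_integral => w _; rewrite (bigD1 ok)//= mulrC.
rewrite (integral_transport (kap := mscale c (distribution P X)) _ mF F0 Fkap)//.
rewrite ge0_integral_mscale//; last 2 first.
- exact/measurable_EFinP.
- by move=> t _; rewrite lee_fin; case/andP: (phiC k t).
rewrite ge0_integral_distribution//; last 2 first.
- exact/measurable_EFinP.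
- by move=> t; rewrite lee_fin; case/andP: (phiC k t).
rewrite (bigD1 ok)//= mulrC EFinM; congr (_ * _)%E.
by rewrite fineK//; exact: integrable_fin_num (int k).
Qed.

End independence.

(** * Exponential deviation inequality *)

Section chernoff_bound.
Context {R : realType}.

Lemma expR_le_quadratic (y : R) : `|y| <= 2^-1 -> expR y <= 1 + y + 2 * y ^+ 2.
Proof.
rewrite ler_norml => /andP[y1 y2].
have p : 0 < 1 - y by lra.
have q : 1 - y <= expR (- y) by rewrite -[leLHS]/(1 + - y) expR_ge1Dx.
have -> : expR y = (expR (- y))^-1 by rewrite expRN invrK.
apply: (@le_trans _ _ (1 - y)^-1).
  by rewrite lef_pV2 ?posrE// expR_gt0.
rewrite -[leLHS]mul1r ler_pdivrMr//.
have -> : (1 + y + 2 * y ^+ 2) * (1 - y) = 1 + y ^+ 2 * (1 - 2 * y) by ring.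
rewrite lerDl mulr_ge0 ?sqr_ge0//; lra.
Qed.

Context d (T : measurableType d) (P : probability T R).
Variables (X : {RV P >-> R}) (Xs : nat -> {RV P >-> R}).
Hypothesis copies : independent_copies X Xs.

Variables (phi : R -> R) (v : R).
Hypothesis mphi : measurable_fun setT phi.
Hypothesis phi1 : forall t, `|phi t| <= 1.
Hypothesis phiv : \int[P]_w (phi (X w) ^+ 2) <= v.

Lemma exp_moment (rho : R) : 0 < rho <= 2^-1 ->
  \int[P]_w expR (rho * phi (X w)) <=
  expR (rho * \int[P]_w phi (X w) + 2 * rho ^+ 2 * v).
Proof.
move=> /andP[r0 r1].
have mX : measurable_fun setT (fun w => phi (X w)) by exact: measurableT_comp.
have i1 : P.-integrable setT (EFin \o (fun w => phi (X w))).
  by apply: (bounded_integrable P (C := 1)) => // w; exact: phi1.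
have i2 : P.-integrable setT (EFin \o (fun w => phi (X w) ^+ 2)).
  apply: (bounded_integrable P (C := 1)); first exact: measurable_funX.
  by move=> w; rewrite normrX exprn_ile1.
have ri1 : P.-integrable setT (EFin \o (fun w => rho * phi (X w))).
  by apply: (integrableZl measurableT rho i1).
have ri2 : P.-integrable setT (EFin \o (fun w => 2 * rho ^+ 2 * phi (X w) ^+ 2)).
  by apply: (integrableZl measurableT (2 * rho ^+ 2) i2).
have ic : P.-integrable setT (EFin \o cst (1 : R)).
  exact: finite_measure_integrable_cst.
have isum1 : P.-integrable setT (EFin \o (fun w => 1 + rho * phi (X w))).
  exact: (integrableD measurableT ic ri1).
have small w : `|rho * phi (X w)| <= 2^-1.
  by rewrite normrM (gtr0_norm r0) -[leRHS]mulr1 ler_pM// ltW.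
apply: (@le_trans _ _ (1 + rho * \int[P]_w phi (X w) +
    2 * rho ^+ 2 * \int[P]_w (phi (X w) ^+ 2))).
  have -> : 1 + rho * \int[P]_w phi (X w) + 2 * rho ^+ 2 * \int[P]_w (phi (X w) ^+ 2) =
      \int[P]_w (1 + rho * phi (X w) + 2 * rho ^+ 2 * phi (X w) ^+ 2).
    have -> := RintegralD measurableT isum1 ri2.
    have -> := RintegralD measurableT ic ri1.
    have -> := RintegralZl (2 * rho ^+ 2) measurableT i2.
    have -> := RintegralZl rho measurableT i1.
    rewrite Rintegral_cst// mul1r; congr (_ + _ + _).
    by rewrite -[LHS]/(fine 1%E); congr fine; apply/esym; exact: probability_setT.
  apply: le_Rintegral => //.
  - apply: (bounded_integrable P (C := expR 2^-1)).
      apply: measurableT_comp; first exact: measurable_expR.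
      by apply: measurable_funM.
    move=> w; rewrite ger0_norm ?expR_ge0// ler_expR (le_trans _ (small w))//.
    exact: ler_norm.
  - exact: (integrableD measurableT isum1 ri2).
  - move=> w _; rewrite (le_trans (expR_le_quadratic (small w)))//.
    by rewrite exprMn mulrA.
apply: le_trans (expR_ge1Dx _); rewrite addrA lerD2l ler_wpM2l//.
by rewrite mulr_ge0// sqr_ge0.
Qed.

(** The exponential Markov inequality, with the variance of the summands rather
    than their range in the exponent: kernel weights are bounded but rarely
    nonzero, and the rate relies on it. *)
Lemma upper_deviation n (rho t : R) : 0 < rho <= 2^-1 ->
  (P [set w | (n%:R * \int[P]_w phi (X w) + t <= \sum_(i < n) phi (Xs i w))%R] <=
   (expR (2 * n%:R * rho ^+ 2 * v - rho * t))%R%:E)%E.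
Proof.
move=> rho2; have /andP[r0 r1] := rho2.
pose S w := \sum_(i < n) phi (Xs i w).
have mS : measurable_fun setT S.
  by apply: measurable_sum => i; exact: (measurableT_comp mphi).
pose SR : {RV P >-> R} := HB.pack S (isMeasurableFun.Build _ _ _ _ S mS).
have := chernoff SR (n%:R * \int[P]_w phi (X w) + t) r0.
move=> /le_trans; apply; rewrite /mmt_gen_fun unlock.
have -> : (\int[P]_w ((expR \o rho \o* SR) w)%:E)%E =
    (\int[P]_w (\prod_(i < n) expR (rho * phi (Xs i w)))%:E)%E.
  apply: eq_integral => w _; congr EFin.
  by rewrite /= /SR /= /S -expR_sum; congr expR; rewrite mulrC mulr_sumr.
rewrite (expectation_prod copies n (phi := fun _ t => expR (rho * phi t)) (C := fun _ => expR 1)).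
- rewrite -EFinM lee_fin prodr_const card_ord.
  apply: (@le_trans _ _ (expR (rho * \int[P]_w phi (X w) + 2 * rho ^+ 2 * v) ^+ n *
      expR (- (rho * (n%:R * \int[P]_w phi (X w) + t))))).
    rewrite ler_wpM2r ?expR_ge0// lerXn2r ?nnegrE ?expR_ge0//; last exact: exp_moment.
    by apply: Rintegral_ge0 => w _; exact: expR_ge0.
  rewrite -expRM_natl -expRD ler_expR le_eqVlt.
  by apply/orP; left; apply/eqP; ring.
- move=> _; apply: measurableT_comp; first exact: measurable_expR.
  by apply: measurable_funM.
- move=> _ s; rewrite expR_ge0/= ler_expR (le_trans (ler_norm _))// normrM.
  by rewrite (gtr0_norm r0) mulr_ile1 ?(ltW r0)//; lra.
Qed.

Lemma deviation_measurable n (a t : R) :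
  measurable [set w | t < `|\sum_(i < n) phi (Xs i w) - a|].
Proof.
have mS : measurable_fun setT (fun w => `|\sum_(i < n) phi (Xs i w) - a|).
  apply: measurableT_comp => //; apply: measurable_funB => //.
  by apply: measurable_sum => i; exact: (measurableT_comp mphi).
rewrite -[X in measurable X]setTI.
rewrite (_ : [set w | _] = (fun w => `|\sum_(i < n) phi (Xs i w) - a|) @^-1` `]t, +oo[).
  by apply: mS => //; exact: measurable_itv.
by apply/seteqP; split => w /=; rewrite in_itv/= andbT.
Qed.

End chernoff_bound.

Section two_sided.
Context {R : realType} d (T : measurableType d) (P : probability T R).
Variables (X : {RV P >-> R}) (Xs : nat -> {RV P >-> R}).
Hypothesis copies : independent_copies X Xs.

Lemma deviation (phi : R -> R) (v : R) n (rho t : R) :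
  measurable_fun setT phi -> (forall t, `|phi t| <= 1) ->
  \int[P]_w (phi (X w) ^+ 2) <= v -> 0 < rho <= 2^-1 ->
  (P [set w | (t < `|\sum_(i < n) phi (Xs i w) - n%:R * \int[P]_w phi (X w)|)%R]
   <= (2 * expR (2 * n%:R * rho ^+ 2 * v - rho * t))%R%:E)%E.
Proof.
move=> mphi phi1 phiv rho2.
have mphiN : measurable_fun setT (fun t => - phi t) by exact: measurable_funN.
have U := upper_deviation copies mphi phi1 phiv n t rho2.
have phiN1 s : `|- phi s| <= 1 by rewrite normrN.
have phivN : \int[P]_w ((- phi (X w)) ^+ 2) <= v.
  by under eq_Rintegral do rewrite sqrrN.
have D := upper_deviation copies mphiN phiN1 phivN n t rho2.
set A := [set w | _] in U; set B := [set w | _] in D.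
have IN : \int[P]_w (- phi (X w)) = - \int[P]_w phi (X w).
  rewrite -mulN1r -RintegralZl//; last first.
    apply: (bounded_integrable P (C := 1) (F := fun w => phi (X w))) => [|w]; last exact: phi1.
    exact: measurableT_comp.
  by apply: eq_Rintegral => w _; rewrite mulN1r.
have mset (c : R) (g : R -> R) : measurable_fun setT g ->
    measurable [set w | c <= \sum_(i < n) g (Xs i w)].
  move=> mg; have mS : measurable_fun setT (fun w => \sum_(i < n) g (Xs i w)).
    by apply: measurable_sum => i; exact: (measurableT_comp mg).
  rewrite -[X in measurable X]setTI.
  rewrite (_ : [set w | _] = (fun w => \sum_(i < n) g (Xs i w)) @^-1` `[c, +oo[).
    by apply: mS => //; exact: measurable_itv.
  by apply/seteqP; split => w /=; rewrite in_itv/= andbT.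
have mA : measurable A by exact: mset.
have mB : measurable B by exact: (mset _ _ mphiN).
apply: (@le_trans _ _ (P (A `|` B))).
  apply: le_measure; rewrite ?inE//; first exact: (deviation_measurable _ mphi).
    exact: measurableU.
  move=> w /=; rewrite lter_normr => /orP[h|h]; [left|right].
    by rewrite /A /=; lra.
  by rewrite /B /= IN sumrN; lra.
rewrite (le_trans (measureU2 _ mA mB))// mulr_natl mulr2n EFinD.
by apply: leeD.
Qed.

End two_sided.

(** * Uniform deviation of the empirical smoother *)

Section kernel_deviation.
Context {R : realType} d (T : measurableType d) (P : probability T R).
Variables (X : {RV P >-> R}) (K : R -> R).
Hypothesis kerK : smoothing_kernel K.
Local Notation E := (local_int K P X).
Implicit Types (h y x kap rho : R) (g u a : R -> R).

Definition wsum h n (xs : nat -> R) g x := \sum_(i < n) K ((xs i - x) / h) * g (xs i).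

Variable Xs : nat -> {RV P >-> R}.
Hypothesis copies : independent_copies X Xs.

(** The relative precision [rho] is chosen so that [n * h * rho ^+ 2 = ln n]:
    deviations of order [n * h * rho] are then polynomially unlikely. The constant
    in the threshold makes the probability of order [n ^- 6], which survives a union
    bound over a grid of [n ^ 3] points. *)
Lemma kernel_deviation n h x (F0 : R) kap rho a : 0 < h -> 0 < kap ->
  (forall t, K t <= kap) -> 0 < rho <= 2^-1 -> n%:R * h * rho ^+ 2 = ln n%:R ->
  E h x (cst 1) <= F0 * h -> measurable_fun setT a ->
  (forall t, `|t - x| <= h -> `|a t| <= 1) ->
  let A := [set w | (2 * F0 + 6 * kap) * n%:R * h * rho <
     `|wsum h n (Xs ^~ w) a x - n%:R * E h x a|] in
  measurable A /\ (P A <= (2 * expR (- (6 * ln n%:R)))%:E)%E.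
Proof.
move=> h0 kap0 Kk rho2 hrho mass ma a1; have [K0 _ _ _ _] := kerK.
pose phi t := kap^-1 * (K ((t - x) / h) * a t).
have Ka t : `|K ((t - x) / h) * a t| <= K ((t - x) / h).
  rewrite normrM (ger0_norm (K0 _)).
  have [/a1 h1|ht] := leP `|t - x| h; last by rewrite (kernel_out kerK)// mul0r.
  by rewrite ler_piMr.
have mphi : measurable_fun setT phi.
  apply: measurable_funM => //; apply: measurable_funM => //.
  exact: scaled_kernel_measurable.
have phiK t : `|phi t| <= kap^-1 * K ((t - x) / h).
  by rewrite /phi normrM (gtr0_norm (x := kap^-1)) ?invr_gt0// ler_pM2l ?invr_gt0.
have phi1 t : `|phi t| <= 1.
  by rewrite (le_trans (phiK t))// mulrC ler_pdivrMr// mul1r.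
have finP := rv_preimage_fin X (x - h) (x + h).
have mX : measurable_fun setT X by [].
have phiv : \int[P]_w (phi (X w) ^+ 2) <= kap^-1 * (F0 * h).
  apply: (@le_trans _ _ (kap^-1 * E h x (cst 1))); last first.
    by rewrite ler_pM2l ?invr_gt0.
  have b1 := locally_bounded_cst h x (1 : R).
  rewrite -(local_intZ kerK mX h0 finP kap^-1 b1).
  apply: le_Rintegral => //.
  - apply: (bounded_integrable P (C := 1)).
      by apply: measurable_funX; exact: (measurableT_comp mphi).
    by move=> w; rewrite normrX exprn_ile1.
  - exact: (local_int_integrable kerK mX h0 finP
      (locally_boundedM (locally_bounded_cst h x kap^-1) b1)).
  - move=> w _ /=; rewrite mulr1 [leRHS]mulrC -real_normK ?num_real//.
    by rewrite (le_trans _ (phiK (X w)))// expr2 ler_piMr.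
have EphiE : \int[P]_w phi (X w) = kap^-1 * E h x a.
  have ba : locally_bounded h x a by split=> //; exists 1.
  by rewrite /phi (RintegralZl _ measurableT (local_int_integrable kerK mX h0 finP ba)).
have sphiE w : \sum_(i < n) phi (Xs i w) = kap^-1 * wsum h n (Xs ^~ w) a x.
  by rewrite /wsum mulr_sumr.
pose t0 := (2 * F0 + 6 * kap) / kap * n%:R * h * rho.
have AE : [set w | (2 * F0 + 6 * kap) * n%:R * h * rho <
     `|wsum h n (Xs ^~ w) a x - n%:R * E h x a|] =
   [set w | t0 < `|\sum_(i < n) phi (Xs i w) - n%:R * \int[P]_w phi (X w)|].
  have t0E : t0 = kap^-1 * ((2 * F0 + 6 * kap) * n%:R * h * rho).
    by rewrite /t0; ring.
  apply/seteqP; split => w /=; rewrite sphiE EphiE (mulrCA n%:R) -mulrBr normrM;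
  by rewrite (gtr0_norm (x := kap^-1)) ?invr_gt0// t0E ltr_pM2l ?invr_gt0.
cbn zeta; rewrite AE; split; first exact: (deviation_measurable _ mphi).
have := deviation copies n t0 mphi phi1 phiv rho2.
rewrite (_ : 2 * n%:R * rho ^+ 2 * (kap^-1 * (F0 * h)) - rho * t0 = - (6 * ln n%:R))//.
by rewrite -hrho /t0; field; rewrite gt_eqF.
Qed.

End kernel_deviation.

Section smoother_error.
Context {R : realType} d (T : measurableType d) (P : probability T R).
Variables (X : {RV P >-> R}) (K : R -> R).
Hypothesis kerK : smoothing_kernel K.
Local Notation E := (local_int K P X).
Variable L : R.
Hypothesis L0 : 0 < L.
Hypothesis lipK : forall u v, `|K u - K v| <= L * `|u - v|.
Implicit Types (h y x z eta rho : R) (g u : R -> R).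

Definition nw_emp h n (xs : nat -> R) u x := \sum_(i < n) nw_weight K h n xs i x * u (xs i).

Lemma kernel_sumE h n xs x : kernel_sum K h n xs x = wsum K h n xs (cst 1) x / h.
Proof.
by rewrite /kernel_sum /wsum mulr_suml; apply: eq_bigr => i _; rewrite mulr1.
Qed.

Lemma nw_empE h n xs u x : 0 < h ->
  nw_emp h n xs u x = wsum K h n xs u x / wsum K h n xs (cst 1) x.
Proof.
move=> h0; rewrite /nw_emp /wsum [RHS]mulr_suml; apply: eq_bigr => i _.
rewrite /nw_weight kernel_sumE /scaled_kernel invfM invrK /wsum.
set s := \sum_(_ < _) _.
rewrite [LHS](_ : _ = (h^-1 * h) * (K ((xs i - x) / h) * u (xs i) * s^-1)); last by ring.
by rewrite mulVf ?gt_eqF// mul1r.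
Qed.

Lemma kernel_shift h x z eta g t : 0 < h -> `|x - z| <= eta -> eta <= h ->
  (forall s, `|s - z| <= 2 * h -> `|g s| <= 1) ->
  `|K ((t - x) / h) * g t - K ((t - z) / h) * g t| <= L * eta / h.
Proof.
move=> h0 xz eh g1; have eta0 : 0 <= eta by rewrite (le_trans _ xz).
rewrite -mulrBl normrM; have [/g1 gt1|ht] := leP `|t - z| (2 * h); last first.
  have zx : `|t - z| <= `|t - x| + `|x - z|.
    by rewrite (_ : t - z = (t - x) + (x - z)) ?ler_normD//; ring.
  by rewrite !(kernel_out kerK) ?subrr ?normr0 ?mul0r ?divr_ge0 ?mulr_ge0 ?(ltW L0) ?(ltW h0)//; lra.
apply: (@le_trans _ _ (L * eta / h * 1)); last by rewrite mulr1.
apply: ler_pM => //; rewrite (le_trans (lipK _ _))// -[leRHS]mulrA ler_pM2l//.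
rewrite -mulrBl normrM normfV (gtr0_norm h0) ler_pM2r ?invr_gt0//.
by rewrite (_ : t - x - (t - z) = - (x - z)) ?normrN//; ring.
Qed.

Lemma wsum_shift h n xs x z eta g : 0 < h -> `|x - z| <= eta -> eta <= h ->
  (forall s, `|s - z| <= 2 * h -> `|g s| <= 1) ->
  `|wsum K h n xs g x - wsum K h n xs g z| <= n%:R * (L * eta / h).
Proof.
move=> h0 xz eh g1; rewrite /wsum -sumrB (le_trans (ler_norm_sum _ _ _))//.
rewrite mulr_natl -[X in _ *+ X]card_ord -sumr_const.
by apply: ler_sum => i _; exact: kernel_shift.
Qed.

Lemma local_int_shift h x z eta g : 0 < h -> `|x - z| <= eta -> eta <= h ->
  measurable_fun setT g ->
  (forall s, `|s - z| <= 2 * h -> `|g s| <= 1) ->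
  `|E h x g - E h z g| <= L * eta / h.
Proof.
move=> h0 xz eh mg g1.
have mX : measurable_fun setT X by [].
have near y : `|y - z| <= h -> locally_bounded h y g.
  move=> yz; split=> //; exists 1 => s sy; apply: g1.
  have : `|s - z| <= `|s - y| + `|y - z|.
    by rewrite (_ : s - z = (s - y) + (y - z)) ?ler_normD//; ring.
  by lra.
have bx := near x (le_trans xz eh).
have bz : locally_bounded h z g by apply: near; rewrite subrr normr0 ltW.
have ix := local_int_integrable kerK mX h0 (rv_preimage_fin X _ _) bx.
have iz := local_int_integrable kerK mX h0 (rv_preimage_fin X _ _) bz.
rewrite /local_int -(RintegralB measurableT ix iz).
have iB := integrableB measurableT ix iz.
rewrite (le_trans (le_normr_Rintegral measurableT iB))//.
apply: (@le_trans _ _ (\int[P]_w (cst (L * eta / h) w))).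
  apply: le_Rintegral => //.
  - exact: (integrable_abse iB).
  - exact: finite_measure_integrable_cst.
  - by move=> w _; exact: kernel_shift.
rewrite Rintegral_cst// [Z in _ * Z](_ : _ = 1) ?mulr1// -[RHS]/(fine 1%E).
by congr fine; exact: probability_setT.
Qed.

(** The ratio [q' / p'] is at most 1 in absolute value, so errors in the denominator
    count no more than those in the numerator. *)
Lemma ratio_error (p q p' q' b e : R) : 0 < b -> b <= p' -> e <= b / 2 ->
  `|p - p'| <= e -> `|q - q'| <= e -> `|q'| <= p' ->
  0 < p /\ `|q / p - q' / p'| <= 4 * e / b.
Proof.
move=> b0 bp eb pp qq qp.
have b2 : b / 2 = 2^-1 * b by rewrite mulrC.
have pb : b / 2 <= p by move: pp; rewrite ler_distl => /andP[? _]; lra.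
have p0 : 0 < p by lra.
have p'0 : 0 < p' by lra.
split=> //.
have -> : q / p - q' / p' = ((q - q') + (q' / p') * (p' - p)) / p.
  by field; rewrite !gt_eqF.
rewrite normrM normfV (gtr0_norm p0) ler_pdivrMr//.
have e0 : 0 <= e by rewrite (le_trans _ pp).
rewrite (le_trans (ler_normD _ _))// normrM.
apply: (@le_trans _ _ (e + 1 * e)).
  rewrite lerD// ler_pM//; last by rewrite distrC.
  by rewrite normrM normfV (gtr0_norm p'0) ler_pdivrMr// mul1r.
apply: (@le_trans _ _ (4 * e / b * (b / 2))).
  by rewrite mul1r le_eqVlt; apply/orP; left; apply/eqP; field; rewrite gt_eqF.
by rewrite ler_wpM2l// divr_ge0 ?mulr_ge0// ltW.
Qed.

(** Both the sums and their expectations move little between [x] and a nearby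
    grid point [z]. Both smoothers reproduce constants, so the value of [u] at [z]
    can be subtracted first and the bound involves only the oscillation [omega]. *)
Lemma smoother_error n h x z eta rho M c0 omega u B (xs : nat -> R) :
  (0 < n)%N -> 0 < h -> 0 < c0 -> 0 < omega ->
  `|x - z| <= eta -> eta <= h -> eta <= h ^+ 2 * rho ->
  measurable_fun setT u -> (forall t, `|u t| <= B) ->
  (forall t, `|t - z| <= 2 * h -> `|u t - u z| <= omega) ->
  c0 * h <= E h x (cst 1) -> (M + 2 * L) * rho <= c0 / 2 ->
  `|wsum K h n xs (cst 1) z - n%:R * E h z (cst 1)| <= M * n%:R * h * rho ->
  `|wsum K h n xs (fun t => (u t - u z) / omega) z -
    n%:R * E h z (fun t => (u t - u z) / omega)| <= M * n%:R * h * rho ->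
  0 < kernel_sum K h n xs x /\
  `|nw_emp h n xs u x - nw_pop X K h u x| <= 4 * (M + 2 * L) / c0 * omega * rho.
Proof.
move=> n0 h0 c00 om0 xz eh er mu uB uo mass Mc D1 D2.
pose g t := (u t - u z) / omega.
have nR0 : 0 < n%:R :> R by rewrite ltr0n.
have mg : measurable_fun setT g.
  by apply: measurable_funM => //; apply: measurable_funB.
have g1 t : `|t - z| <= 2 * h -> `|g t| <= 1.
  by move=> /uo ut; rewrite normrM normfV (gtr0_norm om0) ler_pdivrMr// mul1r.
have c1 t : `|t - z| <= 2 * h -> `|cst 1 t : R| <= 1 by rewrite normr1.
have shift : L * eta / h <= L * (h * rho).
  rewrite -mulrA ler_pM2l// ler_pdivrMr// (le_trans er)//.
  by rewrite le_eqVlt; apply/orP; left; apply/eqP; ring.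
have dev (F : R -> R) : measurable_fun setT F ->
    (forall t, `|t - z| <= 2 * h -> `|F t| <= 1) ->
    `|wsum K h n xs F z - n%:R * E h z F| <= M * n%:R * h * rho ->
    `|wsum K h n xs F x - n%:R * E h x F| <= (M + 2 * L) * rho * (n%:R * h).
  move=> mF F1 DF.
  have e1 := wsum_shift n xs h0 xz eh F1; have e2 := local_int_shift h0 xz eh mF F1.
  have -> : wsum K h n xs F x - n%:R * E h x F =
    (wsum K h n xs F x - wsum K h n xs F z) + (wsum K h n xs F z - n%:R * E h z F) -
    n%:R * (E h x F - E h z F) by ring.
  rewrite (le_trans (ler_normB _ _))//.
  have -> : (M + 2 * L) * rho * (n%:R * h) =
    (n%:R * (L * (h * rho)) + M * n%:R * h * rho) + n%:R * (L * (h * rho)) by ring.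
  rewrite lerD//; last first.
    by rewrite normrM (gtr0_norm nR0) ler_pM2l// (le_trans e2).
  by rewrite (le_trans (ler_normD _ _))// lerD// (le_trans e1)// ler_pM2l.
have mX : measurable_fun setT X by [].
have finP := rv_preimage_fin X (x - h) (x + h).
have b1 := locally_bounded_cst h x (1 : R).
have bg : locally_bounded h x g.
  split=> //; exists 1 => t tx; apply: g1.
  have : `|t - z| <= `|t - x| + `|x - z|.
    by rewrite (_ : t - z = (t - x) + (x - z)) ?ler_normD//; ring.
  by lra.
have qp : `|n%:R * E h x g| <= n%:R * E h x (cst 1).
  rewrite normrM (gtr0_norm nR0) ler_pM2l//.
  apply: (local_int_norm kerK mX h0 finP bg b1) => t tx; apply: g1.
  have : `|t - z| <= `|t - x| + `|x - z|.
    by rewrite (_ : t - z = (t - x) + (x - z)) ?ler_normD//; ring.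
  by lra.
have mass' : c0 * (n%:R * h) <= n%:R * E h x (cst 1).
  by rewrite mulrCA ler_pM2l.
have nh0 : 0 < n%:R * h by rewrite mulr_gt0.
have eb : (M + 2 * L) * rho * (n%:R * h) <= c0 * (n%:R * h) / 2.
  by rewrite [leRHS]mulrAC ler_pM2r.
have b0 : 0 < c0 * (n%:R * h) by rewrite mulr_gt0.
have [p0 rat] := ratio_error b0 mass' eb (dev _ (measurable_cst _) c1 D1)
  (dev _ mg g1 D2) qp.
split; first by rewrite kernel_sumE divr_gt0.
set p := wsum _ _ _ _ (cst 1) x in p0 rat.
have E0 : 0 < E h x (cst 1) by rewrite (lt_le_trans _ mass)// mulr_gt0.
have bu := bounded_locally h x mu uB.
have empE : nw_emp h n xs u x - u z = omega * (wsum K h n xs g x / p).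
  rewrite nw_empE// -/p.
  have -> : wsum K h n xs u x = omega * wsum K h n xs g x + u z * p.
    rewrite /p /wsum !mulr_sumr -big_split/=; apply: eq_bigr => i _.
    by rewrite /g; field; rewrite gt_eqF.
  by field; rewrite gt_eqF.
have popE : nw_pop X K h u x - u z = omega * (n%:R * E h x g / (n%:R * E h x (cst 1))).
  rewrite /nw_pop.
  have -> : E h x u = omega * E h x g + u z * E h x (cst 1).
    rewrite -(local_intZ kerK mX h0 finP _ bg) -(local_intZ kerK mX h0 finP _ b1).
    rewrite -(local_intD kerK mX h0 finP).
    - by congr local_int; apply/funext => t; rewrite /g /=; field; rewrite gt_eqF.
    - exact: (locally_boundedM (locally_bounded_cst h x _) bg).
    - exact: (locally_boundedM (locally_bounded_cst h x _) b1).
  by field; rewrite !gt_eqF.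
have -> : nw_emp h n xs u x - nw_pop X K h u x =
  (nw_emp h n xs u x - u z) - (nw_pop X K h u x - u z) by ring.
rewrite empE popE -mulrBr normrM (gtr0_norm om0).
rewrite (le_trans (ler_wpM2l (ltW om0) rat))// le_eqVlt; apply/orP; left; apply/eqP.
by field; rewrite !gt_eqF.
Qed.

End smoother_error.

(** * From the population smoother to the boosting estimate *)

Section empirical_residual.
Context {R : realType}.
Variable K : R -> R.
Hypothesis kerK : smoothing_kernel K.
Implicit Types (h x : R) (g u v : R -> R) (xs : nat -> R).

Fixpoint emp_residual h n xs g (k : nat) : R -> R :=
  if k is k'.+1 then fun x => emp_residual h n xs g k' x -
    nw_emp K h n xs (emp_residual h n xs g k') x
  else g.

(** Boosting adds the smoothed residuals: with responses [g (xs i)] it computes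
    [1 - (1 - S) ^ (r + 1)] applied to [g], where [S] is the empirical smoother. *)
Lemma boosting_residual h n xs g r x :
  boosting K h n xs (fun i => g (xs i)) r x = g x - emp_residual h n xs g r.+1 x.
Proof.
elim: r x => [|r IH] x; first by rewrite /= subKr.
have -> : emp_residual h n xs g r.+2 x = emp_residual h n xs g r.+1 x -
  nw_emp K h n xs (emp_residual h n xs g r.+1) x by [].
rewrite -[LHS]/(boosting K h n xs (fun i => g (xs i)) r x + \sum_(i < n)
  nw_weight K h n xs i x * (g (xs i) - boosting K h n xs (fun i => g (xs i)) r (xs i))).
rewrite opprB addrA addrAC -IH; congr (_ + _).
by apply: eq_bigr => i _; rewrite IH subKr.
Qed.

Lemma kernel_sum_ge0 h n xs x : 0 < h -> 0 <= kernel_sum K h n xs x.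
Proof.
have [K0 _ _ _ _] := kerK => h0.
by apply: sumr_ge0 => i _; rewrite /scaled_kernel divr_ge0// ltW.
Qed.

Lemma nw_weight_ge0 h n xs i x : 0 < h -> 0 <= nw_weight K h n xs i x.
Proof.
have [K0 _ _ _ _] := kerK => h0.
by rewrite /nw_weight /scaled_kernel !divr_ge0 ?kernel_sum_ge0// ltW.
Qed.

Lemma nw_emp_bounded h n xs v x (c : R) : 0 < h -> 0 < kernel_sum K h n xs x ->
  (forall t, `|t - x| <= h -> `|v t| <= c) -> `|nw_emp K h n xs v x| <= c.
Proof.
move=> h0 S0 vc.
have w0 i : 0 <= nw_weight K h n xs i x by exact: nw_weight_ge0.
have w1 : \sum_(i < n) nw_weight K h n xs i x = 1.
  by rewrite -mulr_suml mulfV// gt_eqF.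
rewrite -[c]mul1r -w1 mulr_suml (le_trans (ler_norm_sum _ _ _))//.
apply: ler_sum => i _; rewrite normrM (ger0_norm (w0 i)).
have [ix|ix] := leP `|xs i - x| h; first by rewrite ler_wpM2l// vc.
by rewrite /nw_weight /scaled_kernel (kernel_out kerK)// !mul0r.
Qed.

Lemma nw_empB h n xs u v x :
  nw_emp K h n xs (fun t => u t - v t) x = nw_emp K h n xs u x - nw_emp K h n xs v x.
Proof. by rewrite /nw_emp -sumrB; apply: eq_bigr => i _; rewrite mulrBr. Qed.

Context d (T : measurableType d) (P : probability T R) (X : {RV P >-> R}).

(** The telescoping of the difference of the [k]-th powers of identity minus
    empirical smoother and of identity minus population smoother: identity minus
    empirical smoother has norm at most 2, and the two smoothers are only
    compared on the deterministic functions [pop_residual]. Every step loses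
    one bandwidth at each end of the interval. *)
Lemma residual_gap h n xs g g0 (a eta : R) r : 0 < h -> 0 <= eta ->
  (forall x, a <= x <= 1 - a -> g x = g0 x) ->
  (forall k x, (k <= r)%N -> a <= x <= 1 - a -> 0 < kernel_sum K h n xs x /\
    `|nw_emp K h n xs (pop_residual X K h g0 k) x -
      nw_pop X K h (pop_residual X K h g0 k) x| <= eta) ->
  forall k x, (k <= r.+1)%N -> a + k%:R * h <= x <= 1 - (a + k%:R * h) ->
  `|emp_residual h n xs g k x - pop_residual X K h g0 k x| <= (2 ^+ k - 1) * eta.
Proof.
move=> h0 eta0 gg0 cmp; elim=> [|k IH] x kr xI.
  rewrite /= gg0 ?subrr ?normr0 ?mul0r//; by move: xI; rewrite mul0r addr0.
have kh0 : 0 <= k%:R * h by rewrite mulr_ge0// ltW.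
have kE : k.+1%:R * h = k%:R * h + h by rewrite -natr1 mulrDl mul1r.
rewrite kE in xI; have [|S0 cm] := cmp k x kr; first by lra.
have gap t : `|t - x| <= h ->
    `|emp_residual h n xs g k t - pop_residual X K h g0 k t| <= (2 ^+ k - 1) * eta.
  by rewrite ler_distl => tx; apply: IH; [exact: ltnW|lra].
have gx : `|emp_residual h n xs g k x - pop_residual X K h g0 k x| <= (2 ^+ k - 1) * eta.
  by apply: gap; rewrite subrr normr0 ltW.
have := nw_emp_bounded h0 S0 gap; rewrite nw_empB /= => ge.
set e := emp_residual _ _ _ _ _ _ in gx *; set p := pop_residual _ _ _ _ _ _ in gx *.
set Se := nw_emp _ _ _ _ (emp_residual _ _ _ _ _) _ in ge *.
set Sp := nw_emp _ _ _ _ _ _ in ge cm *; set Pp := nw_pop _ _ _ _ _ in cm *.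
have -> : e - Se - (p - Pp) = (e - p) - (Se - Sp) - (Sp - Pp) by ring.
have -> : (2 ^+ k.+1 - 1) * eta = (2 ^+ k - 1) * eta + (2 ^+ k - 1) * eta + eta.
  by rewrite exprS; ring.
by rewrite (le_trans (ler_normB _ _))// lerD// (le_trans (ler_normB _ _))// lerD.
Qed.

End empirical_residual.

Section union_bound.
Context {R : realType} d (T : measurableType d) (P : probability T R).

Lemma union_bound n (A : nat -> set T) (c : R) :
  (forall i, (i < n)%N -> measurable (A i) /\ (P (A i) <= c%:E)%E) ->
  measurable (\big[setU/set0]_(i < n) A i) /\
  (P (\big[setU/set0]_(i < n) A i) <= (n%:R * c)%:E)%E.
Proof.
elim: n => [|n IH] hA.
  by rewrite big_ord0 measure0 mul0r; split.
have [mU PU] : measurable (\big[setU/set0]_(i < n) A i) /\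
    (P (\big[setU/set0]_(i < n) A i) <= (n%:R * c)%:E)%E.
  by apply: IH => i /ltnW; exact: hA.
have [mA PA] := hA n (ltnSn n).
rewrite big_ord_recr/=; split; first exact: measurableU.
rewrite (le_trans (measureU2 _ mU mA))// -natr1 mulrDl mul1r EFinD.
exact: leeD.
Qed.

Lemma mem_bigsetU n (A : nat -> set T) i : (i < n)%N ->
  A i `<=` \big[setU/set0]_(i < n) A i.
Proof. by move=> ni w Aw; rewrite -bigcup_mkord; exists i. Qed.

End union_bound.

(** * Uniform rate for noiseless responses *)

Section expansion.
Context {R : realType}.
Variables (V : R * R -> Prop) (Sm : R).
Hypothesis V01 : forall th, V th -> 0 < th.1 <= 1.
Hypothesis Vin : forall th (s : R), V th -> `|s| <= Sm -> 0 < th.2 + th.1 * s < 1.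
Hypothesis Sm1 : 1 <= Sm.

(** Substituting [y - x = h * s] in the [k]-th term produces as many powers of [h] as
    of [s]. *)
Lemma expansion_graded (g : R -> R) p (c : nat -> R -> R) (B C e : R) : 0 <= e ->
  (forall k x, (k <= p)%N -> 0 < x < 1 -> `|c k x| <= B) ->
  (forall x y, 0 < x < 1 -> 0 < y < 1 ->
    `|g y - \sum_(k < p.+1) c k x * (y - x) ^+ k| <= C * `|y - x| `^ e) ->
  exists2 Q, graded V fst 0 Q & exists C' : R, forall th (s : R), V th -> `|s| <= Sm ->
    `|g (th.2 + th.1 * s) - Q th s| <= C' * th.1 `^ e.
Proof.
move=> e0 cB gC; have S0 : 0 <= Sm by rewrite (le_trans _ Sm1).
have x01 th : V th -> 0 < th.2 < 1.
  by move=> Vth; have := @Vin th 0 Vth; rewrite mulr0 addr0 normr0; exact.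
exists (fun th s => \sum_(k < p.+1) c k th.2 * th.1 ^+ k * s ^+ k).
  apply: (graded_sum (G := fun k th s => c k th.2 * th.1 ^+ k * s ^+ k)) => k kp.
  apply: (graded_monomial fst (c := fun th => c k th.2)); last by rewrite addn0.
  by exists B => th /x01; exact: cB.
exists (`|C| * Sm `^ e) => th s Vth sS; have /andP[h0 h1] := V01 Vth.
have := gC _ _ (x01 _ Vth) (Vin Vth sS).
rewrite addrAC subrr add0r => gQ.
rewrite (eq_bigr (fun k : 'I_p.+1 => c k th.2 * (th.1 * s) ^+ k)); last first.
  by move=> k _; rewrite exprMn mulrA.
rewrite (le_trans gQ)// normrM (gtr0_norm h0) powRM ?(ltW h0)//.
rewrite [in leRHS]mulrAC -[leRHS]mulrA (le_trans (ler_wpM2r _ (ler_norm C)))//.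
  by rewrite mulr_ge0 ?powR_ge0.
rewrite ler_wpM2l// ler_wpM2l ?powR_ge0// ge0_ler_powR ?nnegrE//.
Qed.

End expansion.

(** The deterministic functions that are smoothed are bounded in number, so a union
    bound over them and over a grid of mesh [n ^- 3] controls the empirical smoother
    at all grid points, and [smoother_error] carries this over to all points. *)
Lemma boosting_rate (R : realType) d (T : measurableType d) (P : probability T R)
    (X : {RV P >-> R}) (Xs : nat -> {RV P >-> R}) (f m K : R -> R)
    (nu C1 C2 eps c0 : R) (r : nat) :
  independent_copies X Xs -> smoothing_kernel K -> has_density X f ->
  measurable_fun setT m -> 2 <= nu -> 0 <= C1 -> 0 <= C2 ->
  holder_class nu C1 m -> holder_class (nu - 1) C2 f ->
  nu <= (2 * r.+1)%:R -> 0 < eps < 2^-1 ->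
  0 < c0 -> (forall t, 0 < t < 1 -> c0 <= f t) ->
  exists C h1 rho1 : R, [/\ 0 < C, 0 < h1, 0 < rho1 &
  forall n h rho, (0 < n)%N -> 0 < h <= h1 -> 0 < rho <= rho1 ->
  n%:R * h * rho ^+ 2 = ln n%:R -> (n%:R ^+ 3)^-1 <= h ->
  (n%:R ^+ 3)^-1 <= h ^+ 2 * rho ->
  exists A : set T, [/\ measurable A,
    (P A <= ((4 * r.+2%:R) / n%:R)%:E)%E &
    forall w, ~ A w -> forall x, eps <= x <= 1 - eps ->
      0 < kernel_sum K h n (Xs ^~ w) x /\
      `|boosting K h n (Xs ^~ w) (fun i => m (Xs i w)) r x - m x| <=
        C * (h `^ nu + h * rho)]].
Proof.
move=> copies kerK densX mm nu2 C10 C20 m_class f_class r_nu eps_range c00 f_c0.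
have /andP[eps0 eps2] := eps_range.
have nu11 : 1 <= nu - 1 by rewrite lerBrDr; exact: nu2.
have nu1 : 1 <= nu by rewrite (le_trans _ nu2)// ler1n.
have [pf [cf [Bf [_ cfB fT f_lip]]]] := holder_expansion nu11 C20 f_class.
have [pm [cm [Bm [cm0 cmB mT m_lip]]]] := holder_expansion nu1 C10 m_class.
have half01 : 0 < (2^-1 : R) < 1 by rewrite invr_gt0 ltr0n/= invf_lt1// ltr1n.
pose F0 := `|f 2^-1| + `|Bf|.
have f_F0 t : 0 < t < 1 -> c0 <= f t <= F0.
  move=> t01; rewrite f_c0//= /F0.
  have -> : f t = f 2^-1 + (f t - f 2^-1) by ring.
  rewrite lerD// ?ler_norm// (le_trans (ler_norm _))// (le_trans (f_lip _ _ half01 t01))//.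
  rewrite (le_trans (ler_wpM2r _ (ler_norm Bf)))// ler_piMr//.
  by move: t01 half01; rewrite ler_norml; clear; move=> ? ?; apply/andP; split; lra.
have F00 : 0 < F0.
  by have /andP[h1 h2] := f_F0 _ half01; rewrite (lt_le_trans c00)// (le_trans h1).
pose dl := eps / 2; have dl0 : 0 < dl by rewrite divr_gt0.
have dlE : eps = dl + dl by rewrite /dl; field.
(* The regression function is known to be bounded on the unit interval only; it is
   cut off away from the endpoints, further out than the estimate at points of
   the inner interval can see after r + 1 iterations. *)
pose m0 t := if (dl <= t <= 1 - dl) then m t else 0.
have m0E t : dl <= t <= 1 - dl -> m0 t = m t by rewrite /m0 => ->.
have mm0 : measurable_fun setT m0.
  rewrite (_ : m0 = (fun t => m t * \1_(`[dl, 1 - dl]%classic) t)).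
    by apply: measurable_funM => //; apply: measurable_indic; exact: measurable_itv.
  apply/funext => t; rewrite /m0 indicE; case: ifPn => ht.
    by rewrite mem_set ?mulr1//= in_itv.
  by rewrite memNset ?mulr0//= in_itv/=; exact/negP.
have m0B t : `|m0 t| <= `|Bm|.
  rewrite /m0; case: ifPn => [ht|_]; last by rewrite normr0.
  rewrite -cm0 (le_trans (cmB 0%N t _ _))// ?ler_norm//.
  by move: ht dl0; clear; lra.
pose h1 := Num.min 1 (dl / 2 / (r + 4)%:R).
have h10 : 0 < h1 by rewrite lt_min ltr01/= !divr_gt0// ltr0n addn4.
have h1_small h : 0 < h <= h1 -> h <= 1 /\ (r + 4)%:R * h <= dl / 2.
  move=> /andP[h0]; rewrite le_min => /andP[-> hd]; split=> //.
  by rewrite mulrC -ler_pdivlMr// ltr0n addn4.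
pose V (th : R * R) := 0 < th.1 <= h1 /\ eps <= th.2 <= 1 - eps.
pose Sm : R := r.+1%:R.
have Sm1 : 1 <= Sm by rewrite ler1n.
have V01 th : V th -> 0 < th.1 <= 1.
  by move=> [hh _]; have [-> _] := h1_small _ hh; case/andP: hh => ->.
have rE h : (r + 4)%:R * h = Sm * h + h + h + h.
  by rewrite /Sm -!natr1 natrD; ring.
have Vdl th s : V th -> `|s| <= Sm -> dl <= th.2 + th.1 * s <= 1 - dl.
  move=> [hh /andP[x1 x2]] sS; have /andP[h0 _] := hh.
  have [_] := h1_small _ hh; rewrite rE => hS.
  have : `|th.1 * s| <= Sm * th.1 by rewrite normrM (gtr0_norm h0) mulrC ler_pM2r.
  by rewrite ler_norml; move: h0 hS x1 x2 dlE; clear; lra.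
have Vin th s : V th -> `|s| <= Sm -> 0 < th.2 + th.1 * s < 1.
  by move=> Vth sS; move: (Vdl _ _ Vth sS) dl0; clear; lra.
have e10 : 0 <= nu - 1 by rewrite (le_trans _ nu11).
have e0 : 0 <= nu by rewrite (le_trans _ nu1).
have [Rho gRho [Cf hRho]] := expansion_graded V01 Vin Sm1 e10 cfB fT.
have [Q gQ [Cm hQ]] := expansion_graded V01 Vin Sm1 e0 cmB mT.
have m0Q th s : V th -> `|s| <= Sm ->
    `|m0 (th.2 + th.1 * s) - Q th s| <= Cm * th.1 `^ nu.
  by move=> Vth sS; rewrite m0E; [exact: hQ|exact: Vdl].
have m0osc th s s' : V th -> `|s| <= Sm -> `|s'| <= Sm -> `|s' - s| <= 1 ->
    `|m0 (th.2 + th.1 * s') - m0 (th.2 + th.1 * s)| <= `|Bm| * th.1.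
  move=> Vth sS s'S ss; have /andP[h0 _] := V01 _ Vth.
  rewrite !m0E ?Vdl// (le_trans (m_lip _ _ (Vin _ _ Vth sS) (Vin _ _ Vth s'S)))//.
  rewrite (le_trans (ler_wpM2r _ (ler_norm Bm)))// ler_wpM2l//.
  have -> : th.2 + th.1 * s' - (th.2 + th.1 * s) = th.1 * (s' - s) by ring.
  by rewrite normrM (gtr0_norm h0) ler_piMr// ltW.
have [Cb Cb0 hbias] := pop_bias kerK densX V01 Vin Sm1 c00 f_F0 f_lip nu2 gRho hRho
  (lexx _) gQ mm0 m0B m0Q m0osc r_nu.
have [L L0 lipK] := kernel_lipschitz kerK.
have [kap kap0 Kk] := kernel_bounded kerK.
pose M := 2 * F0 + 6 * kap.
have M0 : 0 < M by rewrite addr_gt0// mulr_gt0.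
have ML0 : 0 < M + 2 * L by rewrite addr_gt0// mulr_gt0.
pose om := 2 ^+ r * (2 * (`|Bm| + 1)).
have om0 : 0 < om by rewrite mulr_gt0 ?exprn_gt0// mulr_gt0// ltr_wpDl.
pose Cs := 2 ^+ r.+1 * (4 * (M + 2 * L) / c0 * om).
have Cs0 : 0 < Cs by rewrite !mulr_gt0 ?exprn_gt0 ?invr_gt0.
pose rho1 := Num.min 2^-1 (c0 / 2 / (M + 2 * L)).
exists (Cb + Cs), h1, rho1; split => //.
- by rewrite ltr_wpDl.
- by rewrite lt_min !divr_gt0// invr_gt0 ltr0n.
move=> n h rho n0 hh /andP[rho0]; rewrite le_min => /andP[rho2 rhoc] hrho eh er.
have /andP[h0 _] := hh; have [hle1 hr] := h1_small _ hh.
have Mrho : (M + 2 * L) * rho <= c0 / 2 by rewrite mulrC -ler_pdivlMr.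
have mass y : dl <= y <= 1 - dl -> c0 * h <= local_int K P X h y (cst 1) <= F0 * h.
  move=> /andP[y1 y2]; apply: (kernel_mass_bounds kerK densX h0 (ltW c00)) => t.
  rewrite ler_distl => /andP[t1 t2]; apply: f_F0.
  have Sh : 0 <= Sm * h by rewrite mulr_ge0// ltW.
  by move: hr Sh h0 y1 y2 t1 t2 dl0; rewrite rE; clear; lra.
have mass0 y : dl <= y <= 1 - dl -> 0 < local_int K P X h y (cst 1).
  by move=> /mass/andP[+ _]; apply: lt_le_trans; rewrite mulr_gt0.
pose u k := pop_residual X K h m0 k.
have ureg k : measurable_fun setT (u k) /\ forall t, `|u k t| <= 2 ^+ k * `|Bm|.
  exact: pop_residual_regular.
have uosc k z t : (k <= r)%N -> dl + Sm * h <= z <= 1 - (dl + Sm * h) ->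
    dl + Sm * h <= t <= 1 - (dl + Sm * h) -> `|t - z| <= 2 * h ->
    `|u k t - u k z| <= om * h.
  move=> kr zI tI tz.
  have kS : k%:R * h <= Sm * h by rewrite ler_pM2r// ler_nat leqW.
  have osc0 a b : dl <= a <= 1 - dl -> dl <= b <= 1 - dl -> `|b - a| <= 2 * h ->
      `|m0 b - m0 a| <= (`|Bm| + 1) * (2 * h).
    move=> aI bI ab; rewrite !m0E//.
    have in01 c : dl <= c <= 1 - dl -> 0 < c < 1 by move: dl0; clear; lra.
    rewrite (le_trans (m_lip _ _ (in01 _ aI) (in01 _ bI)))//.
    rewrite (le_trans (ler_wpM2r _ (ler_norm Bm)))// ler_pM//.
    by rewrite lerDl.
  rewrite (le_trans (pop_residual_osc kerK (k := k) h0 mm0 m0B mass0 osc0 _ _ tz))//.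
  + by move: kS zI; clear; lra.
  + by move: kS tI; clear; lra.
  rewrite /om -!mulrA (mulrCA _ 2 h) ler_pM ?exprn_ge0 ?mulr_ge0 ?addr_ge0 ?(ltW h0)//.
  by rewrite ler_eXn2l// ltr1n.
pose zgrid j : R := j%:R / n%:R ^+ 3.
pose inner z := dl + Sm * h + 2 * h <= z <= 1 - (dl + Sm * h + 2 * h).
(* Index r + 1 stands for the constant 1, that is for the denominators. *)
pose a j k t := if (k <= r)%N then (u k t - u k (zgrid j)) / (om * h) else 1.
pose Abad j k := if inner (zgrid j) then
  [set w | M * n%:R * h * rho < `|wsum K h n (Xs ^~ w) (a j k) (zgrid j) -
     n%:R * local_int K P X h (zgrid j) (a j k)|] else set0.
have omh0 : 0 < om * h by rewrite mulr_gt0.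
have Abad_small j k : measurable (Abad j k) /\
    (P (Abad j k) <= (2 * expR (- (6 * ln n%:R)))%:E)%E.
  rewrite /Abad; case: ifPn => [/andP[z1 z2]|_]; last first.
    by split=> //; rewrite measure0 lee_fin mulr_ge0// expR_ge0.
  have Sh : 0 <= Sm * h by rewrite mulr_ge0// ltW.
  apply: (kernel_deviation kerK copies h0 kap0 Kk _ hrho) => //.
  + by rewrite rho0.
  + suff /andP[] : c0 * h <= local_int K P X h (zgrid j) (cst 1) <= F0 * h by [].
      by apply: mass; move: z1 z2 Sh h0; clear; lra.
  + rewrite /a; case: (k <= r)%N => //; apply: measurable_funM => //.
    by apply: measurable_funB => //; exact: (ureg k).1.
  + move=> t tz; rewrite /a; case: ifP => [kr|_]; last by rewrite normr1.
    rewrite normrM normfV (gtr0_norm omh0) ler_pdivrMr// mul1r.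
    apply: uosc => //.
    + by move: z1 z2 h0; clear; lra.
    + by move: tz; rewrite ler_distl; move: z1 z2 h0; clear; lra.
    + by move: tz h0; clear; lra.
pose A := \big[setU/set0]_(j < (n ^ 3).+1) \big[setU/set0]_(k < r.+2) Abad j k.
have [mA PA] : measurable A /\
    (P A <= ((n ^ 3).+1%:R * (r.+2%:R * (2 * expR (- (6 * ln n%:R)))))%:E)%E.
  have U j : measurable (\big[setU/set0]_(k < r.+2) Abad j k) /\
      (P (\big[setU/set0]_(k < r.+2) Abad j k) <=
       (r.+2%:R * (2 * expR (- (6 * ln n%:R))))%:E)%E.
    by have := @union_bound R d T P r.+2 (Abad j); apply => k _; exact: Abad_small.
  by have := @union_bound R d T P (n ^ 3).+1 (fun j => \big[setU/set0]_(k < r.+2) Abad j k); apply.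
have nR0 : 0 < n%:R :> R by rewrite ltr0n.
exists A; split => //.
  apply: (le_trans PA); rewrite lee_fin.
  have -> : expR (- (6 * ln n%:R)) = (n%:R ^+ 6)^-1 :> R.
    by rewrite expRN expRM_natl lnK// posrE.
  have n1 : 1 <= n%:R :> R by rewrite ler1n.
  rewrite mulrCA [leRHS]mulrAC [leRHS]mulrC ler_wpM2l// -natr1 natrX.
  rewrite mulrA ler_pdivrMr ?exprn_gt0// [leRHS]mulrAC ler_pdivlMr//.
  set N := n%:R; have N3 : 1 <= N ^+ 3 by rewrite exprn_ege1.
  have N56 : N ^+ 4 <= N ^+ 6 by rewrite ler_weXn2l.
  have N14 : N <= N ^+ 4 by rewrite -[leLHS]expr1 ler_weXn2l.
  have -> : (N ^+ 3 + 1) * 2 * N = 2 * N ^+ 4 + 2 * N by ring.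
  by move: N56 N14; clear; lra.
move=> w nAw x /andP[x1 x2].
have Sh : 0 <= Sm * h by rewrite mulr_ge0// ltW.
have hrS : Sm * h + h + h + h <= dl / 2 by rewrite -rE.
have cmp k y : (k <= r)%N -> eps - Sm * h <= y <= 1 - (eps - Sm * h) ->
    0 < kernel_sum K h n (Xs ^~ w) y /\
    `|nw_emp K h n (Xs ^~ w) (u k) y - nw_pop X K h (u k) y| <=
      4 * (M + 2 * L) / c0 * (om * h) * rho.
  move=> kr yI.
  pose j := Num.truncn (y * n%:R ^+ 3).
  have y0 : 0 <= y by move: yI hrS dlE dl0 h0; clear; lra.
  have y1 : y <= 1 by move: yI hrS dlE dl0 h0; clear; lra.
  have yn0 : 0 <= y * n%:R ^+ 3 by rewrite mulr_ge0// exprn_ge0.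
  have n30 : 0 < n%:R ^+ 3 :> R by rewrite exprn_gt0.
  have /andP[j1 j2] := truncn_itv yn0.
  have jn : (j < (n ^ 3).+1)%N.
    by rewrite ltnS -(ler_nat R) natrX (le_trans j1)// ler_piMl// ltW.
  have yz : `|y - zgrid j| <= (n%:R ^+ 3)^-1.
    rewrite /zgrid ler_distl; apply/andP; split.
      by rewrite lerBlDr (@le_trans _ _ y) ?ler_pdivrMr// lerDl invr_ge0 ltW.
    by rewrite -[X in _ + X]mul1r -mulrDl natr1 ler_pdivlMr// ltW.
  have zI : inner (zgrid j).
    by move: yz eh yI hrS dlE dl0 h0; rewrite ler_distl /inner; clear; lra.
  have nbad k' : (k' < r.+2)%N -> `|wsum K h n (Xs ^~ w) (a j k') (zgrid j) -
      n%:R * local_int K P X h (zgrid j) (a j k')| <= M * n%:R * h * rho.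
    move=> k'r; rewrite leNgt; apply/negP => bad; apply: nAw.
    apply: (mem_bigsetU (A := fun j => \big[setU/set0]_(k < r.+2) Abad j k) jn).
    by apply: (mem_bigsetU (A := Abad j) k'r); rewrite /Abad zI.
  have D1 := nbad r.+1 (ltnSn _); have D2 := nbad k (leqW kr).
  have [uk1 uk2] := ureg k.
  apply: (smoother_error kerK L0 lipK n0 h0 c00 omh0 yz eh er uk1 uk2 _ _ Mrho).
  + move=> t tz; apply: uosc => //.
      by move: zI h0; rewrite /inner; clear; lra.
    by move: tz zI; rewrite ler_distl /inner; clear; lra.
  + suff /andP[] : c0 * h <= local_int K P X h y (cst 1) <= F0 * h by [].
      by apply: mass; move: yI hrS dlE dl0 h0; clear; lra.
  + by move: D1; rewrite /a ltnn.
  + by move: D2; rewrite /a kr.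
have kx0 : 0 < kernel_sum K h n (Xs ^~ w) x.
  have [] := cmp 0%N x isT; last by [].
  by move: x1 x2 Sh; clear; lra.
split=> //.
have eta0 : 0 <= 4 * (M + 2 * L) / c0 * (om * h) * rho.
  by rewrite !mulr_ge0 ?invr_ge0 ?(ltW c00) ?(ltW ML0) ?(ltW om0) ?(ltW h0) ?(ltW rho0).
have agree y : eps - Sm * h <= y <= 1 - (eps - Sm * h) -> m y = m0 y.
  by move=> yI; rewrite m0E//; move: yI hrS dlE dl0 h0; clear; lra.
have gap : `|emp_residual K h n (Xs ^~ w) m r.+1 x - u r.+1 x| <= Cs * (h * rho).
  have xI : eps - Sm * h + r.+1%:R * h <= x <= 1 - (eps - Sm * h + r.+1%:R * h).
    by rewrite -/Sm subrK x1 x2.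
  have := residual_gap kerK h0 eta0 agree cmp (leqnn r.+1) xI.
  move=> /le_trans; apply; rewrite /Cs.
  have -> : 2 ^+ r.+1 * (4 * (M + 2 * L) / c0 * om) * (h * rho) =
    2 ^+ r.+1 * (4 * (M + 2 * L) / c0 * (om * h) * rho) by ring.
  by rewrite ler_wpM2r// lerBlDr lerDl.
have bias : `|u r.+1 x| <= Cb * h `^ nu.
  by apply: (hbias (h, x)); split=> //=; rewrite x1 x2.
rewrite boosting_residual addrAC subrr add0r normrN.
rewrite -[emp_residual _ _ _ _ _ _ _](subrK (u r.+1 x)) (le_trans (ler_normD _ _))//.
have hnu0 : 0 <= h `^ nu by exact: powR_ge0.
have hr0 : 0 <= h * rho by rewrite mulr_ge0 ?(ltW h0) ?(ltW rho0).
rewrite mulrDr addrC lerD//.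
  by rewrite (le_trans bias)// ler_wpM2r// lerDl ltW.
by rewrite (le_trans gap)// ler_wpM2r// lerDr.
Qed.

(** * Conditional expectation given the design *)

Section weighted_image.
Context d d' (T : measurableType d) (S : measurableType d') (R : realType).
Variables (mu : {measure set T -> \bar R}) (xi : T -> S) (F : T -> \bar R).
Hypothesis mxi : measurable_fun setT xi.
Hypothesis mF : measurable_fun setT F.
Hypothesis F0 : forall w, (0 <= F w)%E.

(** The hypotheses are arguments so that the measure structure can be recovered from
    the term. *)
Definition weighted_image of measurable_fun setT xi & measurable_fun setT F &
    (forall w, (0 <= F w)%E) :=
  fun B : set S => (\int[mu]_(w in xi @^-1` B) F w)%E.
Local Notation nu := (weighted_image mxi mF F0).

Let nu0 : nu set0 = 0%E.
Proof. by rewrite /weighted_image preimage_set0 integral_set0. Qed.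

Let nu_ge0 B : (0 <= nu B)%E. Proof. by apply: integral_ge0. Qed.

Let nu_sigma_additive : semi_sigma_additive nu.
Proof.
have mpre B : measurable B -> measurable (xi @^-1` B).
  by move=> mB; rewrite -[Z in measurable Z]setTI; exact: mxi.
move=> B mB tB mUB; rewrite /weighted_image preimage_bigcup.
have := @semi_sigma_additive_nng_induced _ T R mu F mF F0 (fun n => xi @^-1` B n).
apply; [by move=> i; exact: mpre| |by rewrite -preimage_bigcup; exact: mpre].
move=> i j _ _ [w [Bi Bj]]; apply: tB => //; by exists (xi w).
Qed.

HB.instance Definition _ := isMeasure.Build _ _ _ nu nu0 nu_ge0 nu_sigma_additive.

End weighted_image.

Section generated.
Context d (T : measurableType d) (C : set (set T)).
Hypothesis C_meas : C `<=` measurable.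

Lemma generated_measurable : <<s C >> `<=` measurable.
Proof.
apply: smallest_sub => //; split.
- exact: measurable0.
- by move=> A mA; rewrite setTD; exact: measurableC.
- by move=> F mF; exact: bigcup_measurable.
Qed.

Lemma generated_measurable_fun (R : realType) (F : T -> R) :
  measurable_fun setT (F : g_sigma_algebraType C -> R) -> measurable_fun setT F.
Proof.
move=> mF _ B mB; rewrite setTI; apply: generated_measurable.
by rewrite -[X in <<s _ >> X]setTI; apply: mF.
Qed.

End generated.

Section orthogonality.
Context d (T : measurableType d) (R : realType) (P : probability T R).
Variable C : set (set T).
Hypothesis C_meas : C `<=` measurable.
Hypothesis C_I : setI_closed C.
Hypothesis C_T : C setT.
Variable U : T -> R.
Hypothesis intU : P.-integrable setT (EFin \o U).
Hypothesis U_C : forall A, C A -> (\int[P]_(w in A) (U w)%:E = 0)%E.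

Let mU : measurable_fun setT U.
Proof. exact/measurable_EFinP/(measurable_int P). Qed.

(** The sets over which [U] integrates to 0 form a lambda-system. *)
Lemma orthogonal_sets A : <<s C >> A -> (\int[P]_(w in A) (U w)%:E = 0)%E.
Proof.
pose H := [set A | measurable A /\ (\int[P]_(w in A) (U w)%:E = 0)%E].
have intS B : measurable B -> P.-integrable B (EFin \o U).
  by move=> mB; apply: (integrableS measurableT).
suff : <<s C >> `<=` H by move=> sub /sub [].
apply: lambda_system_subset => //; last first.
  by move=> B CB; split; [exact: C_meas|exact: U_C].
apply/dynkin_lambda_system; split.
- by split; [exact: measurableT|exact: U_C].
- move=> B [mB B0]; split; first exact: measurableC.
  have mBU : measurable_fun (B `|` ~` B) (EFin \o U).
    by rewrite setUv; exact/measurable_EFinP.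
  have BB : [disjoint B & ~` B] by rewrite disj_set2E setICr.
  have := integral_setU P mB (measurableC mB) mBU BB.
  by rewrite B0 add0e setUv (U_C C_T) => <-.
- move=> F tF HF; have mF k : measurable (F k) by have [] := HF k.
  split; first exact: bigcup_measurable.
  rewrite integral_bigcup//; last by apply: intS; exact: bigcup_measurable.
  by rewrite eseries0// => i _ _; have [] := HF i.
Qed.

Local Notation GT := (g_sigma_algebraType C).

(** The positive and the negative part of [U] are the densities of one and the
    same measure on the sigma-algebra generated by [C]; hence [U] integrates to 0
    against all bounded functions measurable for it. *)
Lemma orthogonal_functions (g : T -> R) (M : R) :
  measurable_fun setT (g : GT -> R) -> (forall w, `|g w| <= M) ->
  (\int[P]_w (U w * g w)%:E = 0)%E.
Proof.
have mT (F : T -> R) : measurable_fun setT (F : GT -> R) -> measurable_fun setT F.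
  exact: generated_measurable_fun.
wlog g0 : g M / forall w, 0 <= g w => [W mg gM|mg gM].
  have M0 : 0 <= M by rewrite (le_trans _ (gM point)).
  have W1 : (\int[P]_w (U w * (g w + M))%:E = 0)%E.
    apply: (W (fun w => g w + M) (M + M)).
    - by move=> w; have := gM w; rewrite ler_norml -lerBlDr sub0r => /andP[].
    - exact: measurable_funD.
    - by move=> w; rewrite (le_trans (ler_normD _ _))// lerD// ger0_norm.
  have -> : (\int[P]_w (U w * g w)%:E =
      \int[P]_w ((U w * (g w + M))%:E - M%:E * (U w)%:E))%E.
    by apply: eq_integral => w _; rewrite -EFinM -EFinB; congr EFin; ring.
  rewrite integralB//.
  - by rewrite W1 integralZl// (U_C C_T) mule0 sube0.
  - apply: (@le_integrable _ _ _ P setT measurableT _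
      (fun w => (M + M)%:E * `|(U w)%:E|)%E).
    + apply/measurable_EFinP/measurable_funM => //.
      by apply: measurable_funD => //; exact: mT.
    + move=> w _; rewrite /= lee_fin normrM mulrC normrM normr_id.
      rewrite (ger0_norm (addr_ge0 M0 M0)) ler_wpM2r//.
      by rewrite (le_trans (ler_normD _ _))// lerD// ger0_norm.
    + by apply: integrableZl => //; exact: integrable_abse.
  - exact: integrableZl.
have mUp : measurable_fun setT (fun w => Num.max (U w) 0) by exact: measurable_maxr.
have mUn : measurable_fun setT (fun w => Num.max (- U w) 0).
  by apply: measurable_maxr => //; exact: measurable_funN.
have Up0 w : 0 <= Num.max (U w) 0 by rewrite le_max lexx orbT.
have Un0 w : 0 <= Num.max (- U w) 0 by rewrite le_max lexx orbT.
have mUpE : measurable_fun setT (fun w => (Num.max (U w) 0)%:E) by exact/measurable_EFinP.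
have Up0E w : (0 <= (Num.max (U w) 0)%:E)%E by rewrite lee_fin.
pose iota : T -> GT := id.
have miota : measurable_fun setT iota.
  by move=> _ B mB; rewrite setTI; exact: (generated_measurable C_meas).
have UE w : U w = Num.max (U w) 0 - Num.max (- U w) 0.
  by case: (leP 0 (U w)) => ?; case: (leP 0 (- U w)) => ?; lra.
pose kap : {measure set GT -> \bar R} := weighted_image P miota mUpE Up0E.
have part_int (V : T -> R) : measurable_fun setT V -> (forall w, `|V w| <= `|U w|) ->
    P.-integrable setT (EFin \o V).
  move=> mV VU; apply: (@le_integrable _ _ _ P setT measurableT _ (EFin \o U)) => //.
    exact/measurable_EFinP.
  by move=> w _; rewrite /= lee_fin.
have iUp : P.-integrable setT (EFin \o (fun w => Num.max (U w) 0)).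
  by apply: part_int => // w; rewrite maxEle; case: ifP => _; rewrite ?normr0.
have iUn : P.-integrable setT (EFin \o (fun w => Num.max (- U w) 0)).
  by apply: part_int => // w; rewrite maxEle; case: ifP => _; rewrite ?normr0 ?normrN.
have same B : measurable B ->
    (\int[P]_(w in iota @^-1` B) (Num.max (- U w) 0)%:E = kap B)%E.
  move=> mB; rewrite /kap /= /weighted_image.
  have mTB : measurable (iota @^-1` B) by exact: (generated_measurable C_meas).
  have : (\int[P]_(w in iota @^-1` B) ((Num.max (U w) 0)%:E - (Num.max (- U w) 0)%:E) = 0)%E.
    rewrite -[RHS](orthogonal_sets mB); apply: eq_integral => w _.
    by rewrite -EFinB -UE.
  have ip : P.-integrable (iota @^-1` B) (fun w => (Num.max (U w) 0)%:E).
    exact: integrableS iUp.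
  have im : P.-integrable (iota @^-1` B) (fun w => (Num.max (- U w) 0)%:E).
    exact: integrableS iUn.
  rewrite integralB//; move/eqP; rewrite sube_eq; last 2 first.
  - exact: integrable_fin_num.
  - by rewrite fin_num_adde_defl// integrable_fin_num.
  by rewrite add0e => /eqP <-.
have e1 := @integral_transport _ _ T GT R P kap iota _ miota mUp Up0 (fun B _ => erefl) g mg.
have e2 := @integral_transport _ _ T GT R P kap iota _ miota mUn Un0 same g mg.
have bg (V : T -> R) : measurable_fun setT V -> P.-integrable setT (EFin \o V) ->
    P.-integrable setT (fun w => (V w * g w)%:E).
  move=> mV iV; apply: (@le_integrable _ _ _ P setT measurableT _
      (fun w => M%:E * `|(V w)%:E|)%E).
  - by apply/measurable_EFinP/measurable_funM => //; exact: mT.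
  - move=> w _; rewrite /= lee_fin normrM mulrC normrM normr_id ler_wpM2r//.
    by rewrite (le_trans (gM w))// ler_norm.
  - by apply: integrableZl => //; exact: integrable_abse.
have -> : (\int[P]_w (U w * g w)%:E =
    \int[P]_w ((Num.max (U w) 0 * g w)%:E - (Num.max (- U w) 0 * g w)%:E))%E.
  by apply: eq_integral => w _; rewrite -EFinB; congr EFin; rewrite -mulrBl -UE.
rewrite integralB//; [|exact: bg|exact: bg].
have f1 := integrable_fin_num measurableT (bg _ mUp iUp).
rewrite [X in (_ - X)%E]e2 -[X in (_ - X)%E]e1 subee//.
Qed.

End orthogonality.

Section sample.
Context {R : realType} d (T : measurableType d) (P : probability T R).
Variables (X Y : {RV P >-> R}) (Xs Ys : nat -> {RV P >-> R}) (m : R -> R).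
Hypothesis iidXY : iid_copies Xs Ys X Y.

Lemma pair_measurable (V W : {RV P >-> R}) : measurable_fun setT (fun w => (V w, W w)).
Proof. exact: measurable_fun_pair. Qed.

Lemma pair_preimage_measurable (V W : {RV P >-> R}) (D : set (R * R)) :
  measurable D -> measurable [set w | D (V w, W w)].
Proof.
move=> mD; rewrite -[X in measurable X]setTI.
exact: (pair_measurable V W measurableT mD).
Qed.

Lemma independent_pairs n (D : nat -> set (R * R)) : (forall i, measurable (D i)) ->
  P (\bigcap_(i in `I_n) [set w | D i (Xs i w, Ys i w)]) =
  (\prod_(i < n) P [set w | D i (X w, Y w)])%E.
Proof.
have [same indep] := iidXY; move=> mD.
pose J : {fset nat} := [fset i in iota 0 n]%fset.
have JE : [set` J] = `I_n.
  apply/seteqP; split => i /=; rewrite !inE mem_iota add0n //.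
have Jp : perm_eq J (iota 0 n).
  by apply: uniq_perm; rewrite ?iota_uniq ?fset_uniq// => i; rewrite !inE.
rewrite -JE indep// (perm_big _ Jp)/= -[in iota 0 n](subn0 n) -/(index_iota 0 n) big_mkord.
by apply: eq_bigr => i _; rewrite same.
Qed.

Lemma iid_independent_copies : independent_copies X Xs.
Proof.
have [same _] := iidXY.
have mfst (B : set R) : measurable B -> measurable (B `*` setT : set (R * R)).
  by move=> mB; exact: measurableX.
split=> [i B mB|n B mB].
  have := same i _ (mfst B mB).
  by congr (P _ = P _); apply/seteqP; split => w //= [].
have := independent_pairs n (fun i => mfst _ (mB i)).
rewrite (_ : \bigcap_(i in `I_n) [set w | _] = \bigcap_(i in `I_n) Xs i @^-1` B i).
  move=> ->; apply: eq_bigr => i _; congr (P _).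
  by apply/seteqP; split => w //= [].
by apply: eq_bigcapr => i _; apply/seteqP; split => w //= [].
Qed.

(** Meant for an event [C] of probability [c] that is independent of [(X_i, Y_i)]:
    its indicator is the weight in the change of variables. *)
Lemma transport_pair i (C : set T) (c : R) (psi : R * R -> R) :
  measurable C -> 0 <= c -> measurable_fun setT psi ->
  (forall D, measurable D ->
    P (C `&` [set w | D (Xs i w, Ys i w)]) = (c%:E * P [set w | D (X w, Y w)])%E) ->
  (\int[P]_w (\1_C w * psi (Xs i w, Ys i w))%:E =
   \int[P]_w (c * psi (X w, Y w))%:E)%E.
Proof.
move=> mC c0 mpsi hC.
have mc : measurable_fun setT (cst c%:E : T -> \bar R) by [].
have c0E (w : T) : (0 <= cst c%:E w)%E by rewrite lee_fin.
pose kap : {measure set (R * R) -> \bar R} :=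
  weighted_image P (pair_measurable X Y) mc c0E.
rewrite (@integral_transport _ _ T _ R P kap (fun w => (Xs i w, Ys i w)) (\1_C))//.
- have mcst : measurable_fun setT (cst c : T -> R) by [].
  exact: (esym (@integral_transport _ _ T _ R P kap (fun w => (X w, Y w)) (cst c)
    (pair_measurable X Y) mcst (fun _ => c0) (fun B _ => erefl) psi mpsi)).
- exact: pair_measurable.
move=> D mD; rewrite /kap /= /weighted_image integral_cst//; last first.
  exact: pair_preimage_measurable.
by rewrite -hC// integral_indic//; exact: pair_preimage_measurable.
Qed.

Hypothesis regm : regression_function X Y m.

Let resid i w := Ys i w - m (Xs i w).

Let mm : measurable_fun setT m. Proof. by have [] := regm. Qed.

Let psi0 (z : R * R) := z.2 - m z.1.

Let mpsi0 : measurable_fun setT psi0.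
Proof.
apply: measurable_funB; first exact: measurable_snd.
by apply: measurableT_comp => //; exact: measurable_fst.
Qed.

Let int_psi0 : P.-integrable setT (fun w => (psi0 (X w, Y w))%:E).
Proof.
by have [_ [iY im _ _]] := regm; exact: (integrableB measurableT iY im).
Qed.

Lemma residual_integrable i : P.-integrable setT (EFin \o resid i).
Proof.
have [same _] := iidXY.
apply/integrableP; split.
  apply/measurable_EFinP/measurable_funB => //.
  by apply: (measurableT_comp mm).
have := @transport_pair i setT 1 (fun z => `|psi0 z|) measurableT ler01.
have mpsi : measurable_fun setT (fun z => `|psi0 z|) by exact: measurableT_comp.
move=> /(_ mpsi) H; have := integrable_abse int_psi0 => /integrableP[_].
under eq_integral do rewrite abse_id.
apply: le_lt_trans.
under [leRHS]eq_integral do rewrite /= -[X in X%:E]mul1r.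
rewrite -H => [|D mD]; last by rewrite setTI mul1e same.
rewrite le_eqVlt; apply/orP; left; apply/eqP; apply: eq_integral => w _.
by rewrite indicE in_setT mul1r.
Qed.

Definition cylinder n (A : set T) := exists2 B : nat -> set R,
  forall i, measurable (B i) & A = \bigcap_(i in `I_n) Xs i @^-1` B i.

Lemma cylinder_measurable n : cylinder n `<=` measurable.
Proof.
move=> A [B mB ->]; apply: bigcap_measurableType => i _.
exact: preimage_rv_measurable.
Qed.

Lemma cylinder_setI n : setI_closed (cylinder n).
Proof.
move=> A1 A2 [B1 mB1 ->] [B2 mB2 ->]; exists (fun i => B1 i `&` B2 i).
  by move=> i; exact: measurableI.
by rewrite -bigcapI; apply: eq_bigcapr => i _; rewrite preimage_setI.
Qed.

Lemma cylinder_setT n : cylinder n setT.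
Proof.
exists (fun=> setT) => //.
by apply/seteqP; split => w // _ i _.
Qed.

Lemma cylinder_preimage n i (B : set R) : (i < n)%N -> measurable B ->
  cylinder n (Xs i @^-1` B).
Proof.
move=> ni mB; exists (fun j => if j == i then B else setT).
  by move=> j; case: ifP.
apply/seteqP; split => w /=.
  by move=> wB j _ /=; case: eqP => // ->.
by move=> /(_ i ni); rewrite /= eqxx.
Qed.

(** Cylinders, unlike the generators of the definition, are stable under
    intersection. *)
Lemma sigma_sample_cylinder n : sigma_sample Xs n = <<s cylinder n >>.
Proof.
apply/seteqP; split.
  apply: smallest_sub; first exact: smallest_sigma_algebra.
  move=> A [i ni [B mB <-]]; rewrite setTI; apply: sub_sigma_algebra.
  exact: cylinder_preimage.
apply: smallest_sub; first exact: smallest_sigma_algebra.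
move=> A [B mB ->].
pose G := \bigcup_(i in `I_n) sigma_rv (Xs i).
have : measurable (\bigcap_(i in `I_n) Xs i @^-1` B i : set (g_sigma_algebraType G)).
  apply: bigcap_measurableType => i ni; apply: sub_sigma_algebra.
  by exists i => //; exists (B i) => //; rewrite setTI.
by [].
Qed.

(** On a cylinder, the factors other than the [i]-th are independent of the pair
    [(X_i, Y_i)], and the remaining one is a set of values of [X_i]. *)
Lemma residual_cylinder n i A : (i < n)%N -> cylinder n A ->
  (\int[P]_(w in A) (resid i w)%:E = 0)%E.
Proof.
move=> ni [B mB AE]; have [same _] := iidXY; have [_ [iY im _ reg]] := regm.
pose oi := Ordinal ni.
pose C := \bigcap_(j in [set j | (j < n)%N && (j != i)]) Xs j @^-1` B j.
have mC : measurable C.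
  by apply: bigcap_measurableType => j _; exact: preimage_rv_measurable.
pose c := \prod_(j < n | j != oi) fine (P (X @^-1` B j)).
have c0 : 0 <= c by apply: prodr_ge0 => j _; exact: fine_ge0.
have hC D : measurable D ->
    P (C `&` [set w | D (Xs i w, Ys i w)]) = (c%:E * P [set w | D (X w, Y w)])%E.
  move=> mD; pose D' j := if j == i then D else B j `*` setT.
  have mD' j : measurable (D' j) by rewrite /D'; case: ifP => // _; exact: measurableX.
  have -> : C `&` [set w | D (Xs i w, Ys i w)] =
      \bigcap_(j in `I_n) [set w | D' j (Xs j w, Ys j w)].
    apply/seteqP; split => w.
      move=> [wC wD] j /= jn; rewrite /D'; case: eqVneq => [->//|ji].
      by split=> //; apply: (wC j); rewrite /= jn.
    move=> wD'; split; last by have := wD' i ni; rewrite /= /D' eqxx.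
    move=> j /= /andP[jn ji]; have := wD' j jn.
    by rewrite /= /D' (negbTE ji) => -[].
  rewrite independent_pairs// (bigD1 oi)//= /D' eqxx muleC; congr (_ * _)%E.
  rewrite /c (big_morph EFin EFinM (erefl _)); apply: eq_bigr => j ji.
  rewrite ifN// law_fineK//; congr (P _).
  by apply/seteqP; split => w //= [].
pose psi (z : R * R) := \1_(B i) z.1 * psi0 z.
have mpsi : measurable_fun setT psi.
  have mI : measurable_fun setT (\1_(B i) : R -> R) by exact: measurable_indic.
  by apply: measurable_funM => //; apply: (measurableT_comp mI); exact: measurable_fst.
have mA : measurable A by apply: (@cylinder_measurable n); exists B.
rewrite integral_mkcond.
transitivity (\int[P]_w (\1_C w * psi (Xs i w, Ys i w))%:E)%E.
  apply: eq_integral => w _; rewrite patchE /psi /= !indicE.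
  have [wi|wi] := pselect (B i (Xs i w)); last first.
    have wA : ~ A w by rewrite AE => /(_ i ni).
    by rewrite (memNset wi) (memNset wA) mul0r mulr0.
  rewrite (mem_set wi) mul1r; have [wC|wC] := pselect (C w).
    have wA : A w.
      rewrite AE => j jn /=.
      by have [->//|ji] := eqVneq j i; apply: (wC j); rewrite /= jn.
    by rewrite (mem_set wC) (mem_set wA) mul1r.
  have wA : ~ A w.
    by rewrite AE => wA; apply: wC => j /= /andP[jn _]; exact: wA.
  by rewrite (memNset wC) (memNset wA) mul0r.
rewrite (transport_pair mC c0 mpsi hC).
have mXB : measurable (X @^-1` B i) by exact: preimage_rv_measurable.
have E0 : (\int[P]_w (psi (X w, Y w))%:E = 0)%E.
  transitivity (\int[P]_(w in X @^-1` B i) ((Y w)%:E - (m (X w))%:E))%E.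
    rewrite [RHS]integral_mkcond; apply: eq_integral => w _.
    rewrite patchE /psi /psi0 /= indicE; have [wi|wi] := pselect (B i (X w)).
      by rewrite !mem_set// mul1r.
    by rewrite !memNset// mul0r.
  rewrite integralB//; [|exact: integrableS iY|exact: integrableS im].
  have -> : (\int[P]_(w in X @^-1` B i) (Y w)%:E = \int[P]_(w in X @^-1` B i) (m (X w))%:E)%E.
    apply/esym/reg; exists (B i) => //; by rewrite setTI.
  by rewrite subee// integrable_fin_num//; exact: integrableS im.
transitivity (\int[P]_w (c%:E * (psi (X w, Y w))%:E))%E; first by apply: eq_integral.
rewrite integralZl//; first by rewrite E0 mule0.
apply: (@le_integrable _ _ _ P setT measurableT _ (fun w => (psi0 (X w, Y w))%:E)) => //.
  by apply/measurable_EFinP; apply: (measurableT_comp mpsi); exact: pair_measurable.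
move=> w _; rewrite /= lee_fin /psi normrM /= ler_piMl//.
by rewrite indicE; case: (_ \in _); rewrite ?normr0 ?normr1.
Qed.

Local Notation GT n := (g_sigma_algebraType (cylinder n)).

Lemma residual_orthogonal n i (g : T -> R) (M : R) : (i < n)%N ->
  measurable_fun setT (g : GT n -> R) -> (forall w, `|g w| <= M) ->
  (\int[P]_w (resid i w * g w)%:E = 0)%E.
Proof.
move=> ni mg gM; apply: (orthogonal_functions (@cylinder_measurable n)
  (@cylinder_setI n) (cylinder_setT n) (residual_integrable i) _ mg gM).
by move=> A; exact: residual_cylinder.
Qed.

End sample.

(** * The regular version of the conditional expectation *)

Section boosting_algebra.
Context {R : realType}.
Variable K : R -> R.
Hypothesis kerK : smoothing_kernel K.
Variable h : R.
Hypothesis h0 : 0 < h.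
Implicit Types (x : R) (xs ys : nat -> R).

Lemma nw_emp_norm n xs (v : nat -> R) x (c : R) : 0 <= c -> (forall i, `|v i| <= c) ->
  `|\sum_(i < n) nw_weight K h n xs i x * v i| <= c.
Proof.
move=> c0 vc; rewrite (le_trans (ler_norm_sum _ _ _))//.
apply: (@le_trans _ _ (\sum_(i < n) nw_weight K h n xs i x * c)).
  by apply: ler_sum => i _; rewrite normrM (ger0_norm (nw_weight_ge0 kerK _ _ _ _ h0)) ler_wpM2l// nw_weight_ge0.
rewrite -mulr_suml ler_piMl// -mulr_suml -/(kernel_sum K h n xs x).
by have [->|S0] := eqVneq (kernel_sum K h n xs x) 0; rewrite ?mul0r// mulfV.
Qed.

Definition unit_response i : nat -> R := fun j => (j == i)%:R.

Lemma boosting_linear n xs ys r x : boosting K h n xs ys r x =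
  \sum_(i < n) ys i * boosting K h n xs (unit_response i) r x.
Proof.
have dirac (j : 'I_n) : ys j = \sum_(i < n) ys i * unit_response i j.
  rewrite (bigD1 j)//= /unit_response eqxx mulr1 big1 ?addr0// => i ij.
  by rewrite (_ : (j == i :> nat) = false) ?mulr0// eq_sym; exact/negbTE.
elim: r x => [|r IH] x /=.
  under eq_bigr => j _ do rewrite dirac mulr_sumr.
  rewrite exchange_big/=; apply: eq_bigr => i _; rewrite mulr_sumr.
  by apply: eq_bigr => j _; rewrite mulrCA.
under [X in _ + X]eq_bigr => j _ do rewrite IH dirac -sumrB mulr_sumr.
rewrite IH exchange_big/= -big_split/=; apply: eq_bigr => i _.
rewrite mulrDr mulr_sumr; congr (_ + _); apply: eq_bigr => j _.
by rewrite -mulrBr mulrCA.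
Qed.

Lemma boosting_bounded n xs i r x : `|boosting K h n xs (unit_response i) r x| <= 2 ^+ r.+1.
Proof.
have u1 j : `|unit_response i j| <= 1.
  by rewrite /unit_response; case: eqP; rewrite ?normr1 ?normr0.
suff : forall x, `|boosting K h n xs (unit_response i) r x| <= 2 ^+ r.+1 - 1.
  by move=> /(_ x) /le_trans; apply; rewrite lerBlDr lerDl.
elim: r => [|r IH] {}x /=.
  by rewrite expr1 addrK; exact: nw_emp_norm.
rewrite (le_trans (ler_normD _ _))//.
have p1 : 1 <= 2 ^+ r.+1 :> R by rewrite exprn_ege1// ler1n.
apply: (@le_trans _ _ ((2 ^+ r.+1 - 1) + 2 ^+ r.+1)).
  apply: lerD; first exact: IH.
  apply: (@nw_emp_norm n xs (fun j =>
    unit_response i j - boosting K h n xs (unit_response i) r (xs j))) => [|j].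
    exact: le_trans p1.
  rewrite (le_trans (ler_normB _ _))// -[leRHS](subrK 1) addrC lerD//.
by rewrite [in leRHS]exprS; lra.
Qed.

Lemma scaled_kernel_continuous a : continuous (fun x => scaled_kernel K h (a - x)).
Proof.
move=> x; apply: cvgM; last exact: cvg_cst.
apply: (@continuous_comp _ _ _ (fun x : R => (a - x) / h) K); last exact: kernel_continuous.
by apply: cvgM; [apply: cvgB; [exact: cvg_cst|exact: cvg_id]|exact: cvg_cst].
Qed.

Lemma sum_cvg n (F : 'I_n -> R -> R) (l : 'I_n -> R) x :
  (forall i, F i y @[y --> x] --> l i) ->
  \sum_(i < n) F i y @[y --> x] --> \sum_(i < n) l i.
Proof. by move=> Fl; apply: cvg_big => //; exact: add_continuous. Qed.

Lemma kernel_sum_continuous n xs : continuous (kernel_sum K h n xs).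
Proof. by move=> x; apply: sum_cvg => i; exact: scaled_kernel_continuous. Qed.

Lemma nw_weight_continuous n xs i x : 0 < kernel_sum K h n xs x ->
  {for x, continuous (nw_weight K h n xs i)}.
Proof.
move=> S0; apply: cvgM; first exact: scaled_kernel_continuous.
by apply: cvgV; [rewrite gt_eqF|exact: kernel_sum_continuous].
Qed.

Lemma boosting_continuous n xs ys r x : 0 < kernel_sum K h n xs x ->
  {for x, continuous (boosting K h n xs ys r)}.
Proof.
move=> S0; elim: r => [|r IH] /=.
  by apply: sum_cvg => i; apply: cvgM; [exact: nw_weight_continuous|exact: cvg_cst].
apply: cvgD; first exact: IH.
by apply: sum_cvg => i; apply: cvgM; [exact: nw_weight_continuous|exact: cvg_cst].
Qed.

Section boosting_measurable.
Context d (S : measurableType d).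
Variables (n : nat) (xs ys : nat -> S -> R).
Hypothesis mxs : forall i, (i < n)%N -> measurable_fun setT (xs i).
Hypothesis mys : forall i, (i < n)%N -> measurable_fun setT (ys i).

Lemma nw_weight_measurable i (xi : S -> R) : (i < n)%N -> measurable_fun setT xi ->
  measurable_fun setT (fun w => nw_weight K h n (xs ^~ w) i (xi w)).
Proof.
move=> ni mxi.
have msk j : (j < n)%N -> measurable_fun setT (fun w => scaled_kernel K h (xs j w - xi w)).
  move=> jn; apply: measurable_funM => //.
  apply: (measurableT_comp (kernel_measurable kerK)).
  by apply: measurable_funM => //; apply: measurable_funB => //; exact: mxs.
apply: measurable_funM; first exact: msk.
apply: measurable_inv_ge0; last by move=> w; exact: kernel_sum_ge0.
by apply: measurable_sum => j; exact: msk.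
Qed.

Lemma boosting_measurable r (xi : S -> R) : measurable_fun setT xi ->
  measurable_fun setT (fun w => boosting K h n (xs ^~ w) (ys ^~ w) r (xi w)).
Proof.
elim: r xi => [|r IH] xi mxi /=.
  by apply: measurable_sum => i; apply: measurable_funM; [exact: nw_weight_measurable|exact: mys].
apply: measurable_funD; first exact: IH.
apply: measurable_sum => i; apply: measurable_funM; first exact: nw_weight_measurable.
by apply: measurable_funB; [exact: mys|apply: IH; exact: mxs].
Qed.

End boosting_measurable.

End boosting_algebra.

Lemma eq_from_rat {R : realType} (f g : R -> R) x :
  {for x, continuous f} -> {for x, continuous g} ->
  (forall q, f (ratr q) = g (ratr q)) -> f x = g x.
Proof.
move=> cf cg fgq; apply/eqP; rewrite -subr_eq0; apply/negPn/negP => D0.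
have cD : f y - g y @[y --> x] --> f x - g x  by exact: cvgB cf cg.
have : \forall y \near x, f y - g y != 0 by exact: cvgr_neq0 cD D0.
move=> /nbhs_ballP[e /= e0 near0].
have [q] : exists q : rat, ratr q \in `]x, (x + e)[ by apply: rat_in_itvoo; rewrite ltrDl.
rewrite in_itv/= => /andP[xq qe].
have : ball x e (ratr q) by rewrite /ball/= ltr_distlC; apply/andP; split=> //; lra.
by move=> /near0; rewrite /= fgq subrr eqxx.
Qed.

Section regular_version.
Context {R : realType} d (T : measurableType d) (P : probability T R).
Variables (X Y : {RV P >-> R}) (Xs Ys : nat -> {RV P >-> R}) (m K : R -> R).
Hypothesis iidXY : iid_copies Xs Ys X Y.
Hypothesis regm : regression_function X Y m.
Hypothesis kerK : smoothing_kernel K.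

Local Notation GT n := (g_sigma_algebraType (cylinder Xs n)).

Let mm : measurable_fun setT m. Proof. by have [] := regm. Qed.

Let mXG n i : (i < n)%N -> measurable_fun setT (Xs i : GT n -> R).
Proof.
move=> ni _ B mB; rewrite setTI; apply: sub_sigma_algebra.
exact: cylinder_preimage.
Qed.

Let mG n (A : set T) : <<s cylinder Xs n >> A -> measurable A.
Proof. exact: (generated_measurable (@cylinder_measurable _ _ _ _ Xs n)). Qed.

Let mGfun n (F : T -> R) : measurable_fun setT (F : GT n -> R) -> measurable_fun setT F.
Proof. exact: (generated_measurable_fun (@cylinder_measurable _ _ _ _ Xs n)). Qed.

(** The estimate is linear in the responses, with bounded coefficients that depend
    on the design only, and the residuals [Y_i - m (X_i)] are orthogonal to those:
    the responses may be replaced by the values of the regression function. *)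
Lemma boosting_cond_expE h n r x (Z : T -> R) : 0 < h ->
  is_cond_exp P (sigma_sample Xs n)
    (fun w => boosting K h n (Xs ^~ w) (Ys ^~ w) r x) Z ->
  {ae P, forall w, Z w = boosting K h n (Xs ^~ w) (fun i => m (Xs i w)) r x}.
Proof.
move=> h0 [iW iZ mZ eqZ].
pose W w := boosting K h n (Xs ^~ w) (Ys ^~ w) r x.
pose b w := boosting K h n (Xs ^~ w) (fun i => m (Xs i w)) r x.
pose c (i : nat) w := boosting K h n (Xs ^~ w) (unit_response i) r x.
pose resid (i : nat) w := Ys i w - m (Xs i w).
have mcG i : measurable_fun setT (c i : GT n -> R).
  apply: (boosting_measurable kerK h0 (xs := fun i => Xs i : GT n -> R)
    (ys := fun j _ => unit_response i j)) => //.
  exact: mXG.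
have mbG : measurable_fun setT (b : GT n -> R).
  apply: (boosting_measurable kerK h0 (xs := fun i => Xs i : GT n -> R)
    (ys := fun j w => m (Xs j w))) => //; first exact: mXG.
  by move=> i ni; exact: (measurableT_comp mm (mXG ni)).
have cB i w : `|c i w| <= 2 ^+ r.+1 by exact: boosting_bounded.
have WbE w : W w = b w + \sum_(i < n) resid i w * c i w.
  rewrite /W /b boosting_linear [in RHS]boosting_linear -big_split/=.
  by apply: eq_bigr => i _; rewrite /resid -mulrDl addrC subrK.
have mZG : measurable_fun setT (Z : GT n -> R).
  by move=> _ B mB; rewrite setTI; have := mZ B mB; rewrite sigma_sample_cylinder.
have irc i (g : T -> R) : measurable_fun setT g -> (forall w, `|g w| <= 2 ^+ r.+1) ->
    P.-integrable setT (fun w => (resid i w * g w)%:E).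
  move=> mg gB; have ir := residual_integrable iidXY regm i.
  apply: (@le_integrable _ _ _ P setT measurableT _
      (fun w => (2 ^+ r.+1)%:E * `|(resid i w)%:E|)%E).
  - apply/measurable_EFinP/measurable_funM => //.
    by apply: measurable_funB => //; exact: (measurableT_comp mm).
  - move=> w _; rewrite /= lee_fin normrM mulrC normrM normr_id ler_wpM2r//.
    by rewrite (le_trans (gB w))// ler_norm.
  - by apply: integrableZl => //; exact: integrable_abse.
have isum : P.-integrable setT (fun w => (\sum_(i < n) resid i w * c i w)%:E).
  under eq_fun do rewrite -sumEFin.
  by apply: integrable_sum => // i _; apply: irc => //; exact: (mGfun (mcG i)).
have bE w : b w = W w - \sum_(i < n) resid i w * c i w by rewrite WbE addrK.
have ib : P.-integrable setT (EFin \o b).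
  have := integrableB measurableT iW isum; apply: eq_integrable => // w _.
  by rewrite /= bE.
pose D w := Z w - b w.
have iD : P.-integrable setT (EFin \o D) := integrableB measurableT iZ ib.
have mDG : measurable_fun setT (D : GT n -> R) by exact: measurable_funB.
have D0 A : <<s cylinder Xs n >> A -> (\int[P]_(w in A) (D w)%:E = 0)%E.
  move=> GA; have mA := mG GA.
  have iS (F : T -> R) : P.-integrable setT (EFin \o F) -> P.-integrable A (EFin \o F).
    by move=> iF; exact: integrableS iF.
  have eqA : (\int[P]_(w in A) (b w)%:E = \int[P]_(w in A) (W w)%:E)%E.
    pose c' (i : nat) w := c i w * \1_A w.
    have mc' i : measurable_fun setT (c' i : GT n -> R).
      by apply: measurable_funM => //; exact: (@measurable_indic _ (GT n)).
    have c'B i w : `|c' i w| <= 2 ^+ r.+1.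
      rewrite /c' normrM (le_trans _ (cB i w))// ler_piMr//.
      by rewrite indicE; case: (_ \in _); rewrite ?normr0 ?normr1.
    have S0 : (\int[P]_(w in A) (\sum_(i < n) resid i w * c i w)%:E = 0)%E.
      rewrite integral_mkcond.
      transitivity (\int[P]_w \sum_(i < n) (resid i w * c' i w)%:E)%E.
        apply: eq_integral => w _; rewrite patchE /c' indicE.
        case: (w \in A); rewrite sumEFin; congr (_%:E).
          by apply: eq_bigr => i _; rewrite mulr1.
        by rewrite big1// => i _; rewrite !mulr0.
      rewrite integral_sum//; last by move=> i; apply: irc => //; exact: (mGfun (mc' i)).
      by rewrite big1// => i _; exact: (residual_orthogonal iidXY regm (n := n) (M := 2 ^+ r.+1)).
    transitivity (\int[P]_(w in A) ((b w)%:E + (\sum_(i < n) resid i w * c i w)%:E))%E.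
      by rewrite integralD//; [rewrite S0 adde0|exact: iS|exact: iS].
    by apply: eq_integral => w _; rewrite -EFinD -WbE.
  transitivity (\int[P]_(w in A) ((Z w)%:E - (b w)%:E))%E => //.
  rewrite integralB//; [|exact: iS|exact: iS].
  rewrite eqA -eqZ ?sigma_sample_cylinder// subee//.
  by apply: integrable_fin_num => //; exact: iS.
pose Ap := [set w | 0 <= D w].
have GAp : <<s cylinder Xs n >> Ap.
  have := mDG measurableT `[0, +oo[%classic (measurable_itv _).
  rewrite setTI; congr (<<s _ >> _).
  by apply/seteqP; split => w /=; rewrite in_itv/= andbT.
have mAp := mG GAp.
have mD : measurable_fun setT D by exact: mGfun mDG.
have : (\int[P]_w `|(D w)%:E| = 0)%E.
  have mDE : measurable_fun setT (fun w => `|(D w)%:E|%E).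
    by apply: measurableT_comp => //; exact/measurable_EFinP.
  rewrite -(setUv Ap) (ge0_integral_setU P mAp (measurableC mAp))//; last 2 first.
  - by rewrite setUv.
  - by rewrite disj_set2E setICr.
  rewrite (eq_integral (fun w => (D w)%:E)); last first.
    by move=> w; rewrite inE => Dw; rewrite gee0_abs.
  rewrite (D0 _ GAp) add0e (eq_integral (fun w => - (D w)%:E)%E); last first.
    move=> w; rewrite inE /Ap /= => /negP; rewrite -ltNge => Dw.
    by rewrite ltr0_norm.
  rewrite integralN.
    by rewrite D0 ?oppe0//; exact: sigma_algebraC.
  have mnAp := measurableC mAp.
  by apply: (integrable_add_def mnAp); exact: (integrableS measurableT mnAp).
move=> /(ae_eq_integral_abs P measurableT (measurable_int _ iD)).
apply: filterS => w /(_ I) /= -[] /eqP; rewrite subr_eq0 => /eqP.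
exact.
Qed.

(** The exceptional null sets of the rational points suffice: at a point where the
    kernel sum is positive, the version and the estimate are both continuous. *)
Lemma boosting_version h r (Z : nat -> R -> T -> R) : (forall n, 0 < h n) ->
  boosting_cond_exp K h Xs Ys r Z ->
  {ae P, forall w, forall n x, 0 < kernel_sum K (h n) n (Xs ^~ w) x ->
    Z n x w = boosting K (h n) n (Xs ^~ w) (fun i => m (Xs i w)) r x}.
Proof.
move=> h0 [condZ contZ].
have ratZ : {ae P, forall w, forall n k, forall q : rat, choice.unpickle k = Some q ->
    Z n (ratr q) w = boosting K (h n) n (Xs ^~ w) (fun i => m (Xs i w)) r (ratr q)}.
  apply: ae_foralln => n; apply: ae_foralln => k.
  case: (choice.unpickle k) => [q|]; last exact: aeW.
  by apply: filterS (boosting_cond_expE (h0 n) (condZ n (ratr q))) => w Zw q' [<-].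
apply: filterS2 ratZ contZ => w ratZ contZ n x S0.
have cb : {for x, continuous (boosting K (h n) n (Xs ^~ w) (fun i => m (Xs i w)) r)}.
  exact: boosting_continuous.
have cZ := contZ n x S0.
apply: eq_from_rat cZ cb _ => q.
by apply: (ratZ n (choice.pickle q)); rewrite choice.pickleK.
Qed.

End regular_version.

(** * Uniform order in probability *)

(** Here [rho] is [sqrt (ln n / (n * h))]. It tends to 0, while [h] and [rho] are
    eventually at least [1 / n], so that a grid of mesh [n ^- 3] is fine enough. *)
Lemma bandwidth_eventually (R : realType) (h : nat -> R) (h1 rho1 : R) :
  (forall n, 0 < h n) -> h n @[n --> \oo] --> (0 : R) ->
  n%:R * h n / ln n%:R @[n --> \oo] --> +oo -> 0 < h1 -> 0 < rho1 ->
  \forall n \near \oo, (0 < n)%N /\ exists rho : R, [/\ h n <= h1, 0 < rho <= rho1,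
    n%:R * h n * rho ^+ 2 = ln n%:R, h n * rho = Num.sqrt (h n * ln n%:R / n%:R) &
    (n%:R ^+ 3)^-1 <= h n /\ (n%:R ^+ 3)^-1 <= h n ^+ 2 * rho].
Proof.
move=> h0 hcvg nhcvg h10 rho10.
have small (e : R) : 0 < e -> \forall n \near \oo, h n <= e.
  move=> e0; near=> n; apply: le_trans (ler_norm _) _.
  by near: n; exact: cvgr0_norm_le.
near=> n.
have n1 : (0 < n)%N by near: n; exists 1%N.
have N1 : 1 <= n%:R :> R by rewrite ler1n.
have N0 : 0 < n%:R :> R by rewrite ltr0n.
have hn0 := h0 n.
have ln1 : 1 <= ln n%:R :> R.
  rewrite -[leLHS]expRK ler_ln ?posrE ?expR_gt0//.
  by near: n; exact: (cvgry_ge cvgr_idn).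
have ln0 : 0 < ln n%:R :> R by rewrite (lt_le_trans _ ln1).
have hle : h n <= 1 by near: n; exact: small.
have nh_ge (A : R) : A <= n%:R * h n / ln n%:R -> A * ln n%:R <= n%:R * h n.
  by rewrite ler_pdivlMr.
have nh1 : ln n%:R <= n%:R * h n.
  by rewrite -[leLHS]mul1r; apply: nh_ge; near: n; exact: (cvgry_ge nhcvg).
have nhrho : (rho1 ^+ 2)^-1 * ln n%:R <= n%:R * h n.
  by apply: nh_ge; near: n; exact: (cvgry_ge nhcvg).
have nh0 : 0 < n%:R * h n by rewrite mulr_gt0.
pose rho := Num.sqrt (ln n%:R / (n%:R * h n)).
have rho2 : rho ^+ 2 = ln n%:R / (n%:R * h n) by rewrite sqr_sqrtr// divr_ge0// ltW.
have rho0 : 0 < rho by rewrite sqrtr_gt0 divr_gt0.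
have rhole (a : R) : 0 < a -> (a ^+ 2)^-1 * ln n%:R <= n%:R * h n -> rho <= a.
  move=> a0 H; rewrite -(ger0_norm (ltW a0)) -sqrtr_sqr ler_wsqrtr//.
  by rewrite ler_pdivrMr// -ler_pdivrMl// exprn_gt0.
have rho_le1 : rho <= 1 by apply: rhole => //; rewrite expr1n invr1 mul1r.
have ninv : n%:R^-1 <= rho.
  apply: (@le_trans _ _ (rho ^+ 2)); last by rewrite expr2 ger_pMr.
  rewrite rho2 -[leLHS]mul1r ler_pM ?invr_ge0 ?ler0n//.
  by rewrite lef_pV2 ?posrE// ger_pMr.
have hinv : n%:R^-1 <= h n.
  by rewrite -[leLHS]mul1r ler_pdivrMr// mulrC (le_trans ln1).
have ninv1 : n%:R^-1 <= 1 :> R by rewrite invf_le1.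
have ninv0 : 0 <= n%:R^-1 :> R by rewrite invr_ge0 ltW.
split=> //; exists rho; split=> //.
- by near: n; exact: small.
- by rewrite rho0 rhole.
- by rewrite rho2 mulrC divfK// gt_eqF.
- rewrite -[X in X * _](ger0_norm (ltW hn0)) -sqrtr_sqr -sqrtrM ?sqr_ge0//.
  congr Num.sqrt; field; by rewrite !gt_eqF.
rewrite -exprVn; split.
  by rewrite (le_trans _ hinv)// -[leRHS]expr1 ler_wiXn2l.
by rewrite exprSr; apply: ler_pM => //; rewrite ?exprn_ge0// lerXn2r ?nnegrE// ltW.
Unshelve. all: by end_near. Qed.

Theorem theorem3 (R : realType) (d : measure_display) (T : measurableType d)
    (P : probability T R) (X Y : {RV P >-> R}) (Xs Ys : nat -> {RV P >-> R})
    (f m K : R -> R) (h : nat -> R) (nu C1 C2 : R) (r : nat)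
    (Z : nat -> R -> T -> R)
    (iidXY : iid_copies Xs Ys X Y)
    (densX : has_density X f)
    (suppf : forall x, ~ unit_interval x -> f x = 0)
    (regm : regression_function X Y m)
    (kerK : smoothing_kernel K)
    (h_gt0 : forall n, 0 < h n)
    (h_cvg0 : h n @[n --> \oo] --> (0 : R))
    (nh_cvg : n%:R * h n / ln n%:R @[n --> \oo] --> +oo)
    (nu_ge2 : 2 <= nu) (C1_gt0 : 0 < C1) (C2_gt0 : 0 < C2)
    (m_class : holder_class nu C1 m)
    (f_class : holder_class (nu - 1) C2 f)
    (inf_f : 0 < inf (f @` unit_interval))
    (r_ge : sfloor (nu / 2) <= r%:Z)
    (condZ : boosting_cond_exp K h Xs Ys r Z) :
  \forall eps \near (0 : R)^'+,
    stochastic_bigO P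
      (fun n w => ereal_sup [set `|Z n x w - m x|%:E | x in `[eps, 1 - eps]])
      (fun n => h n `^ nu + Num.sqrt (h n * ln n%:R / n%:R)).
Proof.
have [mm _] := regm; have [_ f0 _] := densX.
have f_inf t : 0 < t < 1 -> inf (f @` unit_interval) <= f t.
  move=> /andP[t0 t1]; apply: ge_inf; first by exists 0 => _ [x _ <-].
  by exists t => //; rewrite /unit_interval/= in_itv/= !ltW.
have r_nu : nu <= (2 * r.+1)%:R.
  move: r_ge; rewrite /sfloor lerBlDr => r_ge'.
  have : nu / 2 <= (r%:Z + 1)%:~R by rewrite -ceil_le_int.
  by rewrite ler_pdivrMr// natrM -[r.+1%:R]natr1 intrD mulrC.
near=> eps.
have eps_range : 0 < eps < 2^-1.
  apply/andP; split; first by near: eps; exact: nbhs_right_gt.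
  by near: eps; apply: nbhs_right_lt.
have [C [h1 [rho1 [C0 h10 rho10 rate]]]] := boosting_rate
  (iid_independent_copies iidXY) kerK densX mm nu_ge2 (ltW C1_gt0) (ltW C2_gt0)
  m_class f_class r_nu eps_range inf_f f_inf.
move=> delta delta0; exists C => //.
have [N [mN N0 subN]] := boosting_version iidXY regm kerK h_gt0 condZ.
have bandwidth := bandwidth_eventually h_gt0 h_cvg0 nh_cvg h10 rho10.
near=> n.
have [//|n0 [rho [hn rho_range nhrho hrho [n3h n3rho]]]] := near bandwidth n.
have hn_range : 0 < h n <= h1 by rewrite h_gt0.
have [A [mA PA rateA]] := rate n (h n) rho n0 hn_range rho_range nhrho n3h n3rho.
exists (A `|` N); split; first exact: measurableU.
  apply: (le_trans (measureU2 P mA mN)); rewrite [X in (_ + X)%E]N0 adde0.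
  apply: (le_trans PA); rewrite lee_fin.
  rewrite ler_pdivrMr ?ltr0n// [leRHS]mulrC -ler_pdivrMr//.
  by near: n; exact: (cvgry_ge cvgr_idn).
move=> w; apply: contraPP => /not_orP[wA wN] /=; apply/negP; rewrite -leNgt.
apply: ub_ereal_sup => _ [x + <-]; rewrite /= in_itv/= => x_range.
have [S0 bound] := rateA w wA x x_range.
have Zw : forall n x, 0 < kernel_sum K (h n) n (Xs ^~ w) x ->
    Z n x w = boosting K (h n) n (Xs ^~ w) (fun i => m (Xs i w)) r x.
  by apply: contrapT => /subN.
by rewrite lee_fin Zw// -hrho.
Unshelve. all: by end_near. Qed.
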